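(* Let $\mathcal{A}$ be a sequentially complete locally convex algebra with separately continuous (bilinear) product $\mu\colon\mathcal A\times\mathcal A\to\mathcal A$, and let $\mathcal{E}$ be a sequentially complete locally convex left $\mathcal{A}$-module with separately continuous module structure $\tilde\mu\colon\mathcal{A}\times\mathcal{E}\to\mathcal{E}$, so that $\tilde\mu(\mu(a,b),\psi)=\tilde\mu(a,\tilde\mu(b,\psi))$ for $a,b\in\mathcal A$, $\psi\in\mathcal E$. Let $\alpha$ be a smooth polynomially bounded $\mathbb{R}^n$-action by automorphisms on $\mathcal{A}$, and $\beta$ a smooth polynomially bounded $\mathbb{R}^n$-action on $\mathcal{E}$ such that $$\beta_x(\tilde\mu(a,\psi))=\tilde\mu(\alpha_x(a),\beta_x(\psi)),\qquad a\in\mathcal{A},\ \psi\in\mathcal{E},\ x\in\mathbb{R}^n.$$ Let $\theta\in\mathbb{R}^{n\times n}$ be a real matrix and define, as oscillatory integrals, $$\mu_\theta(a,b):=a\times_\theta b:=(2\pi)^{-n}\int_{\mathbb{R}^{2n}}dp\,dx\,e^{i\langle p,x\rangle}\,\mu(\alpha_{\theta p}(a),\alpha_x(b)),\qquad a,b\in\mathcal{A},$$ $$\tilde\mu_\theta(a,\psi):=a_\theta\psi:=(2\pi)^{-n}\int_{\mathbb{R}^{2n}}dp\,dx\,e^{i\langle p,x\rangle}\,\tilde\mu(\alpha_{\theta p}(a),\beta_x(\psi)),\qquad a\in\mathcal{A},\ \psi\in\mathcal{E}.$$ Let $\mathcal{A}_\theta$ denote the vector space $\mathcal{A}$ with product $\times_\theta$.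 Then: (i) $(\mathcal{E},\tilde\mu_\theta)$ is a left $\mathcal{A}_\theta$-module, i.e. $(a\times_\theta b)_\theta\psi=a_\theta(b_\theta\psi)$ for all $a,b\in\mathcal{A}$, $\psi\in\mathcal{E}$. (ii) If the product $\mu$ of $\mathcal{A}$ is associative, then so is the deformed product $\mu_\theta$.
   Context: All locally convex spaces are complex and Hausdorff. ''Algebra'' means a vector space with a bilinear product, not assumed associative unless stated. Symbols. Let $V$ be a sequentially complete locally convex space and $\mathcal{Q}$ a defining system of seminorms (a set of continuous seminorms generating the topology). An order (resp. type) for $\mathcal{Q}$ is a map $\boldsymbol{m}\colon\mathcal{Q}\to\mathbb{R}$ (resp. $\boldsymbol{\rho}\colon\mathcal{Q}\to\mathbb{R}$); all (in)equalities between orders, types and numbers are meant pointwise on $\mathcal{Q}$. For $F\in C^\infty(\mathbb{R}^n,V)$, $\mathrm{q}\in\mathcal{Q}$, $\mu\in\mathbb{N}_0^n$ put $$\|F\|^{\boldsymbol m,\boldsymbol\rho}_{\mathrm q,\mu}=\sup_{x\in\mathbb{R}^n}(1+\|x\|^2)^{-\frac12(\boldsymbol m(\mathrm q)-\boldsymbol\rho(\mathrm q)|\mu|)}\,\mathrm q(\partial^\mu F(x))\in[0,\infty].$$ $\mathrm S^{\boldsymbol m,\boldsymbol\rho}(\mathbb{R}^n,V)$ is the space of all $F$ for which all these are finite, with the locally convex topology they generate. $\underline{\mathrm S}(\mathbb{R}^{n},V)$ is the union of all $\mathrm S^{\boldsymbol m,\boldsymbol\rho}(\mathbb{R}^{n},V)$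 over all orders $\boldsymbol m$ and all types $\boldsymbol\rho$ with $-1<\boldsymbol\rho\le1$ (independent of the choice of $\mathcal Q$). Oscillatory integral. Fix a non-degenerate bilinear form $\langle p,x\rangle=(p,Mx)$ on $\mathbb{R}^n$, where $(\cdot,\cdot)$ is the Euclidean inner product and $|\det M|=1$. For $F\in C^\infty_0(\mathbb{R}^{2n},V)$ let $I_0(F)=(2\pi)^{-n}\int_{\mathbb{R}^{2n}}dp\,dx\,e^{i\langle p,x\rangle}F(p,x)$ (Riemann integral). For $F\in\mathrm S^{\boldsymbol m,\boldsymbol\rho}(\mathbb{R}^{2n},V)$ with $-1<\boldsymbol\rho\le1$, the oscillatory integral is $I(F)=\lim_j I_0(F_j)\in V$ for any sequence $F_j\in C_0^\infty(\mathbb{R}^{2n},V)$ converging to $F$ in $\mathrm S^{\boldsymbol m',\boldsymbol\rho'}(\mathbb{R}^{2n},V)$ for some $\boldsymbol m'>\boldsymbol m$, $-1<\boldsymbol\rho'\le\boldsymbol\rho$ (such sequences exist and the limit does not depend on the choices). It is written $(2\pi)^{-n}\int_{\mathbb{R}^{2n}}dp\,dx\,e^{i\langle p,x\rangle}F(p,x)$. Actions. Defining systems $\mathcal Q$ are assumed filtrating (any two elements are dominated, up to a constant, by a third). An $\mathbb{R}^n$-action $\alpha\colon\mathbb{R}^n\times V\to V$ by linear maps $\alpha_x$ is smooth polynomially bounded (of order $\boldsymbol m$) if for each $v\in V$ the function $\alpha(v)\colon x\mapsto\alpha_x(v)$ lies in $\mathrm S^{\boldsymbol m,0}(\mathbb{R}^n,V)$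 and $V\ni v\mapsto\alpha(v)\in\mathrm S^{\boldsymbol m,0}(\mathbb{R}^n,V)$ is continuous. The integrands in the deformed product and deformed module structure are elements of $\underline{\mathrm S}(\mathbb{R}^{2n},\mathcal A)$ and $\underline{\mathrm S}(\mathbb{R}^{2n},\mathcal E)$. *)

(* Defs.v *)
From HB Require Import structures.
From mathcomp Require Import all_boot all_order all_algebra complex.
From mathcomp Require Import all_classical all_reals all_analysis.

Set Implicit Arguments.
Unset Strict Implicit.
Unset Printing Implicit Defensive.

Import Order.TTheory GRing.Theory Num.Theory.
Import numFieldNormedType.Exports.

Local Open Scope classical_set_scope.
Local Open Scope ring_scope.
Local Open Scope complex_scope.

(* Complex locally convex spaces are objects of [tvsType R[i]]; R^N is
   ['cV[R]_N] and R^{2n} is ['cV[R]_(n + n)], a point z of the latter being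
   the pair (p, x) = (usubmx z, dsubmx z).  Since R^N is real and V is complex,
   real scalars act on V through the embedding [%:C]. *)

Section LocallyConvexSpaces.
Context {R : realType}.

(* The uniform structure carried by a [tvsType] is only required to induce the
   topology, not to be translation invariant, so that the library's [cauchy]
   is not the notion of a Cauchy sequence of a topological vector space. *)
Definition cauchy_seq (V : tvsType R[i]) (u : nat -> V) : Prop :=
  forall U : set V, nbhs 0 U ->
    exists K : nat, forall j k, (K <= j)%N -> (K <= k)%N -> U (u j - u k).

Definition sequentially_complete (V : tvsType R[i]) : Prop :=
  forall u : nat -> V, cauchy_seq u -> exists v : V, u @ \oo --> v.

Definition seminorm (V : lmodType R[i]) (q : V -> R) : Prop :=
  (forall v w, q (v + w) <= q v + q w) /\
  (forall (a : R[i]) v, (q (a *: v))%:C = `|a| * (q v)%:C).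

Definition defining_system (V : tvsType R[i]) (Q : set (V -> R)) : Prop :=
  (forall q, Q q -> seminorm q /\ continuous q) /\
  (forall U : set V, nbhs 0 U ->
     exists (k : nat) (s : 'I_k -> V -> R) (e : R),
       [/\ 0 < e, forall i, Q (s i)
         & forall v, (forall i, s i v < e) -> U v]).

Definition filtrating (V : Type) (Q : set (V -> R)) : Prop :=
  forall q1 q2, Q q1 -> Q q2 ->
    exists q3 (c : R), Q q3 /\ forall v, q1 v <= c * q3 v /\ q2 v <= c * q3 v.

Definition bilinear_map (U V W : lmodType R[i]) (f : U -> V -> W) : Prop :=
  (forall u, linear (f u)) /\ (forall v, linear (f ^~ v)).

Definition separately_continuous (U V W : topologicalType)
    (f : U -> V -> W) : Prop :=
  (forall u, continuous (f u)) /\ (forall v, continuous (f ^~ v)).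

(* The algebra (A, mu) need not be associative. *)
Definition left_module (A E : lmodType R[i])
    (mu : A -> A -> A) (nu : A -> E -> E) : Prop :=
  bilinear_map nu /\ forall a b psi, nu (mu a b) psi = nu a (nu b psi).

End LocallyConvexSpaces.

Section VectorValuedFunctions.
Context {R : realType} {N : nat} {V : tvsType R[i]}.
Implicit Types (F : 'cV[R]_N -> V) (q : V -> R) (m rho : (V -> R) -> R).

Definition diff_quotient (i : 'I_N) F (x : 'cV[R]_N) (h : R) : V :=
  (h^-1)%:C *: (F (x + h *: delta_mx i 0) - F x).

(* Limits are unique in the Hausdorff spaces considered; as for the two
   integrals below, 0 is a junk value when there is no limit. *)
Definition partial (i : 'I_N) F (x : 'cV[R]_N) : V :=
  xget 0 [set v | diff_quotient i F x h @[h --> 0^'] --> v].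

Definition partials (s : seq 'I_N) F : 'cV[R]_N -> V := foldr partial F s.

Definition smooth F : Prop :=
  forall s : seq 'I_N,
    continuous (partials s F) /\
    forall i x, exists v : V, diff_quotient i (partials s F) x h @[h --> 0^'] --> v.

Definition test_function F : Prop :=
  smooth F /\ compact (closure [set x | F x <> 0]).

Definition midx_partial (mu : {ffun 'I_N -> nat}) F : 'cV[R]_N -> V :=
  foldr (fun i => iter (mu i) (partial i)) F (enum 'I_N).

Definition midx_size (mu : {ffun 'I_N -> nat}) : nat := (\sum_i mu i)%N.

Definition sqnorm (x : 'cV[R]_N) : R := \sum_i x i 0 ^+ 2.

(* Orders and types are maps on the whole type of functions V -> R, but only
   their values on the system of seminorms Q are ever used. *)
Definition symbol_norm m rho q (mu : {ffun 'I_N -> nat}) F : \bar R :=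
  ereal_sup [set ((1 + sqnorm x) `^
                   (- ((m q - rho q * (midx_size mu)%:R) / 2))
                  * q (midx_partial mu F x))%:E | x in [set: 'cV[R]_N]].

Definition symbol (Q : set (V -> R)) m rho F : Prop :=
  smooth F /\ forall q mu, Q q -> (symbol_norm m rho q mu F < +oo)%E.

Definition symbol_cvg (Q : set (V -> R)) m rho
    (G : nat -> 'cV[R]_N -> V) F : Prop :=
  forall q mu, Q q ->
    symbol_norm m rho q mu (fun x => G j x - F x) @[j --> \oo] --> (0 : \bar R).

(* Tagged partitions of the cube [-L, L]^N by a product grid.  The same number
   K of (possibly degenerate) intervals may be taken in all the directions,
   the cell of index c being the product of the intervals
   [t i (c i), t i (c i).+1]. *)
Definition tagged_grid (L : R) (K : nat) (t : 'I_N -> nat -> R)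
    (xi : {ffun 'I_N -> 'I_K} -> 'cV[R]_N) : Prop :=
  [/\ forall i, t i 0%N = - L /\ t i K = L,
      forall i k, (k < K)%N -> t i k <= t i k.+1
    & forall (c : {ffun 'I_N -> 'I_K}) i, t i (c i) <= xi c i 0 <= t i (c i).+1].

Definition riemann_sum (K : nat) (t : 'I_N -> nat -> R)
    (xi : {ffun 'I_N -> 'I_K} -> 'cV[R]_N) F : V :=
  \sum_(c : {ffun 'I_N -> 'I_K})
    (\prod_i (t i (c i).+1 - t i (c i)))%:C *: F (xi c).

Definition is_riemann_integral F (v : V) : Prop :=
  exists L : R,
    [/\ 0 < L,
        forall x : 'cV[R]_N, (exists i, L < `|x i 0|) -> F x = 0
      & forall U : set V, nbhs v U ->
          exists2 d : R, 0 < d &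
            forall K t xi, @tagged_grid L K t xi ->
              (forall i k, (k < K)%N -> t i k.+1 - t i k < d) ->
              U (riemann_sum t xi F)].

Definition riemann_integral F : V := xget 0 (is_riemann_integral F).

End VectorValuedFunctions.

Section OscillatoryIntegrals.
Context {R : realType} {n : nat} {V : tvsType R[i]}.
Variables (Q : set (V -> R)) (M : 'M[R]_n).
Implicit Types F : 'cV[R]_(n + n) -> V.

Definition pairing (p x : 'cV[R]_n) : R := \sum_i p i 0 * (M *m x) i 0.

Definition expi (t : R) : R[i] := cos t +i* sin t.

Definition osc0 F : V :=
  ((2 * pi) ^- n)%:C *:
    riemann_integral (fun z => expi (pairing (usubmx z) (dsubmx z)) *: F z).

Definition admissible_type (rho : (V -> R) -> R) : Prop :=
  forall q, Q q -> -1 < rho q /\ rho q <= 1.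

Definition regularization (m rho : (V -> R) -> R) F
    (G : nat -> 'cV[R]_(n + n) -> V) : Prop :=
  (forall j, test_function (G j)) /\
  exists m' rho' : (V -> R) -> R,
    (forall q, Q q -> [/\ m q < m' q, -1 < rho' q & rho' q <= rho q]) /\
    symbol_cvg Q m' rho' G F.

(* The limit along regularizing sequences; the existence of one of them is
   part of the definition, so that the last clause is never vacuous. *)
Definition is_oscint F (v : V) : Prop :=
  exists m rho : (V -> R) -> R,
    [/\ admissible_type rho,
        symbol Q m rho F,
        exists G, regularization m rho F G
      & forall G, regularization m rho F G -> osc0 (G j) @[j --> \oo] --> v].

Definition oscint F : V := xget 0 (is_oscint F).

End OscillatoryIntegrals.

Section Actions.
Context {R : realType} {n : nat}.

Definition linear_action (V : lmodType R[i])
    (alpha : 'cV[R]_n -> V -> V) : Prop :=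
  [/\ forall x, linear (alpha x),
      forall v, alpha 0 v = v
    & forall x y v, alpha (x + y) v = alpha x (alpha y v)].

(* The last clause is the continuity of v |-> alpha(v) for the topology of S^{m,0} generated by its seminorms. *)
Definition smooth_poly_bounded_action (V : tvsType R[i]) (Q : set (V -> R))
    (m : (V -> R) -> R) (alpha : 'cV[R]_n -> V -> V) : Prop :=
  linear_action alpha /\
  (forall v, symbol Q m (fun=> 0) (alpha ^~ v)) /\
  (forall v q mu (e : R), Q q -> 0 < e ->
     \forall w \near v,
       (symbol_norm m (fun=> 0%R) q mu (fun x => (alpha x w - alpha x v)%R)
          < e%:E)%E).

Definition acts_multiplicatively (A : Type) (mu : A -> A -> A)
    (alpha : 'cV[R]_n -> A -> A) : Prop :=
  forall x a b, alpha x (mu a b) = mu (alpha x a) (alpha x b).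

Definition deformed (A : Type) (V : tvsType R[i]) (Q : set (V -> R))
    (M theta : 'M[R]_n) (alpha : 'cV[R]_n -> A -> A)
    (beta : 'cV[R]_n -> V -> V) (nu : A -> V -> V) (a : A) (v : V) : V :=
  oscint Q M
    (fun z => nu (alpha (theta *m usubmx z) a) (beta (dsubmx z) v)).

End Actions.

(* Main.v *)
(** Lattice sums of mesh 1/(K+1) converge to the Riemann integral of a continuous
function of bounded support.  They make translations, integral unimodular changes
of variables, Fubini and integration by parts elementary, and yield, for a
quadratic phase Q with invertible Hessian and r < 1/2, the estimate
  q (int e^{iQ} G) <= C B   if   q (d_i^j G) <= B w^(m + r j),   w = 1 + |z|^2:
cut G by a partition of unity centred at the integral points k, and integrate by
parts in z - k, where the phase has a linear part of frequency Q''k, of size |k|.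
Hence the oscillatory integral of F is the limit of those of X_j F for the cutoffs
X_j, at the rate 1/j.  This applies to the integrands of the deformed products:
moving one action in front by covariance bounds their growth, in each slot,
independently of the derivatives taken in that slot, and interpolation between
derivatives then lowers the loss in growth to an arbitrarily small r per
derivative.  Both sides of the module identity are limits of integrals over
R^(4n), which the phase-preserving shear
  (p', x', p, x) |-> (p' + p, x, p', x' - x)
identifies up to the cutoffs, and the change of cutoffs is again O(1/j). *)

Require Import Defs.
From HB Require Import structures.
From mathcomp Require Import all_boot all_order all_algebra complex.
From mathcomp Require Import all_classical all_reals all_analysis.
From mathcomp Require Import ring lra zify.
Set Implicit Arguments.
Unset Strict Implicit.
Unset Printing Implicit Defensive.
Import Order.TTheory GRing.Theory Num.Theory.
Import numFieldNormedType.Exports.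
Local Open Scope classical_set_scope.
Local Open Scope ring_scope.
Local Open Scope complex_scope.

(** * Calculus in locally convex spaces *)

(** Two obstacles shape the proof. The product and the module structure are only separately
    continuous: q(nu(a, psi)) need not be bounded by a product of seminorms of a and of psi. A
    growth exponent found for one psi thus says nothing about the derivatives of its orbit, where
    psi is replaced by other elements. Covariance gives exponents uniform in one slot at a time, and
    Landau's inequality between successive derivatives removes their dependence on the remaining
    slots. The price is the loss r, and 1/2 is the break-even point: 2 n integrations by parts gain
    |k|^(2 n), that is w^n, and cost w^(2 n r). This is exactly the condition that types exceed -1,
    since a type rho corresponds to r = - rho / 2. The second obstacle is integration itself, for
    values in a space that is merely sequentially complete. A sum over all of Z^N turns the change
    of variables in R^(4n) into a permutation of the index set, because the shear and its inverse
    have integral entries. *)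

Section Seminorms.
Context {R : realType}.
Local Notation normc := (@ComplexField.Normc.normc R).

Lemma normcE_norm (a : R[i]) : `|a| = (normc a)%:C.
Proof. by []. Qed.

Lemma normc_real (a : R) : normc a%:C = `|a|.
Proof. by rewrite /ComplexField.Normc.normc /= expr0n addr0 sqrtr_sqr. Qed.

Lemma normc_ge0 (a : R[i]) : 0 <= normc a.
Proof. by case: a => a b; rewrite sqrtr_ge0. Qed.

Lemma real_complexI (a b : R) : a%:C = b%:C -> a = b.
Proof. by case. Qed.

Section OneSeminorm.
Variables (V : lmodType R[i]) (q : V -> R).
Hypothesis qsn : seminorm q.

Lemma snD v w : q (v + w) <= q v + q w.
Proof. by case: qsn => + _; apply. Qed.

Lemma snZ (a : R[i]) v : q (a *: v) = normc a * q v.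
Proof. by case: qsn => _ /(_ a v); rewrite normcE_norm -rmorphM; apply: real_complexI. Qed.

Lemma snZr (a : R) v : q (a%:C *: v) = `|a| * q v.
Proof. by rewrite snZ normc_real. Qed.

Lemma sn0 : q 0 = 0.
Proof. by rewrite -(scale0r (0 : V)) -[0]/(0%:C) snZr normr0 mul0r. Qed.

Lemma snN v : q (- v) = q v.
Proof.
have -> : - v = (-1)%:C *: v by rewrite (rmorphN1 (real_complex R)) scaleN1r.
by rewrite snZr normrN1 mul1r.
Qed.

Lemma snBC v w : q (v - w) = q (w - v).
Proof. by rewrite -snN opprB. Qed.

Lemma sn_ge0 v : 0 <= q v.
Proof.
have := snD v (- v); rewrite subrr sn0 snN -mulr2n => H.
by rewrite -(pmulrn_lge0 _ (ltn0Sn 1)).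
Qed.

Lemma snB v w : q (v - w) <= q v + q w.
Proof. by rewrite -(snN w) snD. Qed.

Lemma sn_sum (I : Type) (r : seq I) (P : pred I) (F : I -> V) :
  q (\sum_(i <- r | P i) F i) <= \sum_(i <- r | P i) q (F i).
Proof.
elim/big_rec2: _ => [|i y x _ H]; first by rewrite sn0.
by apply: le_trans (snD _ _) _; rewrite lerD2l.
Qed.

Lemma snD_tri v w z : q (v - z) <= q (v - w) + q (w - z).
Proof. by have := snD (v - w) (w - z); rewrite addrA subrK. Qed.

Lemma sn_lip v w : `|q v - q w| <= q (v - w).
Proof.
have := snD_tri v w 0; have := snD_tri w v 0; rewrite !subr0 (snBC w v) => H1 H2.
by rewrite ler_norml; lra.
Qed.

End OneSeminorm.

Lemma sn_normc : seminorm (normc : R[i]^o -> R).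
Proof.
split=> [v w|a v].
  by apply: le_normcD.
by rewrite normcE_norm -rmorphM -ComplexField.Normc.normcM.
Qed.

End Seminorms.

Section TopologyBySeminorms.
Context {R : realType} (V : tvsType R[i]) (Q : set (V -> R)).
Hypothesis Qdef : defining_system Q.

Lemma Qsn q : Q q -> seminorm q.
Proof. by case: Qdef => + _ => /[apply] -[]. Qed.

Lemma Qcont q : Q q -> continuous q.
Proof. by case: Qdef => + _ => /[apply] -[]. Qed.

(** Limits are handled through this criterion, never through the uniform structure of [V]. As [Q]
    describes only the neighbourhoods of 0, those of v are brought there by continuity of
    addition. *)
Lemma cvgQ (T : Type) (F : set_system T) {FF : Filter F} (f : T -> V) v :
  f x @[x --> F] --> v <->
  (forall q, Q q -> q (f x - v) @[x --> F] --> (0 : R)).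
Proof.
split=> [H q Hq|H U nU].
  have -> : 0 = q (v - v) by rewrite subrr (sn0 (Qsn Hq)).
  apply: continuous_cvg; first exact: Qcont.
  have Hs := @sub_continuous V (v, v).
  apply: (@continuous2_cvg _ _ _ _ F FF f (fun=> v) (fun x y : V => x - y)) => //.
  exact: cvg_cst.
have nU0 : nbhs 0 [set w | U (v + w)].
  have Ha := @add_continuous V (v, 0).
  have : (fun w => v + w) x @[x --> (0:V)] --> v + 0.
    apply: (@continuous2_cvg _ _ _ _ _ _ (fun=> v) id (fun x y : V => x + y)) => //.
    exact: cvg_cst.
  by move=> /(_ U); rewrite addr0; apply.
case: Qdef => _ /(_ _ nU0) [k [s [e [e0 Hs HU]]]].
have : \forall x \near F, forall i, s i (f x - v) < e.
  apply: filter_forall => i; have /cvgrPdist_lt/(_ e e0) := H _ (Hs i).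
  by apply: filterS => x; rewrite sub0r normrN; apply: le_lt_trans; exact: ler_norm.
by apply: filterS => x /HU /=; rewrite addrC subrK.
Qed.

Lemma cvgQ_lt (T : Type) (F : set_system T) {FF : Filter F} (f : T -> V) v :
  f x @[x --> F] --> v <->
  (forall q e, Q q -> 0 < e -> \forall x \near F, q (f x - v) < e).
Proof.
rewrite cvgQ; split=> H.
  move=> q e Hq e0; have /cvgrPdist_lt/(_ e e0) := H _ Hq.
  by apply: filterS => x; rewrite sub0r normrN; apply: le_lt_trans; exact: ler_norm.
move=> q Hq; apply/cvgrPdist_lt => e e0; have := H q e Hq e0.
by apply: filterS => x; rewrite sub0r normrN ger0_norm // (sn_ge0 (Qsn Hq)).
Qed.

Lemma cvg_unV (hV : hausdorff_space V) (T : Type) (F : set_system T) {FF : ProperFilter F}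
   (f : T -> V) (v w : V) :
  f x @[x --> F] --> v -> f x @[x --> F] --> w -> v = w.
Proof. by move=> H1 H2; apply: (cvg_unique hV H1 H2). Qed.

Lemma sepQ (hV : hausdorff_space V) v w : (forall q, Q q -> q (v - w) = 0) -> v = w.
Proof.
move=> H; apply: (@cvg_unV hV nat \oo _ (fun=> v)); first exact: cvg_cst.
apply/cvgQ => q Hq; rewrite (_ : (fun _ => _) = (fun=> 0)); first exact: cvg_cst.
by apply/funext => ?; rewrite H.
Qed.

Lemma cvgV_add (T : Type) (F : set_system T) {FF : Filter F} (f g : T -> V) v w :
  f x @[x --> F] --> v -> g x @[x --> F] --> w -> f x + g x @[x --> F] --> v + w.
Proof.
move=> H1 H2; apply: (@continuous2_cvg _ _ _ _ F FF f g (fun x y : V => x + y)) => //.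
exact: (@add_continuous V (v, w)).
Qed.

Lemma cvgV_sub (T : Type) (F : set_system T) {FF : Filter F} (f g : T -> V) v w :
  f x @[x --> F] --> v -> g x @[x --> F] --> w -> f x - g x @[x --> F] --> v - w.
Proof.
move=> H1 H2; apply: (@continuous2_cvg _ _ _ _ F FF f g (fun x y : V => x - y)) => //.
exact: (@sub_continuous V (v, w)).
Qed.

Lemma cvgV_scale (T : Type) (F : set_system T) {FF : Filter F} (f : T -> R[i]^o) (g : T -> V) (a : R[i]^o) (w : V) :
  f x @[x --> F] --> a -> g x @[x --> F] --> w -> (f x : R[i]) *: g x @[x --> F] --> (a : R[i]) *: w.
Proof.
move=> H1 H2; apply: (@continuous2_cvg _ _ _ _ F FF f g (fun x (y : V) => x *: y)) => //.
exact: (@scale_continuous _ V (a, w)).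
Qed.

Lemma cvgV_scalec (T : Type) (F : set_system T) {FF : Filter F} (a : R[i]) (g : T -> V) w :
  g x @[x --> F] --> w -> a *: g x @[x --> F] --> a *: w.
Proof. by move=> H; apply: cvgV_scale => //; exact: cvg_cst. Qed.

End TopologyBySeminorms.

Section ScalarSeminorm.
Context {R : realType}.
Local Notation normc := (@ComplexField.Normc.normc R).

(** Makes the scalars one of the spaces [V], so that cutoffs and phases are differentiated and
    bounded by the lemmas on vector-valued functions. *)
Lemma defsys_normc : defining_system [set (normc : R[i]^o -> R)].
Proof.
split=> [q ->|U].
  split; first exact: sn_normc.
  move=> x; apply/(@cvgrPdist_lt _ _ _ _ (nbhs_filter x)) => e e0.
  have /cvgrPdist_lt/(_ e%:C) := @cvg_id _ (nbhs (x : R[i]^o)); rewrite ltcR => /(_ e0).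
  apply: (@filterS _ _ (nbhs_filter x)) => y; rewrite normcE_norm ltcR.
  by apply: le_lt_trans; exact: (sn_lip sn_normc).
move=> /nbhs_normP [e /= e0 HU].
have [er ee] : exists er : R, e = er%:C.
  by exists (complex.Re e); rewrite RRe_real // gtr0_real.
exists 1%N, (fun=> normc), er; split=> //.
- by rewrite -ltcR -ee.
- move=> v /(_ ord0) H; apply: HU; rewrite /= /ball_ sub0r normrN.
  by rewrite ee normcE_norm ltcR.
Qed.

End ScalarSeminorm.

Section MeanValue.
Context {R : realType} (V : tvsType R[i]) (Q : set (V -> R)).
Hypothesis Qdef : defining_system Q.

Lemma near0'P (P : R -> Prop) :
  (\forall h \near 0^', P h) <->
  (exists2 d : R, 0 < d & forall h, h != 0 -> `|h| < d -> P h).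
Proof.
split=> [/nbhs_ballP [d /= d0 H]|[d d0 H]].
  exists d => // h h0 hd; apply: H => //.
  by rewrite /ball /= sub0r normrN.
apply/nbhs_ballP; exists d => //= h; rewrite /ball /= sub0r normrN => hd h0.
exact: H.
Qed.

Definition rderiv (f : R -> V) (t : R) (v : V) :=
  (h^-1)%:C *: (f (t + h) - f t) @[h --> 0^'] --> v.

Lemma rderiv_local q (f : R -> V) t v C : Q q -> rderiv f t v -> q v < C ->
  exists2 d : R, 0 < d & forall h, `|h| < d -> q (f (t + h) - f t) <= C * `|h|.
Proof.
move=> Hq /(cvgQ_lt Qdef)/(_ q (C - q v) Hq); rewrite subr_gt0 => H /H /near0'P[d d0 Hd].
exists d => // h hd; have [->|h0] := eqVneq h 0.
  by rewrite addr0 subrr (sn0 (Qsn Qdef Hq)) normr0 mulr0.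
have Hs := Qsn Qdef Hq.
have := Hd h h0 hd; have := snD_tri Hs ((h^-1)%:C *: (f (t + h) - f t)) v 0.
rewrite !subr0 (snZr Hs) normrV ?unitfE // => H1 H2.
have : `|h|^-1 * q (f (t + h) - f t) <= C by lra.
by rewrite mulrC ler_pdivrMr ?normr_gt0.
Qed.

(** Proved without linear functionals: the t for which the increment of f from a is at most C' (t -
    a) contain their supremum, and by [rderiv_local] one can go beyond it unless it is b. *)
Lemma mvi q (f f' : R -> V) a b C : Q q -> a <= b ->
  (forall t, a <= t <= b -> rderiv f t (f' t)) ->
  (forall t, a <= t <= b -> q (f' t) <= C) -> q (f b - f a) <= C * (b - a).
Proof.
move=> Hq ab Hf HC; have Hs := Qsn Qdef Hq.
(* A constant above the bound leaves room for a local increase at each point. The denominator b - a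
   + 1 also covers a = b. *)
suff HC0 C' : C < C' -> q (f b - f a) <= C' * (b - a).
  apply/ler_addgt0Pr => e e0; have ba : 0 < b - a + 1 by lra.
  have := HC0 (C + e / (b - a + 1)); rewrite ltrDl divr_gt0 // => /(_ isT) H.
  apply: le_trans H _; rewrite mulrDl lerD2l -[leRHS]mulr1 -mulrA ler_wpM2l //; first by lra.
  by rewrite mulrC ler_pdivrMr // mul1r; lra.
move=> CC'.
pose S := [set t | a <= t <= b /\ q (f t - f a) <= C' * (t - a)].
have Sa : S a by split; [rewrite lexx|rewrite !subrr (sn0 Hs) mulr0].
have hS : has_sup S by split; [exists a|exists b => t [/andP[]]].
pose t0 := sup S.
have at0 : a <= t0 by apply: (ub_le_sup hS.2).
have t0b : t0 <= b by apply: ge_sup; [exists a|move=> t [/andP[]]].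
have [d d0 Hd] := rderiv_local Hq (Hf t0 ltac:(rewrite at0 t0b //)) (le_lt_trans (HC t0 ltac:(rewrite at0 t0b //)) CC').
have St0 : q (f t0 - f a) <= C' * (t0 - a).
  have [t [St1 St2] tt0] := sup_adherent d0 hS.
  have tle : t <= t0 by apply: (ub_le_sup hS.2).
  have := Hd (t - t0); rewrite distrC ger0_norm ?subr_ge0 // => /(_ ltac:(rewrite -/t0 in tt0; lra)).
  rewrite [t0 + _]addrC subrK (snBC Hs) => H.
  by have := snD_tri Hs (f t0) (f t) (f a); nra.
have [t0b'|] := ltP t0 b; last first.
  by move=> bt0; have -> : b = t0 by apply/le_anti; rewrite bt0 t0b.
exfalso.
pose h := Num.min (d / 2) (b - t0).
have h0 : 0 < h by rewrite lt_min divr_gt0 //= subr_gt0.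
have hd : h < d by rewrite gt_min; apply/orP; left; lra.
have hb : h <= b - t0 by rewrite ge_min lexx orbT.
have : S (t0 + h).
  split; first by apply/andP; split; lra.
  have := Hd h; rewrite gtr0_norm // => /(_ hd) H.
  by have := snD_tri Hs (f (t0 + h)) (f t0) (f a); lra.
by move=> /(ub_le_sup hS.2); rewrite -/t0; lra.
Qed.

Lemma subrACA (U : zmodType) (a b c d : U) : (a - b) - (c - d) = (a - c) - (b - d).
Proof. by rewrite !opprB !addrA [LHS]addrAC [RHS]addrAC (addrAC a). Qed.

Lemma cvg_eqn (T : Type) (U : topologicalType) (F : set_system T) {FF : Filter F} (f g : T -> U) (l : U) :
  (\forall x \near F, f x = g x) -> g x @[x --> F] --> l -> f x @[x --> F] --> l.
Proof.
move=> H; apply: cvg_trans; apply: near_eq_cvg.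
by move: H; apply: filterS => x ->.
Qed.

Lemma rderiv_sub_lin (f : R -> V) t v w : rderiv f t v ->
  rderiv (fun s => f s - s%:C *: w) t (v - w).
Proof.
move=> H; apply: (@cvg_eqn _ _ _ _ _ (fun h => (h^-1)%:C *: (f (t + h) - f t) - w)).
  apply/near0'P; exists 1 => // h h0 _.
  rewrite subrACA -scalerBl -rmorphB (_ : t + h - t = h); last by ring.
  by rewrite [LHS]scalerBr [in LHS]scalerA -rmorphM mulVf // scale1r.
by apply: cvgV_sub => //; exact: cvg_cst.
Qed.

Lemma taylor1 q (f f' : R -> V) a b v C : Q q -> a <= b ->
  (forall t, a <= t <= b -> rderiv f t (f' t)) ->
  (forall t, a <= t <= b -> q (f' t - v) <= C) ->
  q (f b - f a - (b - a)%:C *: v) <= C * (b - a).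
Proof.
move=> Hq ab Hf HC.
have := @mvi q (fun s => f s - s%:C *: v) (fun t => f' t - v) a b C Hq ab.
move=> /(_ _ HC) H; have : q (f b - b%:C *: v - (f a - a%:C *: v)) <= C * (b - a).
  by apply: H => t Ht; apply: rderiv_sub_lin; exact: Hf.
by rewrite subrACA -scalerBl -rmorphB.
Qed.

End MeanValue.

Section Partials.
Context {R : realType} (V : tvsType R[i]) (Q : set (V -> R)).
Hypothesis Qdef : defining_system Q.
Hypothesis hV : hausdorff_space V.
Variable N : nat.
Implicit Types F G : 'cV[R]_N -> V.

Local Notation e_ i := (delta_mx i 0 : 'cV[R]_N).

Definition pd (i : 'I_N) F (x : 'cV[R]_N) (v : V) :=
  diff_quotient i F x h @[h --> 0^'] --> v.

Lemma pd_partial i F x v : pd i F x v -> partial i F x = v.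
Proof.
move=> H; rewrite /partial; apply: xget_unique => // w Hw.
exact: (cvg_unV hV Hw H).
Qed.

Lemma partial_pd i F x : (exists v, pd i F x v) -> pd i F x (partial i F x).
Proof. by move=> [v Hv]; rewrite (pd_partial Hv). Qed.

Lemma pd_fun i F F' : (forall x, pd i F x (F' x)) -> partial i F = F'.
Proof. by move=> H; apply/funext => x; exact: pd_partial. Qed.

Lemma smooth_cont F : smooth F -> continuous F.
Proof. by move=> /(_ [::]) []. Qed.

Lemma smooth_pd F i x : smooth F -> pd i F x (partial i F x).
Proof. by move=> /(_ [::]) [_ H]; apply: partial_pd; exact: H. Qed.

Lemma partials_cat s t F : partials (s ++ t) F = partials s (partials t F).
Proof. by rewrite /partials foldr_cat. Qed.

Lemma partials_rcons s i F : partials (rcons s i) F = partials s (partial i F).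
Proof. by rewrite -cats1 partials_cat. Qed.

Lemma smooth_partials s F : smooth F -> smooth (partials s F).
Proof. by move=> H t; rewrite -partials_cat; exact: H. Qed.

Lemma smooth_partial i F : smooth F -> smooth (partial i F).
Proof. exact: (@smooth_partials [:: i]). Qed.

(** [smooth] speaks of all iterated partial derivatives, so it is proved by exhibiting a class
    stable under differentiation. The Leibniz and chain rules produce sums, hence the linear span;
    see [lspan_smooth]. *)
Inductive lspan (B : set ('cV[R]_N -> V)) : ('cV[R]_N -> V) -> Prop :=
| lspan_0 : lspan B (fun=> 0)
| lspan_base F : B F -> lspan B F
| lspan_D F G : lspan B F -> lspan B G -> lspan B (fun x => F x + G x)
| lspan_Z a F : lspan B F -> lspan B (fun x => a *: F x).

Lemma pd_D i F G x v w : pd i F x v -> pd i G x w -> pd i (fun y => F y + G y) x (v + w).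
Proof.
move=> HF HG; apply: (cvg_eqn _ (cvgV_add HF HG)); apply: filterE => h.
by rewrite /diff_quotient -scalerDr opprD addrACA.
Qed.

Lemma pd_Z i F x a v : pd i F x v -> pd i (fun y => a *: F y) x (a *: v).
Proof.
move=> HF; apply: (cvg_eqn _ (cvgV_scalec (a := a) HF)); apply: filterE => h.
by rewrite /diff_quotient -scalerBr !scalerA mulrC.
Qed.

Lemma pd_cst i v x : pd i (fun=> v) x 0.
Proof.
apply: (cvg_eqn _ (cvg_cst _)); apply: filterE => h.
by rewrite /diff_quotient subrr scaler0.
Qed.

Lemma contV_D F G : continuous F -> continuous G -> continuous (fun x => F x + G x).
Proof. by move=> HF HG x; exact: (cvgV_add (HF x) (HG x)). Qed.

Lemma contV_Z a F : continuous F -> continuous (fun x => a *: F x).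
Proof. by move=> HF x; exact: (cvgV_scalec (a := a) (HF x)). Qed.

Lemma contV_cst (v : V) : continuous ((fun=> v) : 'cV[R]_N -> V).
Proof. exact: cst_continuous. Qed.

Lemma lspan_smooth (B : set ('cV[R]_N -> V)) :
  (forall F, B F -> continuous F) ->
  (forall F i, B F -> exists2 F', (forall x, pd i F x (F' x)) & lspan B F') ->
  forall F, lspan B F -> smooth F.
Proof.
move=> Bc Bd; have lc F : lspan B F -> continuous F.
  elim=> [|G /Bc //|G H _ ? _ ?|a G _ ?].
  - exact: contV_cst.
  - exact: contV_D.
  - exact: contV_Z.
have ld F i : lspan B F -> exists2 F', (forall x, pd i F x (F' x)) & lspan B F'.
  elim=> [|G /Bd //|G H _ [G' G1 G2] _ [H' H1 H2]|a G _ [G' G1 G2]].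
  - by exists (fun=> 0) => [x|]; [exact: pd_cst|exact: lspan_0].
  - exists (fun x => G' x + H' x) => [x|]; first exact: pd_D.
    exact: lspan_D.
  - by exists (fun x => a *: G' x) => [x|]; [exact: pd_Z|exact: lspan_Z].
move=> F HF s; have {}HF : lspan B (partials s F).
  elim: s => [//|i s IH] /=; have [F' /pd_fun F1 F2] := ld _ i IH.
  by rewrite F1.
split; first exact: lc.
by move=> i x; have [F' F1 F2] := ld _ i HF; exists (F' x); exact: F1.
Qed.

Lemma smooth_lspan F : lspan (@smooth R N V) F -> smooth F.
Proof.
move=> HF; apply: (lspan_smooth _ _ HF); first exact: smooth_cont.
move=> G i HG; exists (partial i G) => [x|]; first exact: smooth_pd.
by apply: lspan_base; exact: smooth_partial.
Qed.

Lemma smooth_D F G : smooth F -> smooth G -> smooth (fun x => F x + G x).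
Proof. by move=> HF HG; apply: smooth_lspan; apply: lspan_D; exact: lspan_base. Qed.

Lemma smooth_Z a F : smooth F -> smooth (fun x => a *: F x).
Proof. by move=> HF; apply: smooth_lspan; apply: lspan_Z; exact: lspan_base. Qed.

Lemma smooth_cst (v : V) : smooth ((fun=> v) : 'cV[R]_N -> V).
Proof.
apply: (@lspan_smooth [set F | exists w, F = fun=> w]); last by apply: lspan_base; exists v.
  by move=> _ [w ->]; exact: contV_cst.
by move=> _ i [w ->]; exists (fun=> 0) => [x|]; [exact: pd_cst|exact: lspan_0].
Qed.

Lemma smooth_B F G : smooth F -> smooth G -> smooth (fun x => F x - G x).
Proof.
move=> HF HG; have := smooth_D HF (smooth_Z (-1) HG).
by under eq_fun do rewrite scaleN1r.
Qed.

Lemma partials_D s F G : smooth F -> smooth G ->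
  partials s (fun x => F x + G x) = (fun x => partials s F x + partials s G x).
Proof.
move=> HF HG; elim: s => [//|i s IH] /=; rewrite IH; apply: pd_fun => x.
by apply: pd_D; apply: smooth_pd; exact: smooth_partials.
Qed.

Lemma partials_Z s a F : smooth F ->
  partials s (fun x => a *: F x) = (fun x => a *: partials s F x).
Proof.
move=> HF; elim: s => [//|i s IH] /=; rewrite IH; apply: pd_fun => x.
by apply: pd_Z; apply: smooth_pd; exact: smooth_partials.
Qed.

Lemma partials_B s F G : smooth F -> smooth G ->
  partials s (fun x => F x - G x) = (fun x => partials s F x - partials s G x).
Proof.
move=> HF HG; have := partials_D s HF (smooth_Z (-1) HG); rewrite partials_Z //.
by under eq_fun do rewrite scaleN1r; move=> ->; apply/funext => x; rewrite scaleN1r.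
Qed.

Lemma near_cV (x : 'cV[R]_N) (P : 'cV[R]_N -> Prop) :
  (\forall y \near x, P y) <->
  (exists2 d : R, 0 < d & forall y : 'cV[R]_N, (forall i, `|y i 0 - x i 0| < d) -> P y).
Proof.
split=> [/nbhs_ballP [d /= d0 H]|[d d0 H]].
  exists d => // y Hy; apply: H; split=> // i j.
  by rewrite (ord1 j) /ball /= distrC.
apply/nbhs_ballP; exists d => //= y [_ Hy]; apply: H => i.
by rewrite distrC; exact: Hy.
Qed.

Lemma contP F : continuous F <-> (forall q (x : 'cV[R]_N) (e : R), Q q -> 0 < e ->
  exists2 d : R, 0 < d & forall y : 'cV[R]_N, (forall i, `|y i 0 - x i 0| < d) -> q (F y - F x) < e).
Proof.
split=> [HF q x e Hq e0|H x].
  by have /(cvgQ_lt Qdef)/(_ q e Hq e0)/near_cV := HF x.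
by apply/(@cvgQ_lt _ _ _ Qdef _ _ (nbhs_filter x)) => q e Hq e0; apply/near_cV; exact: H.
Qed.

Lemma e_E i j : e_ i j 0 = (i == j)%:R.
Proof. by rewrite mxE eqxx andbT eq_sym. Qed.

Lemma pd_line i F x t v : pd i F (x + t *: e_ i) v -> rderiv (fun t => F (x + t *: e_ i)) t v.
Proof.
by move=> H; apply: (cvg_eqn _ H); apply: filterE => h; rewrite /diff_quotient scalerDl addrA.
Qed.

Lemma line_taylor q i F (F' : 'cV[R]_N -> V) x h v C : Q q ->
  (forall y, pd i F y (F' y)) ->
  (forall t, `|t| <= `|h| -> q (F' (x + t *: e_ i) - v) <= C) ->
  q (F (x + h *: e_ i) - F x - h%:C *: v) <= C * `|h|.
Proof.
move=> Hq HF HC; have Hs := Qsn Qdef Hq; have [h0|h0] := leP 0 h.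
  have := @taylor1 _ _ _ Qdef q (fun t => F (x + t *: e_ i)) (fun t => F' (x + t *: e_ i)) 0 h v C Hq h0.
  rewrite scale0r addr0 subr0 (ger0_norm h0); apply.
    by move=> t _; apply: pd_line; exact: HF.
  by move=> t /andP[t0 th]; apply: HC; rewrite !ger0_norm.
have := @taylor1 _ _ _ Qdef q (fun t => F (x + t *: e_ i)) (fun t => F' (x + t *: e_ i)) h 0 v C Hq (ltW h0).
rewrite scale0r addr0 sub0r ltr0_norm // => H; rewrite -(snN Hs).
have -> : - (F (x + h *: e_ i) - F x - h%:C *: v) = F x - F (x + h *: e_ i) - (- h)%:C *: v.
  by rewrite !opprD !opprK addrAC [in RHS]addrAC rmorphN scaleNr opprK [in RHS]addrC addrA [in RHS]addrAC addrC addrA.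
apply: H; first by move=> t _; apply: pd_line; exact: HF.
by move=> t /andP[t0 th]; apply: HC; rewrite !ler0_norm ?lerN2 // ltW.
Qed.

Lemma line_mvi q i F (F' : 'cV[R]_N -> V) x h C : Q q ->
  (forall y, pd i F y (F' y)) ->
  (forall t, `|t| <= `|h| -> q (F' (x + t *: e_ i)) <= C) ->
  q (F (x + h *: e_ i) - F x) <= C * `|h|.
Proof.
move=> Hq HF HC; have := @line_taylor q i F F' x h 0 C Hq HF.
by rewrite scaler0 subr0; apply => t Ht; rewrite subr0; exact: HC.
Qed.

Lemma norm_e i (t : R) j : `|(t *: e_ i) j 0| <= `|t|.
Proof.
by rewrite mxE e_E normrM -[leRHS]mulr1 ler_wpM2l //; case: eqP; rewrite ?normr1 ?normr0 ?ler01.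
Qed.

(* The increments of the coordinates are added one at a time. *)
Lemma dir_deriv F (F' : 'I_N -> 'cV[R]_N -> V) (u x : 'cV[R]_N) :
  (forall i y, pd i F y (F' i y)) -> (forall i, continuous (F' i)) ->
  (h^-1)%:C *: (F (x + h *: u) - F x) @[h --> 0^'] --> \sum_i (u i 0)%:C *: F' i x.
Proof.
move=> HF HC.
suff H (l : seq 'I_N) : (h^-1)%:C *: (F (x + h *: \sum_(i <- l) u i 0 *: e_ i) - F x) @[h --> 0^']
     --> \sum_(i <- l) (u i 0)%:C *: F' i x.
  have -> : u = \sum_i u i 0 *: e_ i.
    apply/colP => k; rewrite summxE (bigD1 k) //= big1 => [|i ik]; rewrite mxE e_E ?eqxx ?mulr1 ?addr0 //.
    by rewrite (negbTE ik) mulr0.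
  have := H (index_enum 'I_N); congr (_ --> _); last first.
  by apply: eq_bigr => i _; rewrite summxE (bigD1 i) //= big1 => [|j ji]; rewrite mxE e_E ?eqxx ?mulr1 ?addr0 // (negbTE ji) mulr0.
elim: l => [|j l IH].
  rewrite !big_nil; apply: (@cvg_eqn _ _ _ _ _ (fun=> 0)); last exact: cvg_cst.
  by apply: filterE => h; rewrite scaler0 addr0 subrr scaler0.
set s := \sum_(i <- l) _ in IH; rewrite !big_cons -/s.
pose D h := (h^-1)%:C *: (F (x + h *: s + (h * u j 0) *: e_ j) - F (x + h *: s)).
suff HD : D h @[h --> 0^'] --> (u j 0)%:C *: F' j x.
  apply: (cvg_eqn _ (cvgV_add HD IH)); apply: filterE => h.
  have -> : x + h *: (u j 0 *: e_ j + s) = x + h *: s + (h * u j 0) *: e_ j.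
    by rewrite scalerDr scalerA -[RHS]addrA; congr (_ + _); exact: addrC.
  by rewrite /D -scalerDr addrA subrK.
apply/(cvgQ_lt Qdef) => q e Hq e0; have Hs := Qsn Qdef Hq.
pose ee := e / (`|u j 0| + 1).
have u1 : 0 < `|u j 0| + 1 by rewrite ltr_wpDl.
have ee0 : 0 < ee by rewrite divr_gt0.
have [d d0 Hd] := (iffLR (contP (F' j))) (HC j) q x ee Hq ee0.
(* When |t| <= |h u_j|, the coordinates of h s + t e_j are at most |h| M, so the whole segment stays
   where F'_j differs from its value at x by less than [ee]. *)
pose M := \sum_i `|s i 0| + `|u j 0| + 1.
have M0 : 0 < M by rewrite /M ltr_wpDl // addr_ge0 // sumr_ge0.
apply/near0'P; exists (d / M); first exact: divr_gt0.
move=> h h0 hd.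
have hM : `|h| * M < d by rewrite -ltr_pdivlMr.
have := @line_taylor q j F (F' j) (x + h *: s) (h * u j 0) (F' j x) ee Hq (HF j).
have Hb t : `|t| <= `|h * u j 0| -> q (F' j (x + h *: s + t *: e_ j) - F' j x) <= ee.
  move=> ht; apply/ltW/Hd => i.
  rewrite -addrA [(x + _) i 0]mxE addrAC subrr add0r mxE (le_lt_trans (ler_normD _ _)) //.
  apply: le_lt_trans hM; rewrite mulrDr mulr1 mulrDr.
  have H1 := le_trans (norm_e j t i) ht; rewrite normrM in H1.
  have H2 : `|(h *: s) i 0| <= `|h| * \sum_i `|s i 0|.
    rewrite mxE normrM ler_wpM2l // (bigD1 i) //= lerDl sumr_ge0 //.
  by have := normr_ge0 h; lra.
move=> /(_ Hb) H.
have -> : D h - (u j 0)%:C *: F' j x = (h^-1)%:C *: (F (x + h *: s + (h * u j 0) *: e_ j) - F (x + h *: s) - (h * u j 0)%:C *: F' j x).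
  by rewrite [RHS]scalerBr scalerA -rmorphM mulrA mulVf // mul1r.
rewrite (snZr Hs) normrV ?unitfE // mulrC ltr_pdivrMr ?normr_gt0 //.
apply: le_lt_trans H _; rewrite normrM /ee.
have hp : 0 < `|h| by rewrite normr_gt0.
rewrite mulrAC ltr_pdivrMr // -subr_gt0.
have -> : e * `|h| * (`|u j 0| + 1) - e * (`|h| * `|u j 0|) = e * `|h| by ring.
exact: mulr_gt0.
Qed.

End Partials.

Section CvgColumn.
Context {R : realType} (N : nat).

Lemma cvg_cV (T : Type) (F : set_system T) {FF : Filter F} (f : T -> 'cV[R]_N) (x : 'cV[R]_N) :
  (forall i, f t i 0 @[t --> F] --> (x i 0 : R)) -> f t @[t --> F] --> x.
Proof.
move=> H U /near_cV [d d0 Hd].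
have : \forall t \near F, forall i, `|f t i 0 - x i 0| < d.
  apply: filter_forall => i; have /cvgrPdist_lt/(_ d d0) := H i.
  by apply: filterS => t; rewrite distrC.
by apply: filterS => t; exact: Hd.
Qed.

Lemma cvg_coord (T : Type) (F : set_system T) {FF : Filter F} (f : T -> 'cV[R]_N) (x : 'cV[R]_N) i :
  f t @[t --> F] --> x -> f t i 0 @[t --> F] --> (x i 0 : R).
Proof.
move=> H; apply: (cvg_comp _ (fun y : 'cV[R]_N => y i 0) H).
exact: (@coord_continuous R N 1 i 0 x).
Qed.

Lemma cvgR_sum (T : Type) (F : set_system T) {FF : Filter F} (I : Type) (r : seq I) (f : I -> T -> R) v :
  (forall i, f i x @[x --> F] --> v i) ->
  \sum_(i <- r) f i x @[x --> F] --> \sum_(i <- r) v i.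
Proof.
move=> H; elim: r => [|i r IH].
  by rewrite big_nil; under eq_fun do rewrite big_nil; exact: cvg_cst.
by rewrite big_cons; under eq_fun do rewrite big_cons; exact: cvgD.
Qed.

Lemma cont_aff N' (A : 'M[R]_(N, N')) (c : 'cV[R]_N) : continuous (fun y : 'cV[R]_N' => c + A *m y).
Proof.
move=> y; apply: (@cvg_cV _ _ (nbhs_filter y)) => i.
rewrite mxE (_ : (fun _ => _) = fun t : 'cV[R]_N' => c i 0 + \sum_j A i j * t j 0); last first.
  by apply/funext => t; rewrite !mxE.
apply: (@cvgD _ _ _ _ (nbhs_filter y)); first exact: cst_continuous.
rewrite mxE; apply: (@cvgR_sum _ _ (nbhs_filter y)) => j.
apply: (@cvgM _ _ _ (nbhs_filter y)); first exact: cst_continuous.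
exact: (@coord_continuous R N' 1 j 0 y).
Qed.

End CvgColumn.

Section Chain.
Context {R : realType} (V : tvsType R[i]) (Q : set (V -> R)).
Hypothesis Qdef : defining_system Q.
Hypothesis hV : hausdorff_space V.
Variables N N' : nat.

Lemma pd_aff (A : 'M[R]_(N, N')) c (F : 'cV[R]_N -> V) i y : smooth F ->
  pd i (fun y : 'cV[R]_N' => F (c + A *m y)) y
     (\sum_j (A j i)%:C *: partial j F (c + A *m y)).
Proof.
move=> HF.
have := @dir_deriv _ _ _ Qdef _ F (fun j => partial j F) (col i A) (c + A *m y) (fun j x => smooth_pd hV HF) (fun j => smooth_cont (smooth_partial j HF)).
rewrite (_ : \sum_i0 _ = \sum_j (A j i)%:C *: partial j F (c + A *m y)); last first.
  by apply: eq_bigr => j _; rewrite mxE.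
apply: cvg_eqn; apply: filterE => h; rewrite /diff_quotient.
by rewrite mulmxDr -scalemxAr -colE addrA.
Qed.

Lemma lspan_sum (B : set ('cV[R]_N' -> V)) (I : Type) (r : seq I) (F : I -> 'cV[R]_N' -> V) :
  (forall i, lspan B (F i)) -> lspan B (fun x => \sum_(i <- r) F i x).
Proof.
move=> H; elim: r => [|i r IH].
  by under eq_fun do rewrite big_nil; exact: lspan_0.
by under eq_fun do rewrite big_cons; exact: lspan_D.
Qed.

Lemma smooth_aff (A : 'M[R]_(N, N')) c (F : 'cV[R]_N -> V) : smooth F ->
  smooth (fun y : 'cV[R]_N' => F (c + A *m y)).
Proof.
move=> HF.
apply: (lspan_smooth hV (B := [set G | exists2 F : 'cV[R]_N -> V, smooth F & G = fun y => F (c + A *m y)]));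
  last by apply: lspan_base; exists F.
- move=> _ [G HG ->] y; apply: (cvg_comp _ G (@cont_aff R N N' A c y)).
  exact: (smooth_cont HG).
- move=> _ i [G HG ->]; exists (fun y => \sum_j (A j i)%:C *: partial j G (c + A *m y)).
    by move=> x; exact: pd_aff.
  apply: lspan_sum => j; apply: lspan_Z; apply: lspan_base; exists (partial j G) => //.
  exact: smooth_partial.
Qed.

Lemma partial_aff (A : 'M[R]_(N, N')) c (F : 'cV[R]_N -> V) i : smooth F ->
  partial i (fun y : 'cV[R]_N' => F (c + A *m y)) =
  (fun y => \sum_j (A j i)%:C *: partial j F (c + A *m y)).
Proof. by move=> HF; apply: (pd_fun hV) => x; exact: pd_aff. Qed.

End Chain.

Section Product.
Context {R : realType} (V : tvsType R[i]) (Q : set (V -> R)).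
Hypothesis Qdef : defining_system Q.
Hypothesis hV : hausdorff_space V.
Variable N : nat.
Implicit Types (F : 'cV[R]_N -> V) (g : 'cV[R]_N -> R[i]^o).
Local Notation e_ i := (delta_mx i 0 : 'cV[R]_N).

Lemma hausC : hausdorff_space (R[i]^o : tvsType R[i]).
Proof. exact: (@norm_hausdorff _ (R[i]^o)). Qed.

Lemma cvg_line0 i (x : 'cV[R]_N) : x + h *: e_ i @[h --> 0^'] --> x.
Proof.
apply: cvg_cV => j.
rewrite (_ : (fun _ => _) = fun t : R => x j 0 + t * e_ i j 0); last first.
  by apply/funext => t; rewrite !mxE.
rewrite -[X in _ --> X]addr0; apply: cvgD; first exact: cvg_cst.
rewrite -[X in _ --> X](mul0r (e_ i j 0)); apply: cvgM; last exact: cvg_cst.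
exact: nbhs_dnbhs.
Qed.

Lemma pd_mul i g F x a v : continuous F -> pd i g x a -> pd i F x v ->
  pd i (fun y => (g y : R[i]) *: F y) x ((a : R[i]) *: F x + (g x : R[i]) *: v).
Proof.
move=> cF Hg HF.
have H1 : F (x + h *: e_ i) @[h --> 0^'] --> F x.
  apply: (cvg_comp _ F (@cvg_line0 i x)); exact: cF.
apply: (cvg_eqn _ (cvgV_add (cvgV_scale Hg H1) (cvgV_scalec (a := g x) HF))).
apply: filterE => h; rewrite /diff_quotient.
have E (c d : R[i]) (w : V) : (c *: (d : R[i]^o) : R[i]) *: w = c *: (d *: w) by rewrite scalerA.
rewrite E [X in _ = _ + X]scalerA [g x * _]mulrC -[X in _ = _ + X]scalerA -scalerDr.
by congr (_ *: _); rewrite scalerBl scalerBr addrA subrK.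
Qed.

Lemma cont_mul g F : continuous g -> continuous F -> continuous (fun y => (g y : R[i]) *: F y).
Proof. by move=> cg cF x; exact: (cvgV_scale (cg x) (cF x)). Qed.

Lemma smooth_mul g F : smooth g -> smooth F -> smooth (fun y => (g y : R[i]) *: F y).
Proof.
move=> Hg HF.
apply: (lspan_smooth hV (B := [set G | exists g F, [/\ smooth g, smooth F & G = fun y => (g y : R[i]) *: F y]]));
  last by apply: lspan_base; exists g, F.
- move=> _ [h [G [Hh HG ->]]]; apply: cont_mul; exact: smooth_cont.
- move=> _ i [h [G [Hh HG ->]]].
  exists (fun x => (partial i h x : R[i]) *: G x + (h x : R[i]) *: partial i G x).
    move=> x; apply: pd_mul; [exact: smooth_cont|exact: (smooth_pd hausC)|exact: (smooth_pd hV)].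
  apply: lspan_D; apply: lspan_base.
    by exists (partial i h), G; split; [exact: smooth_partial|exact: HG|reflexivity].
  by exists h, (partial i G); split; [exact: Hh|exact: smooth_partial|reflexivity].
Qed.

Lemma partial_mul i g F : smooth g -> smooth F ->
  partial i (fun y => (g y : R[i]) *: F y) =
  (fun x => (partial i g x : R[i]) *: F x + (g x : R[i]) *: partial i F x).
Proof.
move=> Hg HF; apply: (pd_fun hV) => x; apply: pd_mul;
  [exact: smooth_cont|exact: (smooth_pd hausC)|exact: (smooth_pd hV)].
Qed.

End Product.

Section LinearImage.
Context {R : realType} (V W : tvsType R[i]).
Hypothesis hV : hausdorff_space V.
Variable N : nat.
Variable T : V -> W.
Hypothesis Tlin : linear T.
Hypothesis Tcont : continuous T.

Let TL : {linear V -> W} := HB.pack T (GRing.isLinear.Build _ _ _ _ T Tlin).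

Lemma linTB v w : T (v - w) = T v - T w.
Proof. exact: (raddfB TL). Qed.

Lemma linTD v w : T (v + w) = T v + T w.
Proof. exact: (raddfD TL). Qed.

Lemma linT0 : T 0 = 0.
Proof. exact: (raddf0 TL). Qed.

Lemma linTZ a v : T (a *: v) = a *: T v.
Proof. by have := Tlin a v 0; rewrite !addr0 linT0 addr0. Qed.

Lemma linT_sum (I : Type) (r : seq I) (P : pred I) (F : I -> V) :
  T (\sum_(i <- r | P i) F i) = \sum_(i <- r | P i) T (F i).
Proof. exact: (raddf_sum TL). Qed.

Lemma cvg_lin (S : Type) (F : set_system S) {FF : Filter F} (f : S -> V) (v : V) :
  f x @[x --> F] --> v -> T (f x) @[x --> F] --> T v.
Proof. by move=> H; apply: (cvg_comp _ T H); exact: Tcont. Qed.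

End LinearImage.

(** * Lattice sums and the Riemann integral *)

Section Lattice.
Context {R : realType} (N : nat).
Implicit Types (K : nat) (k : 'cV[int]_N).

Definition mesh K : R := (K.+1%:R)^-1.

Lemma mesh_gt0 K : 0 < mesh K.
Proof. by rewrite invr_gt0 ltr0n. Qed.

Lemma mesh_le1 K : mesh K <= 1.
Proof. by rewrite invf_le1 ?ltr0n // ler1n. Qed.

Lemma mesh_cvg0 : mesh K @[K --> \oo] --> 0.
Proof. exact: cvg_harmonic. Qed.

Lemma mesh_near (e : R) : 0 < e -> \forall K \near \oo, mesh K < e.
Proof.
move=> e0; have /cvgrPdist_lt/(_ e e0) := mesh_cvg0.
by apply: filterS => K; rewrite sub0r normrN gtr0_norm // mesh_gt0.
Qed.

Definition latpt K k : 'cV[R]_N := mesh K *: map_mx intr k.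

Lemma latptE K k i : latpt K k i 0 = mesh K * (k i 0)%:~R.
Proof. by rewrite !mxE. Qed.

Section Box.
Variables (V : zmodType) (m : nat) (k0 : 'cV[int]_N).

Definition boxpt (c : {ffun 'I_N -> 'I_m}) : 'cV[int]_N := \col_i (k0 i 0 + (c i : nat)%:Z).

Lemma boxpt_inj : injective boxpt.
Proof.
move=> c d /colP H; apply/ffunP => i; have := H i; rewrite !mxE => /addrI [].
by move/val_inj.
Qed.

Lemma fsbig_box (F : 'cV[int]_N -> V) :
  (forall k, F k != 0 -> forall i, k0 i 0 <= k i 0 < k0 i 0 + m%:Z) ->
  \sum_(k \in [set: 'cV[int]_N]) F k = \sum_(c : {ffun 'I_N -> 'I_m}) F (boxpt c).
Proof.
move=> HF; rewrite (fsbigE [seq boxpt c | c <- index_enum {ffun 'I_N -> 'I_m}]).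
- by rewrite big_map; apply: eq_bigl => c; rewrite in_setT.
- by rewrite map_inj_uniq ?index_enum_uniq //; exact: boxpt_inj.
- by [].
move=> k _; apply: contraNeq => /HF Hk; apply/mapP.
have Hb i : (`|(k i 0 - k0 i 0)%R|%N < m)%N.
  by have := Hk i; move: (k i 0) (k0 i 0) => x y; clear; lia.
exists [ffun i => Ordinal (Hb i)]; first exact: mem_index_enum.
by apply/colP => i; rewrite mxE ffunE /=; have := Hk i; move: (k i 0) (k0 i 0) => x y; clear; lia.
Qed.

End Box.

Variable V : lmodType R[i].
Implicit Types F G : 'cV[R]_N -> V.

(** The sum runs over all of Z^N, being finitely supported when F has bounded support: translations
    by lattice vectors and unimodular integral matrices then merely permute the indices. *)
Definition latsum K F : V :=
  ((mesh K ^+ N)%:C) *: \sum_(k \in [set: 'cV[int]_N]) F (latpt K k).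

Definition suppbox (a : 'I_N -> R) (l : R) F :=
  forall z, F z != 0 -> forall i, a i <= z i 0 <= a i + l.

Definition k0box (a : 'I_N -> R) K : 'cV[int]_N := \col_i Num.ceil (a i * K.+1%:R).
(** A closed interval of length l contains at most floor(l (K + 1)) + 1 points of the lattice of
    mesh 1/(K + 1). *)
Definition mbox (l : R) K : nat := (Num.truncn (l * K.+1%:R)).+1.

Lemma latsum_box a l K F : 0 <= l -> suppbox a l F ->
  latsum K F = ((mesh K ^+ N)%:C) *: \sum_(c : {ffun 'I_N -> 'I_(mbox l K)}) F (latpt K (boxpt (k0box a K) c)).
Proof.
move=> l0 HF; rewrite /latsum (fsbig_box (m := mbox l K) (k0 := k0box a K)) // => k /HF Hk i.
have := Hk i; rewrite latptE /mesh mulrC => /andP[H1 H2].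
have K0 : (0 : R) < K.+1%:R by rewrite ltr0n.
have H1' : a i * K.+1%:R <= (k i 0)%:~R by rewrite -ler_pdivlMr.
have H2' : (k i 0)%:~R <= (a i + l) * K.+1%:R by rewrite -ler_pdivrMr.
have H3 : k0box a K i 0 <= k i 0 by rewrite mxE ceil_le_int.
rewrite H3 /= -(ltr_int R) rmorphD /=.
have H4 : a i * K.+1%:R <= (k0box a K i 0)%:~R by rewrite mxE ceil_ge.
have H5 : l * K.+1%:R < (mbox l K)%:R by rewrite /mbox truncnS_gt.
rewrite -[(Posz _)%:~R]/((mbox l K)%:R) ; lra.
Qed.

Lemma mbox_mesh l K : 0 <= l -> mesh K * (mbox l K)%:R <= l + 1.
Proof.
move=> l0; have K0 : (0 : R) < K.+1%:R by rewrite ltr0n.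
rewrite /mesh mulrC ler_pdivrMr // /mbox -natr1 mulrDl mul1r.
have /andP[H _] : (Num.truncn (l * K.+1%:R))%:R <= l * K.+1%:R < (Num.truncn (l * K.+1%:R)).+1%:R.
  by apply: truncn_itv; rewrite mulr_ge0 // ltW.
by apply: lerD => //; rewrite ler1n.
Qed.

(** At most [mbox] lattice points per direction meet the support. Taking l + 1 for the side instead
    of l makes the bound uniform in the mesh. *)
Lemma latsum_bound (q : V -> R) a l K F B : seminorm q -> 0 <= l -> suppbox a l F ->
  (forall z, q (F z) <= B) -> q (latsum K F) <= (l + 1) ^+ N * B.
Proof.
move=> Hs l0 HF HB; have B0 : 0 <= B by apply: le_trans (HB 0); exact: sn_ge0.
have hN : 0 <= mesh K ^+ N by rewrite exprn_ge0 // ltW // mesh_gt0.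
rewrite (latsum_box K l0 HF) (snZr Hs) ger0_norm //.
apply: (@le_trans _ _ (mesh K ^+ N * ((mbox l K)%:R ^+ N * B))).
  rewrite ler_wpM2l //.
  apply: le_trans (sn_sum Hs _ _ _) _.
  apply: le_trans (ler_sum _ (fun c _ => HB _)) _.
  by rewrite sumr_const card_ffun !card_ord -natrX mulr_natl.
rewrite mulrA -exprMn ler_wpM2r // lerXn2r ?nnegrE ?mbox_mesh //.
- by rewrite mulr_ge0 // ltW // mesh_gt0.
- by rewrite addr_ge0.
Qed.

Definition supp_le (L : R) F := forall z, F z != 0 -> forall i, `|z i 0| <= L.

Lemma supp_le_box L F : supp_le L F -> suppbox (fun=> - L) (2 * L) F.
Proof. by move=> HF z /HF Hz i; have := Hz i; rewrite ler_norml; lra. Qed.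

Lemma supp_leW L L' F : L <= L' -> supp_le L F -> supp_le L' F.
Proof. by move=> LL' HF z /HF Hz i; apply: le_trans (Hz i) LL'. Qed.

Lemma supp_leP L F : supp_le L F <-> (forall z : 'cV[R]_N, (exists i, L < `|z i 0|) -> F z = 0).
Proof.
split=> [HF z [i Hi]|HF z].
  by apply/eqP; apply: contraLR Hi => /HF/(_ i); rewrite -leNgt.
move=> Fz i; rewrite leNgt; apply/negP => Li; move/eqP: Fz; apply; apply: HF.
by exists i.
Qed.

Lemma latsumD L K F G : 0 <= L -> supp_le L F -> supp_le L G ->
  latsum K (fun z => F z + G z) = latsum K F + latsum K G.
Proof.
move=> L0 HF HG; have l0 : 0 <= 2 * L by rewrite mulr_ge0.
have HFG : supp_le L (fun z => F z + G z).
  move=> z; have [/eqP Fz|/HF //] := boolP (F z == 0); rewrite Fz add0r; exact: HG.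
rewrite (latsum_box K l0 (supp_le_box HF)) (latsum_box K l0 (supp_le_box HG)) (latsum_box K l0 (supp_le_box HFG)).
by rewrite -scalerDr big_split.
Qed.

Lemma latsumZ L K a F : 0 <= L -> supp_le L F ->
  latsum K (fun z => a *: F z) = a *: latsum K F.
Proof.
move=> L0 HF; have l0 : 0 <= 2 * L by rewrite mulr_ge0.
have HG : supp_le L (fun z => a *: F z).
  by move=> z; have [/eqP -> |/HF //] := boolP (F z == 0); rewrite scaler0 eqxx.
rewrite (latsum_box K l0 (supp_le_box HF)) (latsum_box K l0 (supp_le_box HG)).
by rewrite -scaler_sumr scalerA mulrC -scalerA.
Qed.

Lemma latsumB L K F G : 0 <= L -> supp_le L F -> supp_le L G ->
  latsum K (fun z => F z - G z) = latsum K F - latsum K G.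
Proof.
move=> L0 HF HG; rewrite -[- latsum K G]scaleN1r -(latsumZ (L := L)) // -(latsumD (L := L)) //.
- by congr latsum; apply/funext => z; rewrite scaleN1r.
- by move=> z; have [/eqP -> |/HG //] := boolP (G z == 0); rewrite scaler0 eqxx.
Qed.

Lemma latsum_bij K F (u : 'cV[int]_N -> 'cV[int]_N) (U : 'cV[R]_N -> 'cV[R]_N) : bijective u ->
  (forall k, U (latpt K k) = latpt K (u k)) -> latsum K (F \o U) = latsum K F.
Proof.
move=> Hu HU; rewrite /latsum [in RHS](reindex_fsbigT u) //.
by congr (_ *: _); apply: eq_fsbigr => k _ /=; rewrite HU.
Qed.

(** A difference quotient whose step is the mesh has therefore lattice sum zero, the discrete form
    of [rint_pd]. *)
Lemma latsum_shift K F i : latsum K (fun z => F (z + mesh K *: delta_mx i 0)) = latsum K F.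
Proof.
apply: (@latsum_bij _ _ (fun k => k + delta_mx i 0) (fun z => z + mesh K *: delta_mx i 0)).
  by exists (fun k => k - delta_mx i 0) => k; rewrite ?addrK ?subrK.
move=> k; rewrite /latpt -scalerDr; congr (_ *: _); apply/colP => j.
by rewrite !mxE rmorphD /=; congr (_ + _); case: (_ && _).
Qed.

End Lattice.

Lemma latsum_lin (R : realType) N (V W : tvsType R[i]) (T : V -> W) L K (F : 'cV[R]_N -> V) : linear T ->
  0 <= L -> supp_le L F -> latsum K (T \o F) = T (latsum K F).
Proof.
move=> HT L0 HF; have l0 : 0 <= 2 * L by rewrite mulr_ge0.
have HG : supp_le L (T \o F).
  by move=> z /=; have [/eqP -> |/HF //] := boolP (F z == 0); rewrite (linT0 HT) eqxx.
rewrite (latsum_box K l0 (supp_le_box HF)) (latsum_box K l0 (supp_le_box HG)).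
by rewrite (linTZ HT) (linT_sum HT).
Qed.

Section Compactness.
Context {R : realType} (N : nat).

Lemma box_compact (L : R) : compact [set z : 'cV[R]_N | forall i, `|z i 0| <= L].
Proof.
have H : compact [set v : 'rV[R]_N | forall i, `[-L, L]%classic (v ord0 i)].
  exact: (@rV_compact R N (fun=> `[-L, L]%classic) (fun=> @segment_compact R (-L) L)).
have Hc : continuous (fun v : 'rV[R]_N => v^T : 'cV[R]_N).
  move=> v; apply: (@cvg_cV _ _ _ _ (nbhs_filter v)) => i.
  rewrite mxE; under eq_fun do rewrite mxE.
  exact: (@coord_continuous R 1 N 0 i v).
have := continuous_compact (continuous_subspaceT Hc) H; congr compact.
apply/seteqP; split=> [_ [v Hv <-] i|z Hz].
  by have := Hv i; rewrite mxE /= in_itv /= -ler_norml.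
exists z^T; last by rewrite trmxK.
by move=> i; rewrite mxE /= in_itv /= -ler_norml; exact: Hz.
Qed.

Context (V : tvsType R[i]) (Q : set (V -> R)).
Hypothesis Qdef : defining_system Q.

Lemma unif_cont q (F : 'cV[R]_N -> V) L (e : R) : Q q -> continuous F -> supp_le L F -> 0 < e ->
  exists2 d : R, 0 < d & forall x y : 'cV[R]_N, (forall i, `|x i 0 - y i 0| < d) -> q (F x - F y) < e.
Proof.
move=> Hq cF sF e0; have Hs := Qsn Qdef Hq.
pose P (d : R) (x : 'cV[R]_N) := forall y : 'cV[R]_N, (forall i, `|x i 0 - y i 0| < d) -> q (F x - F y) < e.
(* The cube is enlarged by 1 and d is taken below 1, so that a point outside it and all the points
   d-close to it lie off the support. *)
have /compact_near_coveringP/(_ R 0^'+ P) := @box_compact (L + 1).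
have H : forall x : 'cV[R]_N, [set z : 'cV[R]_N | forall i, `|z i 0| <= L + 1] x ->
   \forall x' \near x & d \near 0^'+, P d x'.
  move=> x _; have e2 : 0 < e / 2 by rewrite divr_gt0.
  have [d d0 Hd] := (iffLR (contP Qdef F)) cF q x (e / 2) Hq e2.
  have d2 : 0 < d / 2 by rewrite divr_gt0.
  exists ([set y : 'cV[R]_N | forall i, `|y i 0 - x i 0| < d / 2], [set t | t < d / 2]).
    split => /=; first by apply/near_cV; exists (d / 2).
    exact: nbhs_right_lt.
  move=> [y t] [/= Hy Ht] z Hz.
  have H1 : q (F y - F x) < e / 2.
    by apply: Hd => i; apply: lt_le_trans (Hy i) _; lra.
  have H2 : q (F z - F x) < e / 2.
    apply: Hd => i; have := Hy i; have := Hz i; have := ler_normD (z i 0 - y i 0) (y i 0 - x i 0).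
    by rewrite addrA subrK (distrC (z i 0) (y i 0)); lra.
  by have := snD_tri Hs (F y) (F x) (F z); rewrite (snBC Hs (F x)); lra.
move=> /(_ _ H) H3.
have H4 : \forall d \near (0 : R)^'+, d < 1 by apply: nbhs_right_lt; exact: ltr01.
have H5 : \forall d \near (0 : R)^'+, 0 < d by exact: nbhs_right_gt.
have [d [[d0 d1] Hd]] := filter_ex (filterI (filterI H5 H4) H3).
exists d => // x y Hxy.
have [Hx|] := pselect (forall i, `|x i 0| <= L + 1); first exact: (Hd x).
move=> /existsNP [i /negP]; rewrite -ltNge => Hi.
have -> : F x = 0 by apply: (iffLR (supp_leP L F)) => //; exists i; lra.
have -> : F y = 0.
  apply: (iffLR (supp_leP L F)) => //; exists i.
  by have := Hxy i; have := ler_normD (x i 0 - y i 0) (y i 0); rewrite subrK; lra.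
by rewrite subrr (sn0 Hs).
Qed.

Lemma cont_bounded q (F : 'cV[R]_N -> V) L : Q q -> continuous F -> supp_le L F ->
  exists2 B : R, 0 <= B & forall x, q (F x) <= B.
Proof.
move=> Hq cF sF; have Hs := Qsn Qdef Hq.
have cq : continuous (q \o F).
  by move=> x; apply: (cvg_comp _ q (cF x)); exact: (Qcont Qdef Hq).
have := compact_bounded (continuous_compact (continuous_subspaceT cq) (@box_compact L)).
move=> [M [_ HM]]; exists (`|M| + 1); first by rewrite addr_ge0.
have Hb := HM (`|M| + 1) ltac:(have := ler_norm M; lra).
move=> x; have [Hx|] := pselect (forall i, `|x i 0| <= L).
  by apply: le_trans (ler_norm _) _; apply: Hb; exists x.
move=> /existsNP [i /negP]; rewrite -ltNge => Hi.
by rewrite (iffLR (supp_leP L F) sF) ?(sn0 Hs) ?addr_ge0 //; exists i.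
Qed.

End Compactness.

(** * Counting lattice points in the cells of a grid *)

Section GridCount.
Context {R : realType}.
Implicit Types (x a b L : R) (K : nat).

Lemma sum_ltn m n : (\sum_(j < m) (j < n)%N)%N = minn n m.
Proof.
elim: m => [|m IH]; first by rewrite big_ord0 minn0.
by rewrite big_ord_recr /= IH; lia.
Qed.

Definition kzero L K : int := Num.ceil (- L * K.+1%:R).

(** The lattice points of index at least [kzero] below x end just before ceil(x (K + 1)), so the
    quantity in the middle is ceil(x (K + 1)) / (K + 1). Its first term, common to all x, cancels
    when two values are subtracted. *)
Lemma count_below x L K : - L <= x -> x <= L ->
  x <= mesh (R:=R) K * (kzero L K)%:~R + \sum_(j < mbox (2 * L) K) mesh K * (mesh K * (kzero L K + j%:Z)%:~R < x)%R%:R <= x + mesh K.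
Proof.
move=> Lx xL; have K0 : (0 : R) < K.+1%:R by rewrite ltr0n.
have hK : mesh (R:=R) K * K.+1%:R = 1 by rewrite mulVf // lt0r_neq0.
have h0 := mesh_gt0 (R:=R) K.
pose c : int := Num.ceil (x * K.+1%:R).
have kc : kzero L K <= c by rewrite /c ceil_le_int; apply: le_trans (ceil_ge _); rewrite ler_pM2r.
pose n := `|c - kzero L K|%N.
have nE : (n%:Z = c - kzero L K)%R by rewrite /n gez0_abs // subr_ge0.
have c1 : x * K.+1%:R <= c%:~R by exact: ceil_ge.
have c2 : (c%:~R : R) < x * K.+1%:R + 1 by rewrite -ltrBlDr; have := ceilB1_lt (x * K.+1%:R : R); rewrite rmorphB.
have nm : (n <= mbox (2 * L) K)%N.
  have H : (n%:R : R) < (mbox (2 * L) K).+1%:R.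
    have -> : (n%:R : R) = c%:~R - (kzero L K)%:~R by rewrite -rmorphB /= -nE.
    have H1 : - L * K.+1%:R <= (kzero L K)%:~R by exact: ceil_ge.
    have H2 : 2 * L * K.+1%:R < (mbox (2 * L) K)%:R by exact: truncnS_gt.
    have H3 : x * K.+1%:R <= L * K.+1%:R by rewrite ler_pM2r.
    by rewrite -natr1; nra.
  by rewrite ltr_nat ltnS in H.
have -> : \sum_(j < mbox (2 * L) K) mesh K * (mesh K * (kzero L K + j%:Z)%:~R < x)%R%:R = mesh K * (n%:R : R).
  rewrite -mulr_sumr; congr (_ * _); rewrite -(minn_idPl nm) -sum_ltn natr_sum.
  apply: eq_bigr => j _; congr (_%:R : R); congr nat_of_bool.
  rewrite mulrC -ltr_pdivlMr // invrK.
  apply/idP/idP => H.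
    have : (kzero L K + j%:Z < c)%R by rewrite -(ltr_int R); apply: lt_le_trans H c1.
    by rewrite -subr_gt0; lia.
  have : ~~ (c <= kzero L K + j%:Z)%R by rewrite -ltNge; lia.
  by rewrite ceil_le_int -ltNge.
rewrite -mulrDr; have -> : ((kzero L K)%:~R + n%:R : R) = c%:~R.
  by rewrite -[n%:R]/((n%:Z)%:~R) nE -rmorphD /= addrC subrK.
apply/andP; split.
  have -> : x = mesh K * (x * K.+1%:R) by rewrite mulrCA hK mulr1.
  by rewrite ler_pM2l.
have -> : x + mesh K = mesh K * (x * K.+1%:R + 1) by rewrite mulrDr mulr1 mulrCA hK mulr1.
by rewrite ler_pM2l // ltW.
Qed.

(** Half-open, hence a difference of two indicators of half-lines: the cells of a partition tile
    without overlap and their indicators telescope. *)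
Definition cell_ind a b x : R := ((a <= x)%R && (x < b)%R)%:R.

Lemma cell_indE a b x : a <= b -> cell_ind a b x = (x < b)%R%:R - (x < a)%R%:R.
Proof.
move=> ab; rewrite /cell_ind; have [xa|ax] := ltP x a; last by rewrite subr0.
by rewrite (lt_le_trans xa ab) subrr.
Qed.

Lemma cell_count_cvg a b L : - L <= a -> a <= b -> b <= L ->
  \sum_(j < mbox (2 * L) K) mesh K * cell_ind a b (mesh K * (kzero L K + j%:Z)%:~R) @[K --> \oo] --> b - a.
Proof.
move=> La ab bL; apply/cvgrPdist_le => e e0.
have := @mesh_near R e e0; apply: filterS => K HK.
have /andP[A1 A2] := @count_below a L K La (le_trans ab bL).
have /andP[B1 B2] := @count_below b L K (le_trans La ab) bL.
under eq_bigr do rewrite cell_indE // mulrBr.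
by rewrite sumrB; rewrite ler_norml; lra.
Qed.

Lemma cell_ind_sum (K : nat) (t : nat -> R) x : (forall k, (k < K)%N -> t k <= t k.+1) ->
  \sum_(c < K) cell_ind (t c) (t c.+1) x = (x < t K)%R%:R - (x < t 0%N)%R%:R.
Proof.
elim: K => [|K IH] Ht; first by rewrite big_ord0 subrr.
rewrite big_ord_recr /= IH; last by move=> k kK; apply: Ht; exact: ltnW.
by rewrite cell_indE ?Ht //; ring.
Qed.

Lemma grid_mono (K : nat) (t : nat -> R) : (forall k, (k < K)%N -> t k <= t k.+1) ->
  forall i j, (i <= j)%N -> (j <= K)%N -> t i <= t j.
Proof.
move=> Ht i; elim=> [|j IH]; first by rewrite leqn0 => /eqP ->.
rewrite leq_eqVlt => /orP[/eqP -> //|ij] jK.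
by apply: le_trans (IH _ (ltnW jK)) (Ht _ jK).
Qed.

End GridCount.

(** * Comparison of Riemann sums with lattice sums *)

Section RiemannSums.
Context {R : realType} (N : nat) (V : tvsType R[i]) (Q : set (V -> R)).
Hypothesis Qdef : defining_system Q.
Hypothesis hV : hausdorff_space V.
Implicit Types F : 'cV[R]_N -> V.

(** Moving the coordinate slightly outwards leaves the support, and continuity concludes. This is
    needed since half-open cells miss the faces x_i = L of the cube. *)
Lemma supp_boundary F L (x : 'cV[R]_N) i : continuous F -> supp_le L F -> L <= `|x i 0| -> F x = 0.
Proof.
move=> cF sF Lx; apply: (sepQ Qdef hV) => q Hq; have Hs := Qsn Qdef Hq.
apply/eqP; rewrite subr0 eq_le (sn_ge0 Hs) andbT; apply/ler_addgt0Pr => e e0; rewrite add0r.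
have [d d0 Hd] := (iffLR (contP Qdef F)) cF q x e Hq e0.
pose s : R := if 0 <= x i 0 then d / 2 else - (d / 2).
have hs : `|s| = d / 2 by rewrite /s; case: ifP => _; rewrite ?normrN ger0_norm // ltW // divr_gt0.
have := Hd (x + s *: delta_mx i 0); rewrite (iffLR (supp_leP L F) sF); last first.
  exists i; rewrite mxE mxE e_E eqxx mulr1 /s; have := Lx.
  by case: ifP => H; [rewrite !ger0_norm|move/negbT: H; rewrite -ltNge => H; rewrite !ltr0_norm]; lra.
rewrite sub0r (snN Hs) => H; apply/ltW/H => j; rewrite [(x + _) j 0]mxE addrAC subrr add0r.
by apply: le_lt_trans (norm_e i s j) _; rewrite hs; lra.
Qed.

Lemma cvgR_prod (T : Type) (A : set_system T) {FF : Filter A} (I : Type) (r : seq I) (f : I -> T -> R) (v : I -> R) :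
  (forall i, f i x @[x --> A] --> v i) ->
  \prod_(i <- r) f i x @[x --> A] --> \prod_(i <- r) v i.
Proof.
move=> H; elim: r => [|i r IH].
  by rewrite big_nil; under eq_fun do rewrite big_nil; exact: cvg_cst.
by rewrite big_cons; under eq_fun do rewrite big_cons; exact: cvgM.
Qed.

Section OneGrid.
Variables (L : R) (Kg : nat) (t : 'I_N -> nat -> R) (xi : {ffun 'I_N -> 'I_Kg} -> 'cV[R]_N).
Hypothesis L0 : 0 < L.
Hypothesis Hg : tagged_grid L t xi.

(* [ind c] is the indicator of the half-open cell [c]: summing over the lattice the
   oscillation of F on the cells compares the Riemann sum with the lattice sum. *)
Let idx K := {ffun 'I_N -> 'I_(mbox (2 * L) K)}.
Let y K (j : idx K) : 'cV[R]_N := latpt K (boxpt (k0box (fun=> - L) K) j).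
Let ind (c : {ffun 'I_N -> 'I_Kg}) (x : 'cV[R]_N) : R := \prod_i cell_ind (t i (c i)) (t i (c i).+1) (x i 0).
Let vol (c : {ffun 'I_N -> 'I_Kg}) := \prod_i (t i (c i).+1 - t i (c i)).

Let ind_ge0 c x : 0 <= ind c x.
Proof. by apply: prodr_ge0 => i _; rewrite /cell_ind; case: (_ && _). Qed.

Let ind_sum x : \sum_c ind c x = \prod_i ((x i 0 < L)%R%:R - (x i 0 < - L)%R%:R).
Proof.
rewrite -(bigA_distr_bigA (fun i (k : 'I_Kg) => cell_ind (t i k) (t i k.+1) (x i 0))).
case: Hg => H1 H2 _; apply: eq_bigr => i _.
by rewrite cell_ind_sum; [case: (H1 i) => -> ->|move=> k; exact: H2].
Qed.

Let ind_sum_le1 x : \sum_c ind c x <= 1.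
Proof.
rewrite ind_sum -[leRHS](big1_eq (op := *%R) (idx := 1 : R) (index_enum 'I_N) xpredT).
apply: ler_prod => i _; have [H1|H1] := ltP (x i 0) L; have [H2|H2] := ltP (x i 0) (- L);
  rewrite ?subrr ?subr0 ?lexx ?ler01 //.
by have := le_lt_trans H1 H2; have := L0; lra.
Qed.

Let ind_sum1 (x : 'cV[R]_N) : (forall i, `|x i 0| < L) -> \sum_c ind c x = 1.
Proof.
move=> Hx; rewrite ind_sum big1 // => i _; have := Hx i; rewrite ltr_norml => /andP[H1 ->].
by rewrite ltNge (ltW H1) subr0.
Qed.

Let ind_close d c (x : 'cV[R]_N) : (forall i k, (k < Kg)%N -> t i k.+1 - t i k < d) -> ind c x != 0 ->
  forall i, `|x i 0 - xi c i 0| < d.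
Proof.
move=> Hd Hi i; have : cell_ind (t i (c i)) (t i (c i).+1) (x i 0) != 0.
  by apply: contraNneq Hi => H; rewrite /ind (bigD1 i) //= H mul0r.
rewrite /cell_ind; case: (boolP (_ && _)) => [/andP[A1 A2] _|]; last by rewrite eqxx.
case: Hg => _ _ /(_ c i) /andP[B1 B2]; have := Hd i (c i) (ltn_ord _).
by rewrite ltr_norml; lra.
Qed.

Let coef K c : R := \sum_(j : idx K) mesh K ^+ N * ind c (y j).

Let coefE K c : coef K c = \prod_i \sum_(j < mbox (2 * L) K)
   mesh K * cell_ind (t i (c i)) (t i (c i).+1) (mesh K * (kzero L K + j%:Z)%:~R).
Proof.
rewrite bigA_distr_bigA /coef; apply: eq_bigr => j _.
rewrite /ind big_split /= prodr_const card_ord; congr (_ * _).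
by apply: eq_bigr => i _; rewrite /y latptE !mxE.
Qed.

Let coef_cvg c : coef K c @[K --> \oo] --> vol c.
Proof.
under eq_fun do rewrite coefE.
case: Hg => H1 H2 _; apply: cvgR_prod => i; have [t0 tK] := H1 i.
have ck := ltn_ord (c i); apply: cell_count_cvg.
- by rewrite -t0; apply: (grid_mono (H2 i)) => //; exact: ltnW.
- exact: H2.
- by rewrite -tK; apply: (grid_mono (H2 i)).
Qed.

(** Splits the error into the oscillation of F on the cells, weighted by the lattice points in them,
    and the defect between the lattice volume [coef] and the true volume [vol] of each cell. Lattice
    points in no open cell position, those on or beyond the faces, contribute 0 by
    [supp_boundary]. *)
Lemma latsum_grid F K : continuous F -> supp_le L F ->
  latsum K F - riemann_sum t xi F =
  \sum_c \sum_(j : idx K) (mesh K ^+ N * ind c (y j))%:C *: (F (y j) - F (xi c)) +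
  \sum_c (coef K c - vol c)%:C *: F (xi c).
Proof.
move=> cF sF; have l0 : 0 <= 2 * L by rewrite mulr_ge0 // ltW.
rewrite (latsum_box K l0 (supp_le_box sF)).
rewrite -big_split /= /riemann_sum.
have -> : (mesh K ^+ N)%:C *: \sum_(c : idx K) F (latpt K (boxpt (k0box (fun=> - L) K) c)) =
    \sum_c \sum_(j : idx K) (mesh K ^+ N * ind c (y j))%:C *: F (y j).
  rewrite exchange_big scaler_sumr; apply: eq_bigr => j _.
  under eq_bigr do rewrite rmorphM -scalerA.
  rewrite -scaler_sumr -scaler_suml -rmorph_sum; congr (_ *: _).
  have [Hy|/existsNP[i /negP]] := pselect (forall i, `|y j i 0| < L).
    by rewrite ind_sum1 // scale1r.
  rewrite -leNgt => Hi; rewrite -/(y j) (supp_boundary cF sF Hi).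
  by rewrite scaler0.
rewrite -sumrB; apply: eq_bigr => c _.
under [X in _ = X + _]eq_bigr do rewrite scalerBr.
rewrite sumrB -addrA; congr (_ + _).
by rewrite -scaler_suml -rmorph_sum rmorphB scalerBl addKr.
Qed.

(** The index K is fixed before F: only the volume defects must be small, and they depend on the
    grid alone. This uniformity over F is what Fubini will require. *)
Lemma grid_near q d e e1 B : Q q -> 0 <= B -> 0 < e -> 0 <= e1 ->
  (forall i k, (k < Kg)%N -> t i k.+1 - t i k < d) ->
  \forall K \near \oo, forall F, continuous F -> supp_le L F -> (forall x, q (F x) <= B) ->
    (forall x x' : 'cV[R]_N, (forall i, `|x i 0 - x' i 0| < d) -> q (F x - F x') < e1) ->
    q (latsum K F - riemann_sum t xi F) < (2 * L + 1) ^+ N * e1 + e.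
Proof.
move=> Hq B0 e0 e10 Hd; have Hs := Qsn Qdef Hq.
have : \sum_c `|coef K c - vol c| * B @[K --> \oo] --> \sum_(c : {ffun 'I_N -> 'I_Kg}) (0 * B : R).
  apply: cvgR_sum => c; apply: cvgM; last exact: cvg_cst.
  rewrite -(normr0 R) -(subrr (vol c)); apply: cvg_norm; apply: cvgB; last exact: cvg_cst.
  exact: coef_cvg.
rewrite big1 => [|c _]; last by rewrite mul0r.
move=> /cvgrPdist_lt/(_ e e0); apply: filterS => K.
rewrite sub0r normrN ger0_norm; last by apply: sumr_ge0 => c _; rewrite mulr_ge0.
move=> He F cF sF HB Hu; rewrite latsum_grid //.
apply: le_lt_trans (snD Hs _ _) _; apply: ler_ltD.
  apply: le_trans (sn_sum Hs _ _ _) _.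
  apply: (@le_trans _ _ (\sum_c \sum_(j : idx K) mesh K ^+ N * ind c (y j) * e1)).
    apply: ler_sum => c _; apply: le_trans (sn_sum Hs _ _ _) _; apply: ler_sum => j _.
    have h0 : 0 <= mesh K ^+ N * ind c (y j) by rewrite mulr_ge0 // exprn_ge0 // ltW // mesh_gt0.
    rewrite (snZr Hs) ger0_norm //.
    have [->|Hi] := eqVneq (ind c (y j)) 0; first by rewrite mulr0 !mul0r.
    by rewrite ler_wpM2l // ltW // Hu //; exact: ind_close.
  rewrite exchange_big /=.
  under eq_bigr do rewrite -mulr_suml -mulr_sumr.
  rewrite -mulr_suml ler_wpM2r //.
  apply: (@le_trans _ _ (\sum_(j : idx K) mesh K ^+ N)).
    by apply: ler_sum => j _; rewrite -[leRHS]mulr1 ler_wpM2l // exprn_ge0 // ltW // mesh_gt0.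
  rewrite sumr_const card_ffun !card_ord -[leLHS]mulr_natr natrX -exprMn lerXn2r ?nnegrE //.
  - by rewrite mulr_ge0 // ltW // mesh_gt0.
  - by rewrite addr_ge0 // mulr_ge0 // ltW.
  - by rewrite mbox_mesh // mulr_ge0 // ltW.
apply: le_lt_trans He; apply: le_trans (sn_sum Hs _ _ _) _.
by apply: ler_sum => c _; rewrite (snZr Hs) ler_wpM2l.
Qed.

End OneGrid.

Lemma grid_exists (L d : R) : 0 < L -> 0 < d ->
  exists (Kg : nat) (t : 'I_N -> nat -> R) (xi : {ffun 'I_N -> 'I_Kg} -> 'cV[R]_N),
    tagged_grid L t xi /\ (forall i k, (k < Kg)%N -> t i k.+1 - t i k < d).
Proof.
move=> L0 d0; pose Kg := (Num.truncn (2 * L / d)).+1.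
have K0 : (0 : R) < Kg%:R by rewrite ltr0n.
pose t (i : 'I_N) (k : nat) := - L + 2 * L / Kg%:R * k%:R.
have tS i k : t i k.+1 - t i k = 2 * L / Kg%:R by rewrite /t -natr1; ring.
have st0 : 0 < 2 * L / Kg%:R by rewrite divr_gt0 // mulr_gt0.
exists Kg, t, (fun c : {ffun 'I_N -> 'I_Kg} => \col_i t i (c i)); split; first split.
- move=> i; rewrite /t mulr0 addr0; split=> //.
  by rewrite divfK ?lt0r_neq0 //; ring.
- by move=> i k _; rewrite -subr_ge0 tS ltW.
- by move=> c i; rewrite mxE lexx /= -subr_ge0 tS ltW.
move=> i k _; rewrite tS ltr_pdivrMr // [d * _]mulrC -ltr_pdivrMr //.
exact: truncnS_gt.
Qed.

Lemma cauchy_seqQ (u : nat -> V) :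
  (forall q e, Q q -> 0 < e -> exists K, forall j k, (K <= j)%N -> (K <= k)%N -> q (u j - u k) < e) ->
  cauchy_seq u.
Proof.
move=> H U /(proj2 Qdef) [k [s [e [e0 Hs HU]]]].
have [Kf HK] := choice (fun i => H (s i) e (Hs i) e0).
exists (\max_i Kf i)%N => j l Hj Hl; apply: HU => i; apply: HK.
  by apply: leq_trans Hj; exact: (leq_bigmax i).
by apply: leq_trans Hl; exact: (leq_bigmax i).
Qed.

Lemma modulus F L q e : Q q -> continuous F -> supp_le L F -> 0 < L -> 0 < e ->
  exists2 d : R, 0 < d & forall (Kg : nat) t xi, @tagged_grid R N L Kg t xi ->
    (forall i k, (k < Kg)%N -> t i k.+1 - t i k < d) ->
    \forall K \near \oo, q (latsum K F - riemann_sum t xi F) < e.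
Proof.
move=> Hq cF sF L0 e0; have p0 : 0 < (2 * L + 1) ^+ N by rewrite exprn_gt0 // addr_gt0 // mulr_gt0.
have e1 : 0 < e / 2 / (2 * L + 1) ^+ N by rewrite !divr_gt0.
have [d d0 Hd] := unif_cont Qdef Hq cF sF e1.
have [B B0 HB] := cont_bounded Qdef Hq cF sF.
exists d => // Kg t xi Hg Hm.
have e2 : 0 < e / 2 by rewrite divr_gt0.
have := grid_near L0 Hg Hq B0 e2 (ltW e1) Hm; apply: filterS => K /(_ F cF sF HB Hd).
by rewrite mulrC divfK ?lt0r_neq0 // -splitr.
Qed.

Hypothesis complV : sequentially_complete V.

(** All lattice sums of large index are close to the Riemann sum of one fine grid, so they form a
    Cauchy sequence. *)
Lemma latsum_cvg F L : continuous F -> supp_le L F -> exists v : V, latsum K F @[K --> \oo] --> v.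
Proof.
move=> cF sF; apply: complV; apply: cauchy_seqQ => q e Hq e0.
pose L' := Num.max L 1; have L0 : 0 < L' by rewrite lt_max ltr01 orbT.
have sF' : supp_le L' F by apply: supp_leW sF; rewrite le_max lexx.
have e2 : 0 < e / 2 by rewrite divr_gt0.
have [d d0 Hd] := modulus Hq cF sF' L0 e2.
have [Kg [t [xi [Hg Hm]]]] := grid_exists L0 d0.
have [K _ HK] := Hd _ _ _ Hg Hm; exists K => j k Hj Hk; have Hs := Qsn Qdef Hq.
have := snD_tri Hs (latsum j F) (riemann_sum t xi F) (latsum k F).
have := HK _ Hj; have := HK _ Hk; rewrite /= (snBC Hs (latsum k F)); lra.
Qed.

Lemma grid_close F L q v e : Q q -> continuous F -> supp_le L F -> 0 < L -> 0 < e ->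
  latsum K F @[K --> \oo] --> v ->
  exists2 d : R, 0 < d & forall (Kg : nat) t xi, @tagged_grid R N L Kg t xi ->
    (forall i k, (k < Kg)%N -> t i k.+1 - t i k < d) ->
    q (riemann_sum t xi F - v) < e.
Proof.
move=> Hq cF sF L0 e0 Hv; have e2 : 0 < e / 2 by rewrite divr_gt0.
have [d d0 Hd] := modulus Hq cF sF L0 e2; exists d => // Kg t xi Hg Hm.
have H1 := Hd _ _ _ Hg Hm; have /(cvgQ_lt Qdef)/(_ q _ Hq e2) H2 := Hv.
have [K [K1 K2]] := filter_ex (filterI H1 H2); have Hs := Qsn Qdef Hq.
by have := snD_tri Hs (riemann_sum t xi F) (latsum K F) v; rewrite (snBC Hs _ (latsum K F)); lra.
Qed.

Lemma riemann_latsum F L : continuous F -> supp_le L F ->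
  latsum K F @[K --> \oo] --> riemann_integral F.
Proof.
move=> cF sF; have [v Hv] := latsum_cvg cF sF.
suff -> : riemann_integral F = v by [].
pose L' := Num.max L 1; have L0 : 0 < L' by rewrite lt_max ltr01 orbT.
have sF' : supp_le L' F by apply: supp_leW sF; rewrite le_max lexx.
apply: xget_unique => [|w [M [M0 HM Hw]]].
  exists L'; split=> // [x Hx|U nU]; first exact: (iffLR (supp_leP L' F)).
  have nU0 : nbhs 0 [set w | U (w + v)].
    have Ha := @add_continuous V (0, v).
    have : (fun w => w + v) x @[x --> (0:V)] --> 0 + v.
      apply: (@continuous2_cvg _ _ _ _ _ _ id (fun=> v) (fun x y : V => x + y)) => //.
      exact: cvg_cst.
    by move=> /(_ U); rewrite add0r; apply.
  have [k [s [e [e0 Hs HU]]]] := proj2 Qdef _ nU0.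
  pose P (d : R) (i : 'I_k) := forall (Kg : nat) t xi, @tagged_grid R N L' Kg t xi ->
    (forall j k, (k < Kg)%N -> t j k.+1 - t j k < d) -> s i (riemann_sum t xi F - v) < e.
  have H : \forall d \near 0^'+, forall i, P d i.
    apply: filter_forall => i.
    have [d d0 Hd] := grid_close (Hs i) cF sF' L0 e0 Hv.
    have : \forall d' \near 0^'+, d' < d by exact: nbhs_right_lt.
    apply: filterS => d' dd' Kg t xi Hg Hm; apply: Hd Hg _ => j l Hl.
    exact: lt_trans (Hm j l Hl) dd'.
  have H5 : \forall d \near 0^'+, (0 : R) < d by exact: nbhs_right_gt.
  have [d [d0 Hd]] := filter_ex (filterI H5 H).
  exists d => // Kg t xi Hg Hm.
  have := HU (riemann_sum t xi F - v); rewrite /= subrK; apply => i.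
  exact: (Hd i) Hg Hm.
(* Uniqueness: another value w may come with another cube, of half-side M, whose Riemann sums are
   compared with the same limit of lattice sums. *)
apply: (sepQ Qdef hV) => q Hq; have Hs := Qsn Qdef Hq.
apply/eqP; rewrite eq_le (sn_ge0 Hs) andbT; apply/ler_addgt0Pr => e e0; rewrite add0r.
have sM : supp_le M F by apply/supp_leP => x Hx; exact: HM.
have e2 : 0 < e / 2 by rewrite divr_gt0.
have nU : nbhs w [set z | q (z - w) < e / 2].
  by have /(cvgQ_lt Qdef)/(_ q _ Hq e2) := @cvg_id _ (nbhs w).
have [d1 d10 Hd1] := Hw _ nU.
have [d2 d20 Hd2] := grid_close Hq cF sM M0 e2 Hv.
have dm : 0 < Num.min d1 d2 by rewrite lt_min d10.
have [Kg [t [xi [Hg Hm]]]] := grid_exists M0 dm.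
have := Hd1 _ _ _ Hg (fun i k Hk => lt_le_trans (Hm i k Hk) _).
have -> : Num.min d1 d2 <= d1 by rewrite ge_min lexx.
move=> /(_ isT) /= A1.
have := Hd2 _ _ _ Hg (fun i k Hk => lt_le_trans (Hm i k Hk) _).
have -> : Num.min d1 d2 <= d2 by rewrite ge_min lexx orbT.
move=> /(_ isT) A2.
have := snD_tri Hs w (riemann_sum t xi F) v; rewrite (snBC Hs w (riemann_sum t xi F)); lra.
Qed.

(** The sections f(z1, .) of a continuous function with bounded support on a product all belong to
    one such class. *)
Definition mclass q (L B d e1 : R) F :=
  [/\ continuous F, supp_le L F, (forall x, q (F x) <= B) &
    (forall x x' : 'cV[R]_N, (forall i, `|x i 0 - x' i 0| < d) -> q (F x - F x') < e1)].

Lemma rint_unif q (L B d e1 e : R) : Q q -> 0 < L -> 0 <= B -> 0 < d -> 0 <= e1 -> 0 < e ->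
  \forall K \near \oo, forall F, mclass q L B d e1 F ->
    q (latsum K F - riemann_integral F) <= 2 * (2 * L + 1) ^+ N * e1 + e.
Proof.
move=> Hq L0 B0 d0 e10 e0; have [Kg [t [xi [Hg Hm]]]] := grid_exists L0 d0.
have e3 : 0 < e / 3 by rewrite divr_gt0.
have Hs := Qsn Qdef Hq.
have H := grid_near L0 Hg Hq B0 e3 e10 Hm; move: (H); apply: filterS => K HK F [cF sF HB Hu].
have /(cvgQ_lt Qdef)/(_ q _ Hq e3) H2 := riemann_latsum cF sF.
have [K' [K1 K2]] := filter_ex (filterI H H2).
have A := HK F cF sF HB Hu; have B' := K1 F cF sF HB Hu.
have T1 := snD_tri Hs (latsum K F) (riemann_sum t xi F) (riemann_integral F).
have T2 := snD_tri Hs (riemann_sum t xi F) (latsum K' F) (riemann_integral F).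
rewrite (snBC Hs (riemann_sum t xi F) (latsum K' F)) in T2.
move: A B' T1 T2 K2; set X := q _; set Y := q _; set Z := q _ ; lra.
Qed.

End RiemannSums.

Section RintTheory.
Context {R : realType} (V : tvsType R[i]) (Q : set (V -> R)).
Hypothesis Qdef : defining_system Q.
Hypothesis hV : hausdorff_space V.
Hypothesis complV : sequentially_complete V.

Definition cc N (F : 'cV[R]_N -> V) := continuous F /\ exists L, supp_le L F.

Lemma cc_L N (F : 'cV[R]_N -> V) : cc F -> exists2 L, 0 < L & supp_le L F.
Proof.
case=> _ [L sF]; exists (Num.max L 1); first by rewrite lt_max ltr01 orbT.
by apply: supp_leW sF; rewrite le_max lexx.
Qed.

Lemma supp_le_mul N L (g : 'cV[R]_N -> R[i]^o) (F : 'cV[R]_N -> V) :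
  supp_le L F -> supp_le L (fun z => (g z : R[i]) *: F z).
Proof. by move=> sF z; have [/eqP ->|/sF //] := boolP (F z == 0); rewrite scaler0 eqxx. Qed.

Lemma supp_le_mull N L (g : 'cV[R]_N -> R[i]^o) (F : 'cV[R]_N -> V) :
  supp_le L g -> supp_le L (fun z => (g z : R[i]) *: F z).
Proof. by move=> sF z; have [/eqP ->|/sF //] := boolP (g z == 0); rewrite scale0r eqxx. Qed.

Lemma supp_leD N L (F G : 'cV[R]_N -> V) :
  supp_le L F -> supp_le L G -> supp_le L (fun z => F z + G z).
Proof. by move=> sF sG z; have [/eqP ->|/sF //] := boolP (F z == 0); rewrite add0r; exact: sG. Qed.

Lemma ccD N (F G : 'cV[R]_N -> V) : cc F -> cc G -> cc (fun z => F z + G z).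
Proof.
move=> [cF [L sF]] [cG [M sG]]; split; first exact: contV_D.
exists (Num.max L M); apply: supp_leD.
  by apply: supp_leW sF; rewrite le_max lexx.
by apply: supp_leW sG; rewrite le_max lexx orbT.
Qed.

Lemma ccZ N a (F : 'cV[R]_N -> V) : cc F -> cc (fun z => a *: F z).
Proof.
move=> [cF [L sF]]; split; first exact: contV_Z.
by exists L => z; have [/eqP ->|/sF //] := boolP (F z == 0); rewrite scaler0 eqxx.
Qed.

Lemma cc_mul N (g : 'cV[R]_N -> R[i]^o) (F : 'cV[R]_N -> V) :
  continuous g -> cc F -> cc (fun z => (g z : R[i]) *: F z).
Proof.
move=> cg [cF [L sF]]; split; first exact: cont_mul.
by exists L; exact: supp_le_mul.
Qed.

Lemma cc_sum N (I : Type) (r : seq I) (F : I -> 'cV[R]_N -> V) :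
  (forall i, cc (F i)) -> cc (fun z => \sum_(i <- r) F i z).
Proof.
move=> H; elim: r => [|i r IH].
  under eq_fun do rewrite big_nil; split; first exact: contV_cst.
  by exists 0 => z; rewrite eqxx.
by under eq_fun do rewrite big_cons; exact: ccD.
Qed.

Lemma rint_lim N (F : 'cV[R]_N -> V) : cc F -> latsum K F @[K --> \oo] --> riemann_integral F.
Proof. by case=> cF [L sF]; exact: (riemann_latsum Qdef hV complV cF sF). Qed.

Lemma rint_unique N (F : 'cV[R]_N -> V) v : cc F -> latsum K F @[K --> \oo] --> v -> riemann_integral F = v.
Proof. by move=> /rint_lim H1 H2; exact: (cvg_unV hV H1 H2). Qed.

Lemma rintD N (F G : 'cV[R]_N -> V) : cc F -> cc G ->
  riemann_integral (fun z => F z + G z) = riemann_integral F + riemann_integral G.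
Proof.
move=> HF HG; apply: rint_unique; first exact: ccD.
have [[_ [L sF]] [_ [M sG]]] := (HF, HG).
pose X := Num.max (Num.max L M) 0.
have X0 : 0 <= X by rewrite le_max lexx orbT.
have sF' : supp_le X F by apply: supp_leW sF; rewrite !le_max lexx.
have sG' : supp_le X G by apply: supp_leW sG; rewrite !le_max lexx orbT.
under eq_fun do rewrite (latsumD _ X0 sF' sG').
by apply: cvgV_add; exact: rint_lim.
Qed.

Lemma rintZ N a (F : 'cV[R]_N -> V) : cc F ->
  riemann_integral (fun z => a *: F z) = a *: riemann_integral F.
Proof.
move=> HF; apply: rint_unique; first exact: ccZ.
have [L L0 sF] := cc_L HF.
under eq_fun do rewrite (latsumZ _ _ (ltW L0) sF).
by apply: cvgV_scalec; exact: rint_lim.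
Qed.

Lemma rintB N (F G : 'cV[R]_N -> V) : cc F -> cc G ->
  riemann_integral (fun z => F z - G z) = riemann_integral F - riemann_integral G.
Proof.
move=> HF HG; rewrite -[- riemann_integral G]scaleN1r -rintZ // -rintD //; last exact: ccZ.
by congr riemann_integral; apply/funext => z; rewrite scaleN1r.
Qed.

Lemma rint0 N : riemann_integral (fun _ : 'cV[R]_N => 0 : V) = 0.
Proof.
apply: rint_unique; first by split; [exact: contV_cst|exists 0 => z; rewrite eqxx].
under eq_fun do rewrite /latsum fsbig1 ?scaler0 //.
exact: cvg_cst.
Qed.

Lemma rint_sum N (I : Type) (r : seq I) (F : I -> 'cV[R]_N -> V) : (forall i, cc (F i)) ->
  riemann_integral (fun z => \sum_(i <- r) F i z) = \sum_(i <- r) riemann_integral (F i).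
Proof.
move=> H; elim: r => [|i r IH].
  by under eq_fun do rewrite big_nil; rewrite big_nil rint0.
under eq_fun do rewrite big_cons.
by rewrite big_cons rintD ?IH //; exact: cc_sum.
Qed.

Lemma lim_sn_le q (u : nat -> V) v C : Q q -> u K @[K --> \oo] --> v ->
  (\forall K \near \oo, q (u K) <= C) -> q v <= C.
Proof.
move=> Hq Hu HC; apply/ler_addgt0Pr => e e0; have Hs := Qsn Qdef Hq.
have /(cvgQ_lt Qdef)/(_ q _ Hq e0) H := Hu.
have [K [K1 K2]] := filter_ex (filterI H HC).
have := snD_tri Hs v (u K) 0; rewrite !subr0 (snBC Hs v (u K)).
by move: K1 K2; set X := q _; set Y := q _; lra.
Qed.

Lemma rint_bound N q a l (F : 'cV[R]_N -> V) B : Q q -> cc F -> 0 <= l -> suppbox a l F ->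
  (forall z, q (F z) <= B) -> q (riemann_integral F) <= (l + 1) ^+ N * B.
Proof.
move=> Hq HF l0 sF HB; apply: (lim_sn_le Hq (rint_lim HF)).
by apply: filterE => K; apply: latsum_bound sF HB => //; exact: (Qsn Qdef Hq).
Qed.

Lemma rint_bij N (F : 'cV[R]_N -> V) (u : 'cV[int]_N -> 'cV[int]_N) (U : 'cV[R]_N -> 'cV[R]_N) :
  bijective u -> (forall K k, U (latpt K k) = latpt K (u k)) -> cc F -> cc (F \o U) ->
  riemann_integral (F \o U) = riemann_integral F.
Proof.
move=> Hu HU HF HFU; apply: rint_unique => //.
under eq_fun do rewrite (latsum_bij _ Hu (HU _)).
exact: rint_lim.
Qed.

(** The mesh is used also as the step of the difference quotient D of F. The lattice sum of D
    vanishes by [latsum_shift], and D is uniformly close to F' because F' is uniformly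
    continuous. *)
Lemma rint_pd N i (F F' : 'cV[R]_N -> V) : cc F -> cc F' -> (forall x, pd i F x (F' x)) ->
  riemann_integral F' = 0.
Proof.
move=> HF HF' Hpd; apply: (sepQ Qdef hV) => q Hq; have Hs := Qsn Qdef Hq.
apply/eqP; rewrite subr0 eq_le (sn_ge0 Hs) andbT; apply/ler_addgt0Pr => e e0; rewrite add0r.
have [[cF [L0 sF0]] [cF' [M0 sG0]]] := (HF, HF').
pose L := Num.max (Num.max L0 M0) 0.
have Lge : 0 <= L by rewrite le_max lexx orbT.
have sF : supp_le L F by apply: supp_leW sF0; rewrite !le_max lexx.
have sG : supp_le L F' by apply: supp_leW sG0; rewrite !le_max lexx orbT.
have L1 : 0 <= L + 1 by rewrite addr_ge0.
(* The shift by one mesh, at most 1, enlarges the support to L + 1; C is then the constant of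
   [latsum_bound] for a box of side 2 (L + 1). *)
pose C := (2 * (L + 1) + 1) ^+ N.
have C0 : 0 < C by rewrite exprn_gt0 // ltr_wpDl // mulr_ge0.
have ec : 0 < e / C by rewrite divr_gt0.
have [d d0 Hd] := unif_cont Qdef Hq cF' sG ec.
apply: (lim_sn_le Hq (rint_lim HF')); have := mesh_near d0; apply: filterS => K HK.
pose h := mesh (R := R) K; have h0 : 0 < h := mesh_gt0 K.
pose S z := F (z + h *: delta_mx i 0).
have sS : supp_le (L + 1) S.
  move=> z /sF Hz j; have := Hz j; rewrite mxE => H.
  have := norm_e i h j; rewrite (ger0_norm (ltW h0)) => HX.
  have h1 : h <= 1 := mesh_le1 K.
  have HN (a b : R) : `|a| <= `|a + b| + `|b| by have := ler_normB (a + b) b; rewrite addrK.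
  by apply: le_trans (HN (z j 0) ((h *: delta_mx i 0) j 0)) _; apply: lerD H (le_trans HX h1).
have sF1 : supp_le (L + 1) F by apply: supp_leW sF; rewrite lerDl.
have sG1 : supp_le (L + 1) F' by apply: supp_leW sG; rewrite lerDl.
pose D z := (h^-1)%:C *: (S z - F z).
have sSF : supp_le (L + 1) (fun z => S z - F z).
  by move=> z; have [/eqP ->|/sS //] := boolP (S z == 0); rewrite sub0r oppr_eq0 => /sF1.
have sD : supp_le (L + 1) D.
  by move=> z; rewrite /D; have [/eqP ->|/sSF //] := boolP (S z - F z == 0); rewrite scaler0 eqxx.
have lD : latsum K D = 0.
  by rewrite (latsumZ _ _ L1 sSF) (latsumB _ L1 sS sF1) latsum_shift subrr scaler0.
have -> : latsum K F' = latsum K (fun z => F' z - D z).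
  by rewrite (latsumB _ L1 sG1 sD) lD subr0.
have sE : supp_le (L + 1) (fun z => F' z - D z).
  by move=> z; have [/eqP ->|/sG1 //] := boolP (F' z == 0); rewrite sub0r oppr_eq0 => /sD.
have -> : e = C * (e / C) by rewrite mulrC divfK // lt0r_neq0.
apply: (latsum_bound _ Hs _ (supp_le_box sE)); first by rewrite mulr_ge0.
move=> z; rewrite (snBC Hs).
have Ht t : `|t| <= `|h| -> q (F' (z + t *: delta_mx i 0) - F' z) <= e / C.
  move=> ht; apply/ltW/Hd => j; rewrite [(z + _) j 0]mxE addrAC subrr add0r.
  by apply: le_lt_trans (norm_e i t j) _; apply: le_lt_trans ht _; rewrite ger0_norm // ltW.
have := @line_taylor R V Q Qdef N q i F F' z h (F' z) (e / C) Hq Hpd Ht => H.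
have -> : D z - F' z = (h^-1)%:C *: (S z - F z - h%:C *: F' z).
  by rewrite [RHS]scalerBr scalerA -rmorphM mulVf ?scale1r // lt0r_neq0.
rewrite (snZr Hs) normrV ?unitfE ?lt0r_neq0 // mulrC ler_pdivrMr ?normr_gt0 ?lt0r_neq0 //.
Qed.

End RintTheory.

Section Fubini.
Context {R : realType} (V : tvsType R[i]) (Q : set (V -> R)).
Hypothesis Qdef : defining_system Q.
Hypothesis hV : hausdorff_space V.
Hypothesis complV : sequentially_complete V.

Definition cbox N (b : nat) : set 'cV[int]_N := [set k | forall i, - b%:Z <= k i 0 <= b%:Z].

Lemma cbox_finite N b : finite_set (cbox (N := N) b).
Proof.
apply: (@sub_finite_set _ _ [set boxpt (const_mx (- b%:Z)) c | c in [set: {ffun 'I_N -> 'I_(b + b).+1}]]).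
  move=> k Hk.
  have Hb i : (`|(k i 0 + b%:Z)%R|%N < (b + b).+1)%N.
    by have := Hk i; move: (k i 0) => x; clear; lia.
  exists [ffun i => Ordinal (Hb i)] => //; apply/colP => i; rewrite !mxE ffunE /=.
  by have := Hk i; move: (k i 0) => x; clear; lia.
by apply: finite_image; exact: finite_finset.
Qed.

Lemma latsum_cbox N K (F : 'cV[R]_N -> V) L b : supp_le L F -> L * K.+1%:R <= b%:R ->
  latsum K F = ((mesh K ^+ N)%:C) *: \sum_(k \in cbox b) F (latpt K k).
Proof.
move=> sF Lb; rewrite /latsum; congr (_ *: _); apply/esym/fsbig_widen => // k /= [_ Hk].
apply/eqP; apply: contraT => /sF Fk; exfalso; apply: Hk => i.
have := Fk i; rewrite latptE /mesh mulrC normrM [`|_^-1|]ger0_norm ?invr_ge0 //.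
rewrite ler_pdivrMr ?ltr0n // => H.
by rewrite -ler_norml -(ler_int R) intr_norm; apply: le_trans H Lb.
Qed.

Lemma latpt_col N1 N2 K (k1 : 'cV[int]_N1) (k2 : 'cV[int]_N2) :
  latpt (R := R) K (col_mx k1 k2) = col_mx (latpt K k1) (latpt K k2).
Proof. by rewrite /latpt map_col_mx scale_col_mx. Qed.

Lemma supp_le_col1 N1 N2 (f : 'cV[R]_(N1 + N2) -> V) L z1 : supp_le L f ->
  supp_le L (fun z2 => f (col_mx z1 z2)).
Proof. by move=> sf z2 /sf H i; have := H (rshift N1 i); rewrite col_mxEd. Qed.

Lemma col_zero N1 N2 (f : 'cV[R]_(N1 + N2) -> V) L (z1 : 'cV[R]_N1) z2 i : supp_le L f ->
  ~~ (`|z1 i 0| <= L) -> f (col_mx z1 z2) = 0.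
Proof.
move=> sf Hi; apply/eqP; apply: contraNT Hi => /sf /(_ (lshift N2 i)).
by rewrite col_mxEu.
Qed.

Lemma latsum_fub N1 N2 K (f : 'cV[R]_(N1 + N2) -> V) L : supp_le L f ->
  latsum K f = latsum K (fun z1 => latsum K (fun z2 => f (col_mx z1 z2))).
Proof.
move=> sf; pose b := (Num.truncn (L * K.+1%:R)).+1.
have Lb : L * K.+1%:R <= b%:R by apply/ltW; exact: truncnS_gt.
have s1 : supp_le L (fun z1 => latsum K (fun z2 => f (col_mx z1 z2))).
  move=> z1 H i; apply: contraNT H => Hi.
  rewrite /latsum fsbig1 ?scaler0 // => k _; exact: (col_zero _ sf Hi).
rewrite (latsum_cbox sf Lb) (latsum_cbox s1 Lb).
under [in RHS]eq_fsbigr => k1 _ do rewrite (latsum_cbox (supp_le_col1 (z1 := latpt K k1) sf) Lb).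
rewrite (fsbig_finite _ _ (cbox_finite N1 b)) /= -scaler_sumr scalerA -rmorphM -exprD.
rewrite -(fsbig_finite _ _ (cbox_finite N1 b)) /=; congr (_ *: _).
rewrite (pair_fsbig _ (fun k1 k2 => f (col_mx (latpt K k1) (latpt K k2))) (cbox_finite N1 b) (cbox_finite N2 b)).
rewrite (reindex_fsbig (fun p : 'cV[int]_N1 * 'cV[int]_N2 => col_mx p.1 p.2) (cbox b `*` cbox b)).
  by apply: eq_fsbigr => p _; rewrite latpt_col.
split.
- move=> [k1 k2] [/= H1 H2] i; case: (split_ordP i) => j ->; rewrite ?col_mxEu ?col_mxEd; [exact: H1|exact: H2].
- by move=> [a1 a2] [b1 b2] _ _ /= /eq_col_mx [-> ->].
move=> k Hk; exists (usubmx k, dsubmx k); last by rewrite /= vsubmxK.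
by split=> i /=; rewrite mxE; exact: Hk.
Qed.

Lemma cont_col N1 N2 (f : 'cV[R]_(N1 + N2) -> V) z1 : continuous f ->
  continuous (fun z2 => f (col_mx z1 z2)).
Proof.
move=> cf z2; have -> : (fun z2 => f (col_mx z1 z2)) = (fun z2 => f (col_mx z1 0 + col_mx 0 1%:M *m z2)).
  by apply/funext => x; rewrite mul_col_mx mul0mx mul1mx add_col_mx addr0 add0r.
apply: (cvg_comp _ f (@cont_aff R (N1 + N2) N2 (col_mx 0 1%:M) (col_mx z1 0) z2)); exact: cf.
Qed.

(** For lattice sums Fubini is an identity, [latsum_fub], and the inner sums converge uniformly in
    z1 by [rint_unif]. Stating the result as a limit of lattice sums avoids proving that the inner
    integral is continuous in z1. *)
Lemma rint_fub N1 N2 (f : 'cV[R]_(N1 + N2) -> V) : cc f ->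
  latsum K (fun z1 => riemann_integral (fun z2 => f (col_mx z1 z2))) @[K --> \oo] --> riemann_integral f.
Proof.
move=> Hf; have [L L0 sf] := cc_L Hf; have [cf _] := Hf.
have Hlim := rint_lim Qdef hV complV Hf.
apply/(cvgQ_lt Qdef) => q e Hq e0; have Hs := Qsn Qdef Hq.
have e2 : 0 < e / 2 by rewrite divr_gt0.
have /(cvgQ_lt Qdef)/(_ q _ Hq e2) H1 := Hlim.
have [B B0 HB] := cont_bounded Qdef Hq cf sf.
pose C := (2 * L + 1) ^+ N1; pose C2 := 2 * (2 * L + 1) ^+ N2.
have L21 : 0 < 2 * L + 1 by rewrite addr_gt0 // mulr_gt0.
have C0 : 0 < C by rewrite exprn_gt0.
have C20 : 0 < C2 by rewrite mulr_gt0 // exprn_gt0.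
(* Together with [e1'], chosen so that the total error C (C2 e1 + e1') equals e/4 + e/8, below
   e/2. *)
have e1 : 0 < e / 4 / C / C2 by rewrite !divr_gt0.
have e1' : 0 < e / 8 / C by rewrite !divr_gt0.
have [d d0 Hd] := unif_cont Qdef Hq cf sf e1.
have H2 := @rint_unif R N2 V Q Qdef hV complV _ _ _ _ _ _ Hq L0 B0 d0 (ltW e1) e1'.
apply: filterS2 H1 H2 => K K1 K2.
have s1 : supp_le L (fun z1 => riemann_integral (fun z2 => f (col_mx z1 z2))).
  move=> z1 H i; apply: contraNT H => Hi; apply/eqP.
  have -> : (fun z2 => f (col_mx z1 z2)) = fun=> 0.
    by apply/funext => z2; exact: (col_zero _ sf Hi).
  exact: (rint0 Qdef hV complV).
have s2 : supp_le L (fun z1 => latsum K (fun z2 => f (col_mx z1 z2))).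
  move=> z1 H i; apply: contraNT H => Hi.
  rewrite /latsum fsbig1 ?scaler0 // => k _; exact: (col_zero _ sf Hi).
have s3 : supp_le L (fun z1 => riemann_integral (fun z2 => f (col_mx z1 z2)) - latsum K (fun z2 => f (col_mx z1 z2))).
  move=> z1 H i; apply: contraNT H => Hi; rewrite (iffLR (supp_leP _ _) s1) ?(iffLR (supp_leP _ _) s2) ?subrr //;
  by exists i; rewrite ltNge.
have A : q (latsum K (fun z1 => riemann_integral (fun z2 => f (col_mx z1 z2))) - latsum K f) <= C * (C2 * (e / 4 / C / C2) + e / 8 / C).
  rewrite (latsum_fub K sf) -(latsumB _ (ltW L0) s1 s2).
  apply: (latsum_bound _ Hs _ (supp_le_box s3)); first by rewrite mulr_ge0 // ltW.
  move=> z1; rewrite (snBC Hs); apply: K2; split.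
  - exact: cont_col.
  - exact: supp_le_col1.
  - by move=> x.
  - move=> x x' Hx; apply: Hd => i; case: (split_ordP i) => j ->; rewrite ?col_mxEu ?col_mxEd //.
    by rewrite subrr normr0.
have E : C * (C2 * (e / 4 / C / C2) + e / 8 / C) = e / 4 + e / 8.
  by field; rewrite !lt0r_neq0.
rewrite E in A.
have := snD_tri Hs (latsum K (fun z1 => riemann_integral (fun z2 => f (col_mx z1 z2)))) (latsum K f) (riemann_integral f).
by move: A K1; set X := q _; set Y := q _; set Z := q _; lra.
Qed.

Lemma rint_lin_comp (W : tvsType R[i]) (QW : set (W -> R)) (T : V -> W) N (F : 'cV[R]_N -> V) :
  defining_system QW -> hausdorff_space W -> sequentially_complete W ->
  linear T -> continuous T -> cc F -> cc (T \o F) /\ riemann_integral (T \o F) = T (riemann_integral F).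
Proof.
move=> QWdef hW complW HT cT HF; have [L L0 sF] := cc_L HF; have [cF _] := HF.
have HTF : cc (T \o F).
  split; first by move=> x; apply: (cvg_comp _ T (cF x)); exact: cT.
  by exists L => z /=; have [/eqP ->|/sF //] := boolP (F z == 0); rewrite (linT0 HT) eqxx.
split=> //; apply: (rint_unique QWdef hW complW) => //.
under eq_fun do rewrite (latsum_lin _ HT (ltW L0) sF).
by apply: (cvg_lin cT); exact: (rint_lim Qdef hV complV HF).
Qed.

End Fubini.

(** * Bumps, weights and cutoffs *)

Section SmoothOneVariable.
Context {R : realType}.
Implicit Types (f g : R -> R) (x : R).

Definition der f f' := forall x, is_derive x (1 : R) f (f' x).

Definition chain (g : nat -> R -> R) := forall k, der (g k) (g k.+1).

Definition S1 f := exists2 g, chain g & g 0%N = f.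

(** A principle of coinduction: choosing a derivative inside the class at each stage yields the
    whole sequence of derivatives. *)
Lemma S1_coind (P : set (R -> R)) :
  (forall f, P f -> exists2 f', P f' & der f f') -> forall f, P f -> S1 f.
Proof.
move=> H; have Hex : forall f, exists f', P f -> P f' /\ der f f'.
  move=> f; have [/H[f' Pf' Hf']|nPf] := pselect (P f); first by exists f'.
  by exists f.
have [nx Hnx] := choice Hex.
move=> f Pf; exists (fun k => iter k nx f) => // k /=.
have Pk : P (iter k nx f) by elim: k => //= k /Hnx [].
by have [] := Hnx _ Pk.
Qed.

Lemma S1_der f : S1 f -> exists2 f', S1 f' & der f f'.
Proof.
move=> [g Hg <-]; exists (g 1%N); last exact: Hg.
by exists (fun k => g k.+1) => // k; exact: Hg.
Qed.

(** This closure is stable under differentiation by the Leibniz and chain rules, so [S1_coind] gives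
    the smoothness of composite functions without formulas for their derivatives. *)
Inductive cl : (R -> R) -> Prop :=
| cl_S f : S1 f -> cl f
| cl_cst c : cl (fun=> c)
| cl_id : cl id
| cl_D f g : cl f -> cl g -> cl (f \+ g)
| cl_M f g : cl f -> cl g -> cl (f \* g)
| cl_C f g : cl f -> cl g -> cl (f \o g).

Lemma cl_der f : cl f -> exists2 f', cl f' & der f f'.
Proof.
elim=> {f}[f /S1_der [f' H1 H2]|c||f g cf [f' F1 F2] cg [g' G1 G2]|f g cf [f' F1 F2] cg [g' G1 G2]|f g cf [f' F1 F2] cg [g' G1 G2]].
- by exists f' => //; exact: cl_S.
- by exists (fun=> 0) => [|x]; [exact: cl_cst|exact: is_derive_cst].
- by exists (fun=> 1) => [|x]; [exact: cl_cst|exact: is_derive_id].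
- exists (f' \+ g') => [|x]; first exact: cl_D.
  by have := F2 x; have := G2 x => *; exact: is_deriveD.
- exists ((f \* g') \+ (g \* f')) => [|x]; first by apply: cl_D; apply: cl_M.
  by have := F2 x; have := G2 x => *; exact: is_deriveM.
- exists ((f' \o g) \* g') => [|x]; first by apply: cl_M => //; apply: cl_C.
  by have := F2 (g x); have := G2 x => *; apply: is_derive1_comp.
Qed.

Lemma cl_S1 f : cl f -> S1 f.
Proof. exact: (S1_coind cl_der). Qed.

(* The derivatives of exp(-1/x) are combinations of the functions [be k]. *)
Definition be (k : nat) x : R := if 0 < x then x^-1 ^+ k * expR (- x^-1) else 0.

Lemma pow_expR n : exists2 C : R, 0 <= C & forall y, 0 <= y -> y ^+ n <= C * expR y.
Proof.
case: n => [|n]; first by exists 1 => // y y0; rewrite expr0 mul1r; apply: le_trans (expR_ge1Dx y); rewrite lerDl.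
have n0 : (0 : R) < n.+1%:R by rewrite ltr0n.
exists (n.+1%:R ^+ n.+1); first by rewrite exprn_ge0 // ltW.
move=> y y0; have -> : expR y = expR (y / n.+1%:R) ^+ n.+1.
  by rewrite -expRM_natl mulrC divfK // lt0r_neq0.
rewrite -exprMn; apply: lerXn2r; rewrite ?nnegrE //.
have {1}-> : y = n.+1%:R * (y / n.+1%:R) by rewrite mulrC divfK // lt0r_neq0.
by rewrite ler_pM2l //; apply: le_trans (expR_ge1Dx _); rewrite lerDr.
Qed.

(** Quadratic flatness at 0 makes the difference quotients there vanish in the limit. It holds
    because exp(1/x) dominates x^-(k + 2). *)
Lemma be_bound k : exists2 C : R, 0 <= C & forall x, `|be k x| <= C * x ^+ 2.
Proof.
have [C C0 HC] := pow_expR (k + 2); exists C => // x; rewrite /be.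
case: ifP => [x0|_]; last by rewrite normr0 mulr_ge0 // sqr_ge0.
have y0 : 0 < x^-1 by rewrite invr_gt0.
rewrite ger0_norm; last by rewrite mulr_ge0 ?expR_ge0 // exprn_ge0 // ltW.
have E1 : x^-1 ^+ 2 * x ^+ 2 = 1 by rewrite -exprMn mulVf ?expr1n // lt0r_neq0.
have E2 : expR x^-1 * expR (- x^-1) = 1 by rewrite -expRD subrr expR0.
have -> : x^-1 ^+ k * expR (- x^-1) = x^-1 ^+ (k + 2) * (expR (- x^-1) * x ^+ 2).
  by rewrite exprD -[LHS]mulr1 -E1; ring.
have -> : C * x ^+ 2 = C * expR x^-1 * (expR (- x^-1) * x ^+ 2).
  by rewrite -[LHS]mulr1 -E2; ring.
rewrite ler_wpM2r ?HC ?(ltW y0) // mulr_ge0 ?expR_ge0 ?sqr_ge0 //.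
Qed.

Lemma is_derive_diff f x d : h^-1 * (f (x + h) - f x) @[h --> 0^'] --> d -> is_derive x (1 : R) f d.
Proof.
move=> H.
have H' : (fun h => h^-1 *: ((f \o shift x) (h *: (1 : R)) - f x)) @ 0^' --> d.
  by apply: cvg_eqn H; apply: filterE => h /=; rewrite [h *: 1]mulr1 [h + x]addrC.
by apply: DeriveDef; [apply/cvg_ex; exists d|exact: cvg_lim].
Qed.

Lemma diff_is_derive f x d : is_derive x (1 : R) f d -> h^-1 * (f (x + h) - f x) @[h --> 0^'] --> d.
Proof.
move=> [H1 H2]; have : h^-1 *: ((f \o shift x) (h *: (1 : R)) - f x) @[h --> 0^'] --> d.
  by rewrite -H2; exact: H1.
by apply: cvg_eqn; apply: filterE => h /=; rewrite [h *: 1]mulr1 [h + x]addrC.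
Qed.

Lemma be_der k : der (be k) (fun x => - k%:R * be k.+1 x + be k.+2 x).
Proof.
move=> x; have [x0|x0|->] := ltgtP x 0.
- have -> : - k%:R * be k.+1 x + be k.+2 x = 0 by rewrite /be !ltNge (ltW x0) /= mulr0 addr0.
  apply: (@near_eq_is_derive _ _ _ (cst 0) _ _ _ _ _ (is_derive_cst _ _ _)).
  near=> y; rewrite /be /cst ltNge ifF //; apply/negbF/ltW; near: y; exact: lt_nbhsl.
- have -> : - k%:R * be k.+1 x + be k.+2 x = x^-1 ^+ k * (x^-2 * expR (- x^-1)) + expR (- x^-1) * (- (k%:R * x^-1 ^+ k.+1)).
    by rewrite /be x0 -exprVn !exprS; ring.
  have xn : x != 0 by rewrite lt0r_neq0.
  have Hi : is_derive x (1 : R) (fun y : R => y^-1) (- x^-2).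
    apply: is_derive_eq; first exact: (is_deriveV (f := id)).
    by rewrite -[X in _ *: X]/(1 : R) [LHS]mulr1.
  have He : is_derive x (1 : R) (fun y => expR (- y^-1)) (x^-2 * expR (- x^-1)).
    have HN : is_derive x (1 : R) (fun y : R => - y^-1) (x^-2).
      by rewrite -[x^-2]opprK; exact: (is_deriveN Hi).
    by rewrite mulrC; exact: (@is_derive1_comp R expR _ x _ _ (is_derive_expR _) HN).
  have Hp : is_derive x (1 : R) (fun y => y^-1 ^+ k) (- (k%:R * x^-1 ^+ k.+1)).
    elim: k => [|k IH]; first by rewrite mul0r oppr0; exact: is_derive_cst.
    rewrite (_ : - _ = x^-1 * (- (k%:R * x^-1 ^+ k.+1)) + x^-1 ^+ k * (- x^-2)).
      rewrite (_ : (fun y : R => y^-1 ^+ k.+1) = (fun y => y^-1) \* (fun y => y^-1 ^+ k)).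
        exact: is_deriveM.
      by apply/funext => y; rewrite exprS.
    by rewrite -exprVn !exprS -natr1; ring.
  apply: (@near_eq_is_derive _ _ _ ((fun y => y^-1 ^+ k) \* (fun y => expR (- y^-1))) _ _ _ _ _ (is_deriveM Hp He)).
  by near=> y; rewrite /be ifT //; near: y; exact: lt_nbhsr.
have -> : - k%:R * be k.+1 0 + be k.+2 0 = 0 by rewrite /be ltxx mulr0 addr0.
apply: is_derive_diff; rewrite {2}/be ltxx.
have [C C0 HC] := be_bound k; apply/cvgrPdist_lt => e e0.
apply/near0'P; exists (e / (C + 1)); first by rewrite divr_gt0 // ltr_wpDl.
move=> h h0 hd; rewrite sub0r normrN add0r subr0 normrM normrV ?unitfE //.
rewrite mulrC ltr_pdivrMr ?normr_gt0 //; apply: le_lt_trans (HC h) _.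
rewrite -normr_id -[h ^+ 2]ger0_norm ?sqr_ge0 // normrX expr2 normr_id mulrA ltr_pM2r ?normr_gt0 //.
rewrite ltr_pdivlMr ?ltr_wpDl // in hd; apply: le_lt_trans hd.
by rewrite mulrC ler_wpM2l // lerDl.
Unshelve. all: by end_near.
Qed.

Inductive fl : (R -> R) -> Prop :=
| fl_b k : fl (be k)
| fl_D f g : fl f -> fl g -> fl (f \+ g)
| fl_Z c f : fl f -> fl (fun x => c * f x).

Lemma S1_be k : S1 (be k).
Proof.
apply: (S1_coind (P := fl)) (fl_b k) => f.
elim=> {f}[{}k|f g _ [f' F1 F2] _ [g' G1 G2]|c f _ [f' F1 F2]].
- exists (fun x => - k%:R * be k.+1 x + be k.+2 x); last exact: be_der.
  exact: (fl_D (fl_Z _ (fl_b _)) (fl_b _)).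
- exists (f' \+ g') => [|x]; first exact: fl_D.
  by have := F2 x; have := G2 x => *; exact: is_deriveD.
- exists (fun x => c * f' x) => [|x]; first exact: fl_Z.
  by have := F2 x => ?; exact: (@is_deriveZ _ _ _ f c x 1 (f' x) _).
Qed.

(** A passage from 0 to 1 without quotients, as [cl] has no inverses. The inner e [be 0 (1 - x)] is
    at least 1 for x <= 0, where the outer [be 0] then vanishes, and is 0 for x >= 1, where the
    outer factor normalises to 1. *)
Definition step x : R := expR 1 * be 0 (1 - expR 1 * be 0 (1 - x)).

Lemma step0 x : x <= 0 -> step x = 0.
Proof.
move=> x0; rewrite /step {1}/be ifF ?mulr0 //; apply/negbTE; rewrite -leNgt subr_le0.
have h1 : 0 < 1 - x by lra.
rewrite /be h1 expr0 mul1r -expRD -[leLHS]expR0 ler_expR.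
rewrite subr_ge0 invf_le1 //; lra.
Qed.

Lemma step1 x : 1 <= x -> step x = 1.
Proof.
move=> x1; rewrite /step {2}/be ifF; last by apply/negbTE; rewrite -leNgt; lra.
by rewrite mulr0 subr0 /be ltr01 expr0 mul1r invr1 -expRD subrr expR0.
Qed.

Lemma S1_step : S1 step.
Proof.
apply: cl_S1; rewrite (_ : step = (fun=> expR 1) \* (be 0 \o ((fun=> 1) \+ ((fun=> - expR 1) \* (be 0 \o ((fun=> 1) \+ ((fun=> -1) \* id))))))).
  by apply: cl_M (cl_cst _) (cl_C (cl_S (S1_be _)) (cl_D (cl_cst _) (cl_M (cl_cst _) (cl_C (cl_S (S1_be _)) (cl_D (cl_cst _) (cl_M (cl_cst _) cl_id)))))).
by apply/funext => x; rewrite /step /= mulN1r mulNr.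
Qed.

(** As a difference of two consecutive translates, its integral translates telescope, whence a
    partition of unity. *)
Definition bump x : R := step x - step (x - 1).

Lemma S1_bump : S1 bump.
Proof.
apply: cl_S1; rewrite (_ : bump = step \+ ((fun=> -1) \* (step \o (id \+ (fun=> -1))))).
  by apply: cl_D (cl_S S1_step) (cl_M (cl_cst _) (cl_C (cl_S S1_step) (cl_D cl_id (cl_cst _)))).
by apply/funext => x; rewrite /bump /= mulN1r.
Qed.

Lemma bump_supp x : bump x != 0 -> 0 <= x <= 2.
Proof.
rewrite /bump; have [x0|x0] := ltP x 0; first by rewrite !step0 ?subrr ?eqxx //; lra.
by have [x2|//] := ltP 2 x; rewrite !step1 ?subrr ?eqxx //; lra.
Qed.

Lemma bump_sum x (a : int) (m : nat) : a%:~R + 1 <= x -> x <= a%:~R + m%:R ->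
  \sum_(k < m) bump (x - (a + k%:Z)%:~R) = 1.
Proof.
move=> ax xm; have -> : \sum_(k < m) bump (x - (a + k%:Z)%:~R) = step (x - a%:~R) - step (x - (a + m%:Z)%:~R).
  elim: m {xm} => [|m IH]; first by rewrite big_ord0 addr0 subrr.
  rewrite big_ord_recr /= IH /bump -addn1 PoszD [a + (m%:Z + _)]addrA [(a + m%:Z + 1)%:~R]intrD opprD addrA.
  by rewrite addrA subrK.
rewrite step1 ?step0 ?subr0 //; last by lra.
by rewrite rmorphD /=; rewrite -[m%:~R]/(m%:R); lra.
Qed.

Definition eta x : R := step (x + 2) * step (2 - x).

Lemma S1_eta : S1 eta.
Proof.
apply: cl_S1; rewrite (_ : eta = (step \o (id \+ (fun=> 2))) \* (step \o ((fun=> 2) \+ ((fun=> -1) \* id)))).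
  by apply: cl_M (cl_C (cl_S S1_step) (cl_D cl_id (cl_cst _))) (cl_C (cl_S S1_step) (cl_D (cl_cst _) (cl_M (cl_cst _) cl_id))).
by apply/funext => x; rewrite /eta /= mulN1r.
Qed.

Lemma eta1 x : `|x| <= 1 -> eta x = 1.
Proof. by rewrite ler_norml => /andP[H1 H2]; rewrite /eta !step1 ?mulr1 //; lra. Qed.

Lemma eta0 x : eta x != 0 -> `|x| <= 2.
Proof.
rewrite /eta => H; rewrite ler_norml; apply/andP; split; rewrite leNgt; apply: contraNN H => H.
  by rewrite step0 ?mul0r //; lra.
by rewrite [X in _ * X]step0 ?mulr0 //; lra.
Qed.

Lemma chain_supp (g : nat -> R -> R) (L : R) : chain g -> (forall x, g 0%N x != 0 -> `|x| <= L) ->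
  forall k x, g k x != 0 -> `|x| <= L.
Proof.
move=> Hg H0; elim=> [//|k IH] x; apply: contraNT; rewrite -ltNge => Lx.
have Hz y : L < `|y| -> g k y = 0 by move=> Ly; apply/eqP; apply: contraTT Ly => /IH; rewrite -leNgt.
have := diff_is_derive (Hg k x) => H.
apply/eqP; apply: (cvg_unique _ H); first exact: Rhausdorff.
apply: (cvg_eqn _ (cvg_cst _)); apply/near0'P; exists (`|x| - L); first by rewrite subr_gt0.
move=> h h0 hd; rewrite !Hz ?subrr ?mulr0 //.
by have := ler_normB (x + h) h; rewrite addrK; lra.
Qed.

Lemma chain_cont (g : nat -> R -> R) k : chain g -> continuous (g k).
Proof.
by move=> Hg x; apply: differentiable_continuous; apply/derivable1_diffP; have [] := Hg k x.
Qed.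

Lemma chain_bounded (g : nat -> R -> R) (L : R) : chain g -> (forall x, g 0%N x != 0 -> `|x| <= L) ->
  forall k, exists2 B : R, 0 <= B & forall x, `|g k x| <= B.
Proof.
move=> Hg H0 k; have Hk := chain_supp Hg H0 (k := k).
have := compact_bounded (continuous_compact (continuous_subspaceT (chain_cont (k := k) Hg)) (@segment_compact R (-L) L)).
move=> [M [_ HM]]; exists (`|M| + 1); first by rewrite addr_ge0.
have Hb := HM (`|M| + 1) ltac:(have := ler_norm M; lra).
move=> x; have [->|/Hk Hx] := eqVneq (g k x) 0; first by rewrite normr0 addr_ge0.
by apply: Hb; exists x => //=; rewrite in_itv /= -ler_norml.
Qed.

End SmoothOneVariable.

Section Weight.
Context {R : realType}.

Definition wt N (z : 'cV[R]_N) : R := 1 + sqnorm z.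

Lemma sqnorm_ge0 N (z : 'cV[R]_N) : 0 <= sqnorm z.
Proof. by apply: sumr_ge0 => i _; exact: sqr_ge0. Qed.

Lemma wt_ge1 N (z : 'cV[R]_N) : 1 <= wt z.
Proof. by rewrite lerDl sqnorm_ge0. Qed.

Lemma wt_gt0 N (z : 'cV[R]_N) : 0 < wt z.
Proof. exact: lt_le_trans ltr01 (wt_ge1 z). Qed.

Lemma wt_ge0 N (z : 'cV[R]_N) : 0 <= wt z.
Proof. exact: ltW (wt_gt0 z). Qed.

Lemma wtp_gt0 N (z : 'cV[R]_N) e : 0 < wt z `^ e.
Proof. exact: powR_gt0 (wt_gt0 z). Qed.

Lemma wtp_ge0 N (z : 'cV[R]_N) e : 0 <= wt z `^ e.
Proof. exact: powR_ge0. Qed.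

Lemma wtp_mono N (z : 'cV[R]_N) e e' : e <= e' -> wt z `^ e <= wt z `^ e'.
Proof. by move=> H; apply: ler_powR => //; exact: wt_ge1. Qed.

Lemma wtp_ge1 N (z : 'cV[R]_N) e : 0 <= e -> 1 <= wt z `^ e.
Proof. by move=> H; rewrite -(powRr0 (wt z)); apply: wtp_mono. Qed.

Lemma wtpD N (z : 'cV[R]_N) e e' : wt z `^ (e + e') = wt z `^ e * wt z `^ e'.
Proof. by rewrite powRD // lt0r_neq0 ?wt_gt0 // implybT. Qed.

Lemma coord_wt N (z : 'cV[R]_N) i : `|z i 0| <= wt z `^ 2^-1.
Proof.
rewrite powR12_sqrt ?wt_ge0 // -sqrtr_sqr ler_wsqrtr //.
rewrite /wt /sqnorm (bigD1 i) //= addrCA lerDl addr_ge0 // sumr_ge0 // => j _; exact: sqr_ge0.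
Qed.

Lemma sqnormD N (y z : 'cV[R]_N) : sqnorm (y + z) <= 2 * (sqnorm y + sqnorm z).
Proof.
rewrite /sqnorm -big_split mulr_sumr; apply: ler_sum => i _ /=.
by rewrite mxE -subr_ge0 (_ : _ - _ = (y i 0 - z i 0) ^+ 2) ?sqr_ge0 //; ring.
Qed.

Lemma wtD N (y z : 'cV[R]_N) : wt (y + z) <= 2 * (wt y * wt z).
Proof. by have := sqnormD y z; rewrite /wt; have := sqnorm_ge0 y; have := sqnorm_ge0 z; nra. Qed.

Lemma sqnorm_mul N N' (A : 'M[R]_(N', N)) :
  exists2 C : R, 0 <= C & forall z, sqnorm (A *m z) <= C * sqnorm z.
Proof.
pose a := \sum_i \sum_j `|A i j|; have a0 : 0 <= a by apply: sumr_ge0 => i _; apply: sumr_ge0.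
exists (N'%:R * a ^+ 2); first by rewrite mulr_ge0 // exprn_ge0.
move=> z; pose s := Num.sqrt (sqnorm z).
have zs j : `|z j 0| <= s.
  rewrite /s -sqrtr_sqr ler_wsqrtr // /sqnorm (bigD1 j) //= lerDl sumr_ge0 // => *; exact: sqr_ge0.
have H i : (A *m z) i 0 ^+ 2 <= (a * s) ^+ 2.
  have as0 : 0 <= a * s by rewrite mulr_ge0 // sqrtr_ge0.
  rewrite -[leLHS]real_normK ?num_real //; apply: lerXn2r; rewrite ?nnegrE // mxE.
  apply: le_trans (ler_norm_sum _ _ _) _.
  apply: (@le_trans _ _ (\sum_j `|A i j| * s)).
    by apply: ler_sum => j _; rewrite normrM ler_wpM2l.
  rewrite -mulr_suml ler_wpM2r ?sqrtr_ge0 // /a [leRHS](bigD1 i) //= lerDl.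
  by apply: sumr_ge0 => k _; apply: sumr_ge0.
apply: le_trans (ler_sum _ (fun i _ => H i)) _.
by rewrite sumr_const card_ord -[leLHS]mulr_natl exprMn sqr_sqrtr ?sqnorm_ge0 // mulrA.
Qed.

Lemma wt_aff N N' (A : 'M[R]_(N', N)) :
  exists2 C : R, 1 <= C & forall c z, wt (c + A *m z) <= C * (wt c * wt z).
Proof.
have [C C0 HC] := sqnorm_mul A; exists (2 * (1 + C)); first by lra.
move=> c z; apply: le_trans (wtD _ _) _; rewrite -mulrA ler_pM2l // mulrCA ler_pM2l ?wt_gt0 //.
by rewrite /wt; have := HC z; have := sqnorm_ge0 z; nra.
Qed.

Lemma wtp_aff N N' (A : 'M[R]_(N', N)) e : 0 <= e ->
  exists2 C : R, 0 <= C & forall c z, wt (c + A *m z) `^ e <= C * (wt c `^ e * wt z `^ e).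
Proof.
move=> e0; have [C C1 HC] := wt_aff A; exists (C `^ e); first exact: powR_ge0.
move=> c z; have C0 : 0 <= C by apply: le_trans C1.
rewrite -!powRM ?mulr_ge0 ?wt_ge0 //.
by apply: ge0_ler_powR; rewrite ?nnegrE ?wt_ge0 ?mulr_ge0 ?wt_ge0.
Qed.

Lemma wt0 N : wt (0 : 'cV[R]_N) = 1.
Proof. by rewrite /wt /sqnorm big1 ?addr0 // => i _; rewrite mxE expr0n. Qed.

Lemma wtp_lin N N' (A : 'M[R]_(N', N)) e : 0 <= e ->
  exists2 C : R, 0 <= C & forall z, wt (A *m z) `^ e <= C * wt z `^ e.
Proof.
move=> e0; have [C C0 HC] := wtp_aff A e0; exists C => // z.
by have := HC 0 z; rewrite add0r wt0 powR1 mul1r.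
Qed.

Lemma wt_col N1 N2 (y : 'cV[R]_N1) (z : 'cV[R]_N2) : wt (col_mx y z) <= wt y * wt z.
Proof.
rewrite /wt {1}/sqnorm big_split_ord /=.
under eq_bigr do rewrite col_mxEu; under [X in _ + (_ + X) <= _]eq_bigr do rewrite col_mxEd.
by rewrite -/(sqnorm y) -/(sqnorm z); have := sqnorm_ge0 y; have := sqnorm_ge0 z; nra.
Qed.

Lemma wtp_col N1 N2 (y : 'cV[R]_N1) (z : 'cV[R]_N2) e : 0 <= e ->
  wt (col_mx y z) `^ e <= wt y `^ e * wt z `^ e.
Proof.
move=> e0; rewrite -powRM ?wt_ge0 //; apply: ge0_ler_powR; rewrite ?nnegrE ?wt_ge0 ?mulr_ge0 ?wt_ge0 //.
exact: wt_col.
Qed.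

End Weight.

Section ProductFunctions.
Context {R : realType} (N : nat).
Local Notation normc := (@ComplexField.Normc.normc R).
Local Notation e_ i := (delta_mx i 0 : 'cV[R]_N).

Lemma cvg_real (T : Type) (A : set_system T) {FF : Filter A} (f : T -> R) (d : R) :
  f x @[x --> A] --> d -> ((f x)%:C : R[i]^o) @[x --> A] --> (d%:C : R[i]^o).
Proof.
move=> H; apply/(cvgQ_lt defsys_normc) => _ e -> e0.
have /cvgrPdist_lt/(_ e e0) := H; apply: filterS => x.
by rewrite -rmorphB normc_real distrC.
Qed.

Lemma pd_real i (g : 'cV[R]_N -> R) x (d : R) :
  h^-1 * (g (x + h *: e_ i) - g x) @[h --> 0^'] --> d ->
  pd i (fun z => (g z)%:C : R[i]^o) x (d%:C : R[i]^o).
Proof.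
move=> H; apply: (cvg_eqn _ (cvg_real H)); apply: filterE => h; rewrite /diff_quotient.
by rewrite rmorphM rmorphB.
Qed.

Lemma cont_real (g : 'cV[R]_N -> R) : continuous g -> continuous (fun z => (g z)%:C : R[i]^o).
Proof. by move=> H x; exact: (cvg_real (H x)). Qed.

Lemma pd_line1 i (f : R -> R) (x : 'cV[R]_N) d : is_derive (x i 0) (1 : R) f d ->
  h^-1 * (f ((x + h *: e_ i) i 0) - f (x i 0)) @[h --> 0^'] --> d.
Proof.
move=> /diff_is_derive; apply: cvg_eqn; apply: filterE => h.
by have -> : (x + h *: e_ i) i 0 = x i 0 + h by rewrite !mxE !eqxx mulr1.
Qed.

Variable G : 'I_N -> nat -> R -> R.
Hypothesis HG : forall l, chain (G l).

(** The index c counts the derivatives taken in each coordinate, so iterated partial derivatives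
    stay in the family and their order is irrelevant. *)
Definition prodc (c : 'I_N -> nat) (z : 'cV[R]_N) : R[i]^o := (\prod_l G l (c l) (z l 0))%:C.

Lemma pd_prodc c i x : pd i (prodc c) x (prodc (fun l => (c l + (i == l))%N) x).
Proof.
have E : \prod_l G l (c l + (i == l))%N (x l 0) = G i (c i).+1 (x i 0) * \prod_(l | l != i) G l (c l) (x l 0).
  rewrite (bigD1 i) //= eqxx addn1; congr (_ * _); apply: eq_bigr => l li.
  by rewrite eq_sym (negbTE li) addn0.
rewrite /prodc E; apply: pd_real.
apply: (@cvg_eqn _ _ _ _ _ (fun h => h^-1 * (G i (c i) ((x + h *: e_ i) i 0) - G i (c i) (x i 0)) * \prod_(l | l != i) G l (c l) (x l 0))).
  apply: filterE => h; rewrite (bigD1 i) //= [X in _ * (_ - X)](bigD1 i) //= -mulrA mulrBl.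
  congr (_ * (_ * _ - _)); apply: eq_bigr => l li; congr (G l (c l) _).
  by rewrite mxE mxE e_E eq_sym (negbTE li) mulr0 addr0.
apply: cvgM; last exact: cvg_cst.
exact: (pd_line1 (HG i (c i) (x i 0))).
Qed.

Lemma cont_prodc c : continuous (prodc c).
Proof.
apply: cont_real => x; apply: (@cvgR_prod R _ _ (nbhs_filter x)) => l.
apply: (cvg_comp _ (G l (c l)) (@coord_continuous R N 1 l 0 x)).
exact: (chain_cont (HG l)).
Qed.

Lemma smooth_prodc c : smooth (prodc c).
Proof.
apply: (lspan_smooth hausC (B := [set g | exists c, g = prodc c])); last by apply: lspan_base; exists c.
  by move=> _ [c' ->]; exact: cont_prodc.
move=> _ i [c' ->]; exists (prodc (fun l => (c' l + (i == l))%N)); first by move=> x; exact: pd_prodc.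
by apply: lspan_base; exists (fun l => (c' l + (i == l))%N).
Qed.

Lemma partials_prodc s : partials s (prodc (fun=> 0%N)) = prodc (fun l => count_mem l s).
Proof.
elim: s => [//|i s IH] /=; rewrite IH; apply/funext => x.
rewrite (pd_partial hausC (@pd_prodc _ i x)); rewrite /prodc; congr (_%:C).
by apply: eq_bigr => l _; rewrite addnC.
Qed.

End ProductFunctions.

Section Cutoff.
Context {R : realType} (N : nat).
Local Notation normc := (@ComplexField.Normc.normc R).

(** The radius depends on the coordinate because the integrals over R^(4n) carry two cutoffs with
    independent radii. *)
Definition cutoff (lam : 'I_N -> R) (z : 'cV[R]_N) : R[i]^o := (\prod_l eta (z l 0 / lam l))%:C.

Definition one_ (z : 'cV[R]_N) : R[i]^o := 1.

Lemma cutoff_supp lam z : (forall l, 0 < lam l) -> cutoff lam z != 0 -> forall l, `|z l 0| <= 2 * lam l.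
Proof.
move=> lam0 H l; have : eta (z l 0 / lam l) != 0.
  by apply: contraNneq H => H; rewrite /cutoff (bigD1 l) //= H mul0r.
move/eta0; rewrite normrM [X in _ * X]gtr0_norm ?invr_gt0 //.
by rewrite ler_pdivrMr.
Qed.

Lemma etachain_ex : exists g : nat -> R -> R, chain g /\ g 0%N = eta.
Proof. by have [g H1 H2] := @S1_eta R; exists g. Qed.

Lemma scale_chain (g : nat -> R -> R) (a : R) : chain g -> chain (fun k x => a^-1 ^+ k * g k (x / a)).
Proof.
move=> Hg k x.
have H1 : is_derive x (1 : R) (fun x => x / a) a^-1.
  apply: is_derive_diff; apply: (cvg_eqn _ (cvg_cst _)); apply/near0'P; exists 1 => // h h0 _.
  by rewrite mulrDl addrAC subrr add0r mulrA mulVf // mul1r.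
have H2 := @is_derive1_comp R (g k) (fun x => x / a) x _ _ (Hg k (x / a)) H1.
have := @is_deriveZ _ _ _ _ (a^-1 ^+ k) _ _ _ H2.
by rewrite [X in is_derive _ _ _ X](_ : _ = a^-1 ^+ k.+1 * g k.+1 (x / a)) // exprSr -[LHS]/(_ * (_ * _)); ring.
Qed.

Lemma cutoff_prodc (g : nat -> R -> R) lam : g 0%N = eta ->
  cutoff lam = prodc (fun l k x => (lam l)^-1 ^+ k * g k (x / lam l)) (fun=> 0%N).
Proof.
move=> g0; apply/funext => z; rewrite /cutoff /prodc; congr (_%:C); apply: eq_bigr => l _.
by rewrite expr0 mul1r g0.
Qed.

Lemma cutoff_smooth lam : smooth (cutoff lam).
Proof.
have [g [Hg g0]] := etachain_ex; rewrite (cutoff_prodc lam g0).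
by apply: smooth_prodc => l; exact: scale_chain.
Qed.

Lemma cutoff_eq1 lam (z : 'cV[R]_N) : (forall l, 0 < lam l) -> (forall l, `|z l 0| <= lam l) -> cutoff lam z = 1.
Proof.
move=> l0 H; rewrite /cutoff big1 // => l _; apply: eta1.
by rewrite normrM [X in _ * X]gtr0_norm ?invr_gt0 // ler_pdivrMr // mul1r.
Qed.

(** Half a power of the weight is traded for the rate 1/rho: 1 - [cutoff] vanishes where all the
    coordinates are at most rho, and elsewhere w^(1/2) exceeds rho. The constant is independent of
    the radii. *)
Lemma cutoff_bound s : exists2 C : R, 0 <= C & forall lam (rho : R), 1 <= rho -> (forall l, rho <= lam l) ->
  forall z, normc (partials s (fun z => one_ z - cutoff lam z) z) <= C * wt z `^ 2^-1 / rho.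
Proof.
have [g [Hg g0]] := etachain_ex.
have Hb k : exists B : R, 0 <= B /\ forall x, `|g k x| <= B.
  by have [|B B0 HB] := chain_bounded (L := 2) Hg _ k; [rewrite g0; exact: eta0|exists B].
have [B HB] := choice Hb.
pose C := \prod_(l < N) B (count_mem l s).
have C0 : 0 <= C by apply: prodr_ge0 => l _; case: (HB (count_mem l s)).
(* Each derivative brings a factor 1/lam_l, and a single such factor already gives the rate; the
   others are bounded by 1. *)
have HX lam rho z : 1 <= rho -> (forall l, rho <= lam l) ->
    normc (partials s (cutoff lam) z) <= C / (if s is [::] then 1 else rho).
  move=> r1 Hlam; rewrite (cutoff_prodc lam g0) partials_prodc; last by move=> l; exact: scale_chain.
  rewrite /prodc normc_real normr_prod.
  have -> : C / (if s is [::] then 1 else rho) = (\prod_(l < N) B (count_mem l s)) * (if s is [::] then 1 else rho^-1).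
    by case: s @C C0 => *; rewrite ?invr1.
  under eq_bigr do rewrite normrM mulrC; rewrite big_split /=.
  apply: ler_pM; try by apply: prodr_ge0.
    by apply: ler_prod => l _; rewrite normr_ge0; case: (HB (count_mem l s)) => _ ->.
  have r0 : 0 < rho by apply: lt_le_trans r1.
  have Hl l : `|(lam l)^-1| <= 1.
    have := Hlam l => Hl; rewrite ger0_norm ?invr_ge0 ?invf_le1 //.
    - exact: le_trans Hl.
    - exact: lt_le_trans Hl.
    - by apply: le_trans Hl; exact: ltW.
  case: s @C C0 => [|i s'] C C0.
    by rewrite big1 // => l _; rewrite expr0 normr1.
  rewrite (bigD1 i) //= eqxx add1n exprS normrM -mulrA -[leRHS]mulr1.
  apply: ler_pM => //; first by rewrite mulr_ge0 // prodr_ge0.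
    rewrite ger0_norm ?invr_ge0; last by apply: le_trans (Hlam i); exact: ltW.
    by rewrite lef_pV2 ?posrE //; exact: lt_le_trans (Hlam i).
  rewrite -[leRHS]mulr1; apply: ler_pM => //; first by apply: prodr_ge0.
    by rewrite normrX exprn_ile1.
  rewrite -[leRHS](big1_eq (op := *%R) (idx := 1 : R) (index_enum 'I_N) (fun l => l != i)).
  by apply: ler_prod => l _; rewrite normr_ge0 normrX exprn_ile1.
exists (C + 1); first by rewrite addr_ge0.
move=> lam rho r1 Hlam z; have r0 : 0 < rho by apply: lt_le_trans r1.
rewrite (partials_B hausC) ?(smooth_cst hausC) ?cutoff_smooth //; last 2 first.
- exact: (smooth_cst hausC (1 : R[i]^o)).
- exact: cutoff_smooth.
have W1 := wtp_ge1 z (ltac:(lra) : 0 <= (2^-1 : R)).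
case: s @C C0 HX => [|i s] C C0 HX.
  have -> : partials [::] one_ z - partials [::] (cutoff lam) z = one_ z - cutoff lam z by [].
  have [Hz|/existsNP [l /negP]] := pselect (forall l, `|z l 0| <= rho).
    rewrite (_ : cutoff lam z = one_ z) ?subrr; last first.
      apply: cutoff_eq1.
    - by move=> l; exact: lt_le_trans (Hlam l).
    - by move=> l; exact: le_trans (Hlam l).
    by rewrite ComplexField.Normc.normc0 ?mulr_ge0 ?invr_ge0 ?addr_ge0 ?wtp_ge0 // ltW.
  rewrite -ltNge => Hz; rewrite ler_pdivlMr //.
  apply: (@le_trans _ _ ((C + 1) * rho)).
    rewrite ler_pM2r //; have := snB sn_normc (1 : R[i]^o) (cutoff lam z).
    by have := HX lam rho z r1 Hlam; rewrite invr1 mulr1 ComplexField.Normc.normc1 => H1 H2; apply: le_trans H2 _; rewrite addrC lerD2r; exact: H1.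
  by rewrite ler_wpM2l ?addr_ge0 //; apply: le_trans (ltW Hz) (coord_wt _ _).
have -> : partials (i :: s) one_ z = 0.
  rewrite (_ : one_ = fun=> 1) //.
  have -> : partials (i :: s) ((fun=> 1) : 'cV[R]_N -> R[i]^o) = fun=> 0; last by [].
  elim: s {C C0 HX} i => [|j s IH] i; first by apply: (pd_fun hausC) => x; exact: pd_cst.
  rewrite -[partials (i :: _) _]/(partial i (partials (j :: s) _)) IH.
  by apply: (pd_fun hausC) => x; exact: pd_cst.
rewrite sub0r (snN sn_normc); apply: le_trans (HX lam rho z r1 Hlam) _.
rewrite ler_pM2r ?invr_gt0 //; apply: (@le_trans _ _ (C + 1)); first by rewrite lerDl.
by rewrite -[leLHS]mulr1 ler_wpM2l ?addr_ge0.
Qed.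

End Cutoff.

(** * Oscillatory integrals *)

Section Phase.
Context {R : realType} (N : nat).
Local Notation normc := (@ComplexField.Normc.normc R).
Local Notation e_ i := (delta_mx i 0 : 'cV[R]_N).

Definition bform (P : 'M[R]_N) (y z : 'cV[R]_N) : R := \sum_i y i 0 * (P *m z) i 0.
Definition dotp (y z : 'cV[R]_N) : R := \sum_i y i 0 * z i 0.
Definition qphase (P : 'M[R]_N) (b z : 'cV[R]_N) : R := bform P z z + dotp b z.

Lemma dotpE y z : dotp y z = (y^T *m z) 0 0.
Proof. by rewrite mxE; apply: eq_bigr => i _; rewrite mxE. Qed.

Lemma bformE P y z : bform P y z = (y^T *m P *m z) 0 0.
Proof. by rewrite -mulmxA -dotpE. Qed.

Lemma bformDl P x y z : bform P (x + y) z = bform P x z + bform P y z.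
Proof. by rewrite /bform -big_split; apply: eq_bigr => i _; rewrite mxE mulrDl. Qed.

Lemma bformDr P x y z : bform P x (y + z) = bform P x y + bform P x z.
Proof. by rewrite /bform -big_split; apply: eq_bigr => i _; rewrite mulmxDr mxE mulrDr. Qed.

Lemma dotpDl x y z : dotp (x + y) z = dotp x z + dotp y z.
Proof. by rewrite /dotp -big_split; apply: eq_bigr => i _; rewrite mxE mulrDl. Qed.

Lemma dotpDr x y z : dotp x (y + z) = dotp x y + dotp x z.
Proof. by rewrite /dotp -big_split; apply: eq_bigr => i _; rewrite mxE mulrDr. Qed.

Lemma bform_dotpl P y z : bform P y z = dotp (P^T *m y) z.
Proof. by rewrite bformE dotpE trmx_mul trmxK. Qed.

Lemma bform_dotpr P y z : bform P z y = dotp (P *m y) z.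
Proof. by apply: eq_bigr => i _; rewrite mulrC. Qed.

Lemma qphaseD P b y z : qphase P b (y + z) = qphase P b y + qphase P b z + dotp ((P + P^T) *m y) z.
Proof.
rewrite /qphase bformDl !bformDr dotpDr mulmxDl dotpDl -bform_dotpl -bform_dotpr.
by ring.
Qed.

(** The i-th component of the gradient of the phase. *)
Definition lin (P : 'M[R]_N) (b x : 'cV[R]_N) (i : 'I_N) : R := ((P + P^T) *m x) i 0 + b i 0.

Lemma dotp_e x i h : dotp x (h *: e_ i) = h * x i 0.
Proof.
rewrite /dotp (bigD1 i) //= big1 => [|j ji]; rewrite mxE e_E ?eqxx ?mulr1 ?addr0 1?mulrC //.
by rewrite eq_sym (negbTE ji) mulr0 mul0r.
Qed.

Lemma qphase_line (P : 'M[R]_N) (b x : 'cV[R]_N) i h : qphase P b (x + h *: e_ i) = qphase P b x + h * lin P b x i + h ^+ 2 * bform P (e_ i) (e_ i).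
Proof.
rewrite qphaseD dotp_e {2}/qphase dotp_e /lin.
have -> : bform P (h *: e_ i) (h *: e_ i) = h ^+ 2 * bform P (e_ i) (e_ i).
  by rewrite /bform mulr_sumr; apply: eq_bigr => j _; rewrite -scalemxAr mxE [(h *: (P *m _)) j 0]mxE; ring.
by ring.
Qed.

Definition ic : R[i] := 0 +i* 1.

Lemma expiE t : expi t = (cos t)%:C + ic * (sin t)%:C.
Proof. by apply/eqP; rewrite eq_complex /=; apply/andP; split; apply/eqP; ring. Qed.

Lemma normc_ic : normc ic = 1.
Proof. by rewrite /ic /ComplexField.Normc.normc expr0n add0r expr1n sqrtr1. Qed.

Lemma normc_expi t : normc (expi t) = 1.
Proof. by rewrite /expi /ComplexField.Normc.normc cos2Dsin2 sqrtr1. Qed.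

Lemma expiD s t : expi (s + t) = expi s * expi t :> R[i].
Proof. by rewrite /expi cosD sinD; apply/eqP; rewrite eq_complex /=; apply/andP; split; apply/eqP; ring. Qed.

Definition eiq P b : 'cV[R]_N -> R[i]^o := fun z => expi (qphase P b z).

Lemma normcM (a b : R[i]) : normc (a * b) = normc a * normc b.
Proof. exact: ComplexField.Normc.normcM. Qed.

(** By [qphase_line] the phase is a quadratic polynomial along a coordinate line, so the
    one-variable chain rule for cos and sin suffices. *)
Lemma pd_eiq (P : 'M[R]_N) (b : 'cV[R]_N) i x : pd i (eiq P b) x (ic * (lin P b x i)%:C * eiq P b x : R[i]^o).
Proof.
pose c := qphase P b x; pose l := lin P b x i; pose p := bform P (e_ i) (e_ i).
have H0 : is_derive (0 : R) (1 : R) (fun t : R => c + t * l + t ^+ 2 * p) l.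
  apply: is_derive_diff.
  apply: (@cvg_eqn _ _ _ _ _ (fun h => l + h * p)).
    by apply/near0'P; exists 1 => // h h0 _; field.
  rewrite -[X in _ --> X]addr0 -[X in _ + X](mul0r p).
  by apply: cvgD; [exact: cvg_cst|apply: cvgM; [exact: nbhs_dnbhs|exact: cvg_cst]].
have E0 : c + 0 * l + 0 ^+ 2 * p = c by ring.
have step1 (f : R -> R) d : is_derive c (1 : R) f d ->
    pd i (fun z => (f (qphase P b z))%:C : R[i]^o) x ((d * l)%:C : R[i]^o).
  move=> Hf; apply: pd_real.
  have Hf' : is_derive (c + 0 * l + 0 ^+ 2 * p) (1 : R) f d by rewrite E0.
  have := diff_is_derive (@is_derive1_comp R f (fun t : R => c + t * l + t ^+ 2 * p) 0 d l Hf' H0).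
  apply: cvg_eqn; apply: filterE => h; rewrite qphase_line /= E0 -/c -/l -/p.
  by rewrite add0r.
have Hc := step1 cos _ (is_derive_cos c).
have Hs := pd_Z (a := ic) (step1 sin _ (is_derive_sin c)).
have := pd_D Hc Hs; rewrite (_ : (fun y => _) = eiq P b); last first.
  by apply/funext => y; rewrite /eiq expiE.
have -> // : ((- sin c * l)%:C : R[i]^o) + ic *: ((cos c * l)%:C : R[i]^o) = ic * l%:C * eiq P b x.
rewrite /eiq -/c /expi; apply/eqP; rewrite eq_complex /=; apply/andP; split; apply/eqP; ring.
Qed.

Definition linf (a : 'cV[R]_N) (c : R) (z : 'cV[R]_N) : R[i]^o := (dotp a z + c)%:C.

Lemma smooth_linf a c : smooth (linf a c).
Proof.
apply: (lspan_smooth hausC (B := [set g | exists a c, g = linf a c])); last by apply: lspan_base; exists a, c.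
  move=> _ [a' [c' ->]]; apply: cont_real => x; apply: (@cvgD _ _ _ _ (nbhs_filter x)); last exact: cst_continuous.
  apply: (@cvgR_sum _ _ _ (nbhs_filter x)) => j.
  apply: (@cvgM _ _ _ (nbhs_filter x)); first exact: cst_continuous.
  exact: (@coord_continuous R N 1 j 0 x).
move=> _ i [a' [c' ->]]; exists (linf 0 (a' i 0)); last by apply: lspan_base; exists 0, (a' i 0).
move=> x; apply: pd_real.
have -> : dotp 0 x + a' i 0 = a' i 0 by rewrite /dotp big1 ?add0r // => j _; rewrite mxE mul0r.
apply: (cvg_eqn _ (cvg_cst _)); apply/near0'P; exists 1 => // h h0 _.
by rewrite dotpDr dotp_e; field.
Qed.

Lemma smooth_mulC (g h : 'cV[R]_N -> R[i]^o) : smooth g -> smooth h -> smooth (fun z => g z * h z : R[i]^o).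
Proof. by move=> Hg Hh; exact: (smooth_mul hausC Hg Hh). Qed.

Lemma cont_eiq P b : continuous (eiq P b).
Proof.
have cq : continuous (qphase P b).
  move=> x; apply: (@cvgD _ _ _ _ (nbhs_filter x)); apply: (@cvgR_sum _ _ _ (nbhs_filter x)) => j.
    apply: (@cvgM _ _ _ (nbhs_filter x)); first exact: (@coord_continuous R N 1 j 0 x).
    have -> : (fun x : 'cV[R]_N => (P *m x) j 0) = (fun x => (0 + P *m x) j 0).
      by apply/funext => y; rewrite add0r.
    have -> : (P *m x) j 0 = (0 + P *m x) j 0 by rewrite add0r.
    exact: (@cvg_coord R N _ _ (nbhs_filter x) _ _ j (@cont_aff R N N P 0 x)).
  apply: (@cvgM _ _ _ (nbhs_filter x)); first exact: cst_continuous.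
  exact: (@coord_continuous R N 1 j 0 x).
have -> : eiq P b = fun z => ((cos (qphase P b z))%:C : R[i]^o) + ic *: ((sin (qphase P b z))%:C : R[i]^o).
  by apply/funext => z; rewrite /eiq expiE.
apply: contV_D; last apply: contV_Z; apply: cont_real => x.
  by apply: (cvg_comp _ cos (cq x)); exact: continuous_cos.
by apply: (cvg_comp _ sin (cq x)); exact: continuous_sin.
Qed.

(** Derivatives of the phase factor acquire polynomial coefficients. Working with all products h
    [eiq], for h smooth, avoids tracking them. *)
Lemma smooth_eiq P b : smooth (eiq P b).
Proof.
apply: (lspan_smooth hausC (B := [set g | exists2 h : 'cV[R]_N -> R[i]^o, smooth h & g = fun z => (h z : R[i]) *: eiq P b z])).
- by move=> _ [h sh ->]; apply: cont_mul; [exact: smooth_cont|exact: cont_eiq].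
- move=> _ i [h sh ->].
  exists (fun z => ((partial i h z + h z * (ic * linf (col i (P + P^T)^T) (b i 0) z) : R[i]^o) : R[i]) *: eiq P b z).
    move=> x; have := pd_mul (@cont_eiq P b) (smooth_pd hausC (i := i) (x := x) sh) (@pd_eiq P b i x).
    rewrite [X in pd _ _ _ X](_ : _ = ((partial i h x + h x * (ic * linf (col i (P + P^T)^T) (b i 0) x) : R[i]^o) : R[i]) *: eiq P b x) //.
    rewrite scalerDl; congr (_ + _); rewrite -[LHS]/(h x * _) -[RHS]/(_ * _) -!mulrA; congr (_ * (_ * (_ * _))).
    by rewrite /linf /lin; congr (_%:C); congr (_ + _); rewrite mxE; apply: eq_bigr => j _; rewrite !mxE.
  apply: lspan_base; refine (ex_intro2 _ _ (fun z => (partial i h z + h z * (ic * linf (col i (P + P^T)^T) (b i 0) z) : R[i]^o)) _ erefl).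
  apply: (smooth_D hausC); first exact: smooth_partial.
  apply: smooth_mulC; first exact: sh.
  exact: (smooth_Z hausC ic (smooth_linf _ _)).
apply: lspan_base; exists (fun=> 1); first exact: (smooth_cst hausC (1 : R[i]^o)).
by apply/funext => z; rewrite scale1r.
Qed.

End Phase.

Section SupportOfDerivative.
Context {R : realType} (N : nat) (V : tvsType R[i]).
Hypothesis hV : hausdorff_space V.

Lemma partial_zero i (F : 'cV[R]_N -> V) z (d : R) : 0 < d ->
  (forall h, `|h| < d -> F (z + h *: delta_mx i 0) = 0) -> partial i F z = 0.
Proof.
move=> d0 Hd; apply: (pd_partial hV); apply: (cvg_eqn _ (cvg_cst _)); apply/near0'P; exists d => // h h0 hd.
rewrite /diff_quotient Hd //; have := Hd 0; rewrite normr0 scale0r addr0 => -> //.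
by rewrite subrr scaler0.
Qed.

Lemma partial_supp i (F : 'cV[R]_N -> V) a l : suppbox a l F -> suppbox a l (partial i F).
Proof.
move=> sF z; apply: contraNP => /existsNP [j /negP]; rewrite negb_and -!ltNge => Hj.
apply/eqP; pose d := if z j 0 < a j then a j - z j 0 else z j 0 - (a j + l).
have d0 : 0 < d by rewrite /d; case: ifP Hj => [H _|_ /= H]; rewrite subr_gt0.
apply: (partial_zero d0) => h hd; apply/eqP; apply: contraT => /sF /(_ j).
rewrite mxE; have := le_lt_trans (norm_e i h j) hd; rewrite ltr_norml /d => /andP[H1 H2] /andP[H3 H4].
move: H1 H2 H3 H4; move: ((h *: delta_mx i 0 : 'cV_N) j 0) => X.
by case: ifP Hj => [H _|_ /= H]; lra.
Qed.

End SupportOfDerivative.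

(** * The oscillatory estimate by localisation and integration by parts *)

Section Estimate.
Context {R : realType} (V : tvsType R[i]) (Q : set (V -> R)).
Hypothesis Qdef : defining_system Q.
Hypothesis hV : hausdorff_space V.
Hypothesis complV : sequentially_complete V.
Variable N : nat.
Local Notation normc := (@ComplexField.Normc.normc R).
Local Notation e_ i := (delta_mx i 0 : 'cV[R]_N).

Lemma partials_shift (W : tvsType R[i]) s (F : 'cV[R]_N -> W) (k : 'cV[R]_N) :
  partials s (fun z => F (z - k)) = (fun z => partials s F (z - k)).
Proof.
elim: s => [//|i s IH] /=; rewrite IH; apply/funext => z; rewrite /partial.
have -> // : diff_quotient i (fun z0 => partials s F (z0 - k)) z = diff_quotient i (partials s F) (z - k).
by apply/funext => h; rewrite /diff_quotient addrAC.
Qed.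

Lemma smooth_shift (W : tvsType R[i]) (F : 'cV[R]_N -> W) (k : 'cV[R]_N) : smooth F -> smooth (fun z => F (z - k)).
Proof.
move=> sF s; have [cF dF] := sF s; rewrite partials_shift; split.
  move=> z; apply: (cvg_comp _ (partials s F) _ (cF (z - k))).
  have -> : (fun z => z - k) = (fun z => - k + 1%:M *m z) by apply/funext => y; rewrite mul1mx addrC.
  have -> : z - k = - k + 1%:M *m z by rewrite mul1mx addrC.
  exact: cont_aff.
move=> i x; have [v Hv] := dF i (x - k); exists v; apply: cvg_eqn Hv.
by apply: filterE => h; rewrite /diff_quotient addrAC.
Qed.

Lemma cont_shift (W : tvsType R[i]) (F : 'cV[R]_N -> W) (k : 'cV[R]_N) : smooth F -> continuous (fun z : 'cV[R]_N => F (z - k)).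
Proof. by move=> sF; apply: smooth_cont; exact: smooth_shift. Qed.

Lemma suppbox_shift (W : tvsType R[i]) l (F : 'cV[R]_N -> W) (k : 'cV[R]_N) :
  suppbox (fun=> 0) l F -> suppbox (fun i => k i 0) l (fun z => F (z - k)).
Proof. by move=> sF z /sF H i; have := H i; rewrite !mxE; lra. Qed.

Lemma suppbox_cc (F : 'cV[R]_N -> V) a l : continuous F -> suppbox a l F -> cc F.
Proof.
move=> cF sF; split=> //; exists (\sum_i `|a i| + `|l|) => z /sF H i.
have := H i; have : `|a i| <= \sum_i `|a i| by rewrite (bigD1 i) //= lerDl sumr_ge0.
have := normr_ge0 l; have := ler_norm l; have := ler_norm (a i); have := ler_norm (- a i).
rewrite normrN; move: (\sum_i _) => S h1 h2 h3 h4 h5 h6; rewrite ler_norml; lra.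
Qed.

(** The constant depends on Psi only, not on the frequency b or the centre k; (2 + 1)^N comes from
    [rint_bound] for a support of side 2. *)
Lemma ibp0 (Psi : 'cV[R]_N -> R[i]^o) : smooth Psi -> suppbox (fun=> 0) 2 Psi ->
  exists2 C : R, 0 <= C & forall q (b k : 'cV[R]_N) (G : 'cV[R]_N -> V) (B : R), Q q -> smooth G -> 0 <= B ->
    (forall z : 'cV[R]_N, (forall l, k l 0 <= z l 0 <= k l 0 + 2) -> q (G z) <= B) ->
    q (riemann_integral (fun z => (eiq 0 b z : R[i]) *: ((Psi (z - k) : R[i]) *: G z))) <= C * B.
Proof.
move=> sPsi suppPsi.
have suppP2 : supp_le 2 Psi by move=> z /suppPsi H l; have := H l; rewrite ler_norml; lra.
have [C C0 HC] := cont_bounded defsys_normc (q := normc) erefl (smooth_cont sPsi) suppP2.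
exists ((2 + 1) ^+ N * C); first by rewrite mulr_ge0 // exprn_ge0 // addr_ge0.
move=> q b k G B Hq sG B0 HB; rewrite -mulrA.
have Hs := Qsn Qdef Hq.
have sb : suppbox (fun i => k i 0) 2 (fun z => (eiq 0 b z : R[i]) *: ((Psi (z - k) : R[i]) *: G z)).
  move=> z; rewrite scalerA; have [/eqP ->|H _] := boolP (Psi (z - k) == 0); first by rewrite mulr0 scale0r eqxx.
  exact: (suppbox_shift suppPsi H).
apply: (rint_bound Qdef hV complV Hq _ _ sb) => //.
  apply: (suppbox_cc _ sb); apply: cont_mul; first exact: cont_eiq.
  by apply: cont_mul; [exact: cont_shift|exact: smooth_cont].
move=> z; rewrite !(snZ Hs) normc_expi mul1r.
have [/eqP ->|H] := boolP (Psi (z - k) == 0); first by rewrite ComplexField.Normc.normc0 mul0r mulr_ge0.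
apply: ler_pM => //; [exact: normc_ge0|exact: (sn_ge0 Hs)|].
by apply: HB => l; exact: (suppbox_shift suppPsi H).
Qed.

(* The integral of a partial derivative vanishes, so that each factor b_i is traded
   for one derivative of Psi or of G. *)
Lemma ibp K : forall i (Psi : 'cV[R]_N -> R[i]^o), smooth Psi -> suppbox (fun=> 0) 2 Psi ->
  exists2 C : R, 0 <= C & forall q (b k : 'cV[R]_N) (G : 'cV[R]_N -> V) (B : R), Q q -> smooth G -> 0 <= B ->
    (forall j (z : 'cV[R]_N), (j <= K)%N -> (forall l, k l 0 <= z l 0 <= k l 0 + 2) -> q (iter j (partial i) G z) <= B) ->
    `|b i 0| ^+ K * q (riemann_integral (fun z => (eiq 0 b z : R[i]) *: ((Psi (z - k) : R[i]) *: G z))) <= C * B.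
Proof.
elim: K => [|K IH] i Psi sPsi suppPsi.
  have [C C0 HC] := ibp0 sPsi suppPsi; exists C => // q b k G B Hq sG B0 HB.
  by rewrite expr0 mul1r; apply: HC => // z; exact: (HB 0%N).
(* Differentiating Psi does not enlarge its support box, so the induction hypothesis applies to its
   derivative, with another constant. *)
have [C1 C10 H1] := IH i (partial i Psi) (smooth_partial i sPsi) (partial_supp hausC suppPsi).
have [C2 C20 H2] := IH i Psi sPsi suppPsi.
exists (C1 + C2); first exact: addr_ge0.
move=> q b k G B Hq sG B0 HB; have Hs := Qsn Qdef Hq.
pose I_ (P : 'cV[R]_N -> R[i]^o) (H : 'cV[R]_N -> V) z := (eiq 0 b z : R[i]) *: ((P (z - k) : R[i]) *: H z).
have ccI P H : smooth P -> suppbox (fun=> 0) 2 P -> smooth H -> cc (I_ P H).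
  move=> sP suP sH; apply: (@suppbox_cc _ (fun i => k i 0) 2).
    apply: cont_mul; first exact: cont_eiq.
    by apply: cont_mul; [exact: cont_shift|exact: smooth_cont].
  move=> z; rewrite /I_ scalerA; have [/eqP ->|Hz _] := boolP (P (z - k) == 0); first by rewrite mulr0 scale0r eqxx.
  exact: (suppbox_shift suP Hz).
have c0 := ccI _ _ sPsi suppPsi sG.
have c1 := ccI _ _ (smooth_partial i sPsi) (partial_supp hausC suppPsi) sG.
have c2 := ccI _ _ sPsi suppPsi (smooth_partial i sG).
pose w : R[i] := ic * (b i 0)%:C.
have E : w *: riemann_integral (I_ Psi G) = - (riemann_integral (I_ (partial i Psi) G) + riemann_integral (I_ Psi (partial i G))).
  apply/eqP; rewrite -addr_eq0 -(rintZ Qdef hV complV w c0) -(rintD Qdef hV complV c1 c2).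
  rewrite -(rintD Qdef hV complV (ccZ w c0) (ccD c1 c2)); apply/eqP.
  apply: (rint_pd Qdef hV complV c0 (ccD (ccZ w c0) (ccD c1 c2)) (i := i)) => x.
  have HP : pd i (fun z => Psi (z - k)) x (partial i Psi (x - k)).
    have := smooth_pd hausC (i := i) (x := x) (@smooth_shift _ _ k sPsi).
    by have := @partials_shift _ [:: i] Psi k => /= ->.
  have cPG : continuous (fun z : 'cV[R]_N => (Psi (z - k) : R[i]) *: G z).
    by apply: cont_mul; [exact: cont_shift|exact: smooth_cont].
  have := pd_mul cPG (@pd_eiq R N 0 b i x) (pd_mul (smooth_cont sG) HP (smooth_pd hV (i := i) (x := x) sG)).
  have -> : lin 0 b x i = b i 0 by rewrite /lin trmx0 addr0 mul0mx mxE add0r.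
  have -> : I_ (partial i Psi) G x + I_ Psi (partial i G) x =
      (eiq 0 b x : R[i]) *: ((partial i Psi (x - k) : R[i]) *: G x + (Psi (x - k) : R[i]) *: partial i G x).
    by rewrite /I_ scalerDr.
  by have -> : w *: I_ Psi G x = (ic * (b i 0)%:C * eiq 0 b x : R[i]) *: ((Psi (x - k) : R[i]) *: G x) by rewrite /I_ scalerA.
have Ew : `|b i 0| = normc w by rewrite normcM normc_ic mul1r normc_real.
rewrite exprSr -mulrA Ew -(snZ Hs) E (snN Hs) -Ew mulrDl.
apply: le_trans (ler_wpM2l (exprn_ge0 _ (normr_ge0 _)) (snD Hs _ _)) _.
rewrite mulrDr; apply: lerD.
  by apply: (H1 q b k G B) => // j z jK; apply: HB; exact: leqW.
by apply: (H2 q b k _ B) => // [|j z jK Hz]; [exact: smooth_partial|rewrite -iterSr; apply: HB].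
Qed.

Lemma exprD_le (x y : R) n : 0 <= x -> 0 <= y -> (x + y) ^+ n <= 2 ^+ n * (x ^+ n + y ^+ n).
Proof.
move=> x0 y0; have H (a b : R) : 0 <= a -> a <= b -> (a + b) ^+ n <= 2 ^+ n * (a ^+ n + b ^+ n).
  move=> a0 ab; have b0 := le_trans a0 ab.
  apply: (@le_trans _ _ ((2 * b) ^+ n)).
    by apply: lerXn2r; rewrite ?nnegrE ?addr_ge0 ?mulr_ge0 //; lra.
  by rewrite exprMn ler_pM2l ?exprn_gt0 // lerDr exprn_ge0.
case/orP: (le_total x y) => [xy|yx]; first exact: H.
by rewrite addrC [x ^+ n + _]addrC; exact: H.
Qed.

Lemma expr_sum_le n (r : seq 'I_N) (a : 'I_N -> R) : (forall i, 0 <= a i) ->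
  (1 + \sum_(i <- r) a i) ^+ n <= (2 ^+ n) ^+ size r * (1 + \sum_(i <- r) a i ^+ n).
Proof.
move=> a0; elim: r => [|i r IH]; first by rewrite !big_nil addr0 expr1n expr0 mulr1.
rewrite !big_cons !(addrCA 1) /=.
have S0 : 0 <= 1 + \sum_(j <- r) a j by rewrite addr_ge0 // sumr_ge0.
have T1 : 1 <= (2 ^+ n) ^+ size r :> R by rewrite exprn_ege1 // exprn_ege1 // ler1n.
apply: le_trans (exprD_le n (a0 i) S0) _.
rewrite exprS -mulrA ler_pM2l ?exprn_gt0 // mulrDr; apply: lerD => //.
by rewrite ler_peMl // exprn_ge0.
Qed.

Lemma sum_inv_sqr (a : int) m : \sum_(k < m) (1 + ((a + k%:Z)%:~R : R) ^+ 2)^-1 <= 8.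
Proof.
(* The sum is bounded by the telescoping sum of 4 (t k - t (k - 1)). *)
pose t (k : int) : R := k%:~R / (1 + `|k%:~R|).
have t1 k : `|t k| <= 1.
  rewrite /t normrM normfV [`|1 + _|]ger0_norm ?addr_ge0 // ler_pdivrMr ?ltr_pwDl //.
  by rewrite mul1r lerDr.
have E (x d e : R) : 0 <= x -> 1 + x ^+ 2 <= d -> e = ((1 + x) * (2 + x))^-1 -> d^-1 <= 4 * e.
  move=> x0 Hd ->; have d0 : 0 < d by apply: lt_le_trans Hd; rewrite ltr_pwDl // sqr_ge0.
  rewrite -(invrK 4) -invfM lef_pV2 ?posrE ?mulr_gt0 ?invr_gt0 //; try lra.
  by rewrite ler_pdivrMl //; nra.
have ts (k : int) : (1 + (k%:~R : R) ^+ 2)^-1 <= 4 * (t k - t (k - 1)).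
  rewrite /t rmorphB /=; have [k0|k0] := ltP 0 k.
    have x0 : 0 <= k%:~R - 1 :> R by rewrite -(rmorphB intr k 1) /= ler0z; move: k0; clear; lia.
    apply: (E _ _ _ x0); first by nra.
    rewrite (_ : 1%:~R = 1 :> R) // !ger0_norm //; last by move: x0; move: (k%:~R : R) => x; lra.
    by field; move: x0; move: (k%:~R : R) => x x0; rewrite !lt0r_neq0 //; lra.
  have x0 : 0 <= - k%:~R :> R by rewrite oppr_ge0 lerz0.
  apply: (E _ _ _ x0); first by nra.
  rewrite (_ : 1%:~R = 1 :> R) // !ler0_norm //; try by move: x0; move: (k%:~R : R) => x; lra.
  by field; move: x0; move: (k%:~R : R) => x x0; rewrite !lt0r_neq0 //; lra.
apply: (@le_trans _ _ (4 * (t (a + m%:Z - 1) - t (a - 1)))).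
  elim: m => [|m IH]; first by rewrite big_ord0 addr0 subrr mulr0.
  rewrite big_ord_recr /=; have := ts (a + m%:Z).
  have -> : a + m.+1%:Z - 1 = a + m%:Z by rewrite -addn1 PoszD addrA addrK.
  by lra.
by have := t1 (a + m%:Z - 1); have := t1 (a - 1); rewrite !ler_norml; lra.
Qed.

Definition phi (y : 'cV[R]_N) : R[i]^o := (\prod_l bump (y l 0))%:C.

Lemma smooth_phi : smooth phi.
Proof.
have [g Hg g0] := @S1_bump R.
have -> : phi = prodc (fun=> g) (fun=> 0%N).
  by apply/funext => z; rewrite /phi /prodc g0.
exact: smooth_prodc.
Qed.

Lemma supp_phi : suppbox (fun=> 0) 2 phi.
Proof.
move=> z H l; rewrite add0r; apply: bump_supp; apply: contraNneq H => H.
by rewrite /phi (bigD1 l) //= H mul0r.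
Qed.

Definition ctr b (c : {ffun 'I_N -> 'I_(b + b).+1}) : 'cV[R]_N := map_mx intr (boxpt (const_mx (- b%:Z)) c).

(** The sum factors into one-variable sums, each equal to 1 by [bump_sum]. The margin 1 is needed at
    the left end, where the first bump, starting at -b, is still rising. *)
Lemma phi_sum b (z : 'cV[R]_N) : (forall l, `|z l 0| <= b%:R - 1) -> \sum_c phi (z - ctr (b := b) c) = 1.
Proof.
move=> Hz.
have -> : \sum_c phi (z - ctr (b := b) c) = ((\sum_(c : {ffun 'I_N -> 'I_(b + b).+1}) \prod_l bump (z l 0 - (- b%:Z + (c l : nat)%:Z)%:~R)) %:C : R[i]).
  by rewrite rmorph_sum; apply: eq_bigr => c _; rewrite /phi; congr (_%:C); apply: eq_bigr => l _; rewrite !mxE.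
rewrite -(bigA_distr_bigA (fun l (j : 'I_(b + b).+1) => bump (z l 0 - (- b%:Z + (j : nat)%:Z)%:~R))).
rewrite big1 // => l _; have := Hz l; rewrite ler_norml => /andP[H1 H2]; apply: bump_sum.
  by rewrite rmorphN /=; lra.
by rewrite rmorphN /= -natr1 natrD; lra.
Qed.

(** The power N of the weight dominates the product of the N factors 1 + k_l^2, so the sum is at
    most a product of one-dimensional sums. *)
Lemma sum_ctr b : \sum_c (wt (ctr (b := b) c) ^+ N)^-1 <= 8 ^+ N.
Proof.
apply: (@le_trans _ _ (\sum_(c : {ffun 'I_N -> 'I_(b + b).+1}) \prod_(l < N) (1 + ((- b%:Z + (c l : nat)%:Z)%:~R : R) ^+ 2)^-1)).
  apply: ler_sum => c _; have -> : wt (ctr c) ^+ N = \prod_(l < N) wt (ctr c) by rewrite prodr_const card_ord.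
  rewrite -prodfV; apply: ler_prod => l _; rewrite invr_ge0 wt_ge0 /=.
  rewrite lef_pV2 ?posrE ?wt_gt0 ?ltr_pwDl ?sqr_ge0 //.
  rewrite /wt lerD2l /sqnorm (bigD1 l) //= !mxE lerDl.
  by apply: sumr_ge0 => i _; exact: sqr_ge0.
rewrite -(bigA_distr_bigA (fun l (j : 'I_(b + b).+1) => (1 + ((- b%:Z + (j : nat)%:Z)%:~R : R) ^+ 2)^-1)).
have -> : 8 ^+ N = \prod_(l < N) 8 :> R by rewrite prodr_const card_ord.
apply: ler_prod => l _; rewrite sum_inv_sqr andbT; apply: sumr_ge0 => j _.
by rewrite invr_ge0 addr_ge0 // sqr_ge0.
Qed.

Lemma wt_box (k z : 'cV[R]_N) : (forall l, k l 0 <= z l 0 <= k l 0 + 2) -> wt z <= 2 * (1 + N%:R * 4) * wt k.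
Proof.
move=> H; have -> : z = k + (z - k) by rewrite addrC subrK.
apply: le_trans (wtD _ _) _; rewrite -mulrA ler_pM2l // mulrC; apply: ler_wpM2r; first exact: wt_ge0.
rewrite /wt lerD2l /sqnorm; apply: (@le_trans _ _ (\sum_(l < N) 4)).
  by apply: ler_sum => l _; have := H l; rewrite !mxE; nra.
by rewrite sumr_const card_ord mulr_natl.
Qed.

(* Expanding the phase at k leaves a linear part of frequency (P + P^T) k, of the size
   of k since P + P^T is invertible. *)
Lemma eiq_recenter (P : 'M[R]_N) k : exists2 c : R[i], normc c = 1 &
  forall z, eiq P 0 z = c * (eiq 0 ((P + P^T) *m k) z * eiq P 0 (z - k)).
Proof.
exists (expi (qphase P 0 k - dotp ((P + P^T) *m k) k)); first exact: normc_expi.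
move=> z; rewrite /eiq -!expiD; congr expi.
have -> : qphase P 0 z = qphase P 0 k + qphase P 0 (z - k) + dotp ((P + P^T) *m k) (z - k).
  by rewrite -qphaseD [k + _]addrC subrK.
have -> : qphase 0 ((P + P^T) *m k) z = dotp ((P + P^T) *m k) z.
  by rewrite /qphase bform_dotpl trmx0 mul0mx dotpE trmx0 mul0mx mxE add0r.
have -> : dotp ((P + P^T) *m k) z = dotp ((P + P^T) *m k) k + dotp ((P + P^T) *m k) (z - k).
  by rewrite -dotpDr [k + _]addrC subrK.
by ring.
Qed.

(** Invertibility of S bounds |k| by a multiple of |S k|, and a power of a sum by the sum of the
    powers. Only powers of single components remain, so each integration by parts can stay in one
    direction and only pure derivatives occur. *)
Lemma wt_expr_le (S : 'M[R]_N) n : S \in unitmx -> exists2 C : R, 0 <= C &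
  forall k, wt k ^+ n <= C * (1 + \sum_i `|(S *m k) i 0| ^+ (n + n)).
Proof.
move=> uS; have [C C0 HC] := sqnorm_mul (invmx S).
exists ((1 + C) ^+ n * (2 ^+ n) ^+ N); first by rewrite mulr_ge0 // exprn_ge0 // ?exprn_ge0 // addr_ge0.
move=> k; set b := S *m k.
have Hw : wt k <= (1 + C) * (1 + \sum_i b i 0 ^+ 2).
  have := HC b; rewrite /b mulKmx // -/b /wt -/(sqnorm b) => H.
  by have := sqnorm_ge0 b; nra.
apply: (@le_trans _ _ (((1 + C) * (1 + \sum_i b i 0 ^+ 2)) ^+ n)).
  by apply: lerXn2r; rewrite ?nnegrE ?wt_ge0 // (le_trans (wt_ge0 k)).
rewrite exprMn -mulrA; apply: ler_wpM2l; first by rewrite exprn_ge0 // addr_ge0.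
have := @expr_sum_le n (index_enum 'I_N) (fun i => b i 0 ^+ 2) (fun i => sqr_ge0 _).
have -> : size (index_enum 'I_N) = N by rewrite -[RHS](size_enum_ord N) enumT.
by under [X in _ <= _ * (1 + X)]eq_bigr do rewrite -real_normK ?num_real // -exprM mul2n -addnn.
Qed.

(** After recentring at k, integration by parts 2 n times in each direction bounds w(k)^n times the
    integral by a multiple of w(k)^e with e = m + 2 n r. The choice of n leaves the factor
    w(k)^(-N), which is summable over the integral points. *)
Lemma piece_bound (P : 'M[R]_N) (m r : R) : P + P^T \in unitmx -> 0 <= m -> 0 <= r -> r < 2^-1 ->
  exists K, exists2 C : R, 0 <= C & forall q (k : 'cV[R]_N) (G : 'cV[R]_N -> V) (B : R), Q q -> smooth G -> 0 <= B ->
    (forall z, q (G z) <= B * wt z `^ m) ->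
    (forall i j z, (j <= K)%N -> q (iter j (partial i) G z) <= B * wt z `^ (m + r * j%:R)) ->
    q (riemann_integral (fun z => (eiq P 0 z : R[i]) *: ((phi (z - k) : R[i]) *: G z))) <= C * B * (wt k ^+ N)^-1.
Proof.
move=> uP m0 r0 r1; set S := P + P^T.
(* Chosen so that m + 2 n r + N <= n, that is n (1 - 2 r) >= m + N, which is possible because r <
   1/2. *)
pose n := (Num.truncn ((m + N%:R) / (1 - 2 * r))).+1.
have nP : m + r * (n + n)%:R + N%:R <= n%:R.
  have := truncnS_gt ((m + N%:R) / (1 - 2 * r)); rewrite -/n.
  rewrite ltr_pdivrMr ?subr_gt0; last by lra.
  by rewrite natrD => H; move/ltW: H; nra.
(* The quadratic part of the recentred phase is absorbed in the bump: this function no longer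
   depends on k, and only a linear phase remains. *)
pose Psi y : R[i]^o := eiq P 0 y * phi y.
have sPsi : smooth Psi by apply: smooth_mulC; [exact: smooth_eiq|exact: smooth_phi].
have suPsi : suppbox (fun=> 0) 2 Psi.
  move=> z; rewrite /Psi; have [/eqP ->|/supp_phi //] := boolP (phi z == 0).
  by rewrite mulr0 eqxx.
have [C0 C00 H0] := ibp0 sPsi suPsi.
have Hi i : exists C : R, 0 <= C /\ forall q (b k : 'cV[R]_N) (G : 'cV[R]_N -> V) (B : R), Q q -> smooth G -> 0 <= B ->
    (forall j (z : 'cV[R]_N), (j <= n + n)%N -> (forall l, k l 0 <= z l 0 <= k l 0 + 2) -> q (iter j (partial i) G z) <= B) ->
    `|b i 0| ^+ (n + n) * q (riemann_integral (fun z => (eiq 0 b z : R[i]) *: ((Psi (z - k) : R[i]) *: G z))) <= C * B.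
  by have [C ? ?] := ibp (n + n) i sPsi suPsi; exists C.
have [C HC] := choice Hi.
have [Cw Cw0 Hw] := wt_expr_le n uP.
pose e := m + r * (n + n)%:R.
pose D := (2 * (1 + N%:R * 4)) `^ e.
have T0 : 0 <= C0 + \sum_i C i by rewrite addr_ge0 // sumr_ge0 // => i _; have [] := HC i.
exists (n + n)%N; exists (Cw * (C0 + \sum_i C i) * D).
  by rewrite !mulr_ge0 // powR_ge0.
move=> q k G B Hq sG B0 HB0 HB; have Hs := Qsn Qdef Hq.
have [c c1 Hc] := eiq_recenter P k; rewrite -/S in Hc.
pose f z := (eiq 0 (S *m k) z : R[i]) *: ((Psi (z - k) : R[i]) *: G z).
have -> : (fun z => (eiq P 0 z : R[i]) *: ((phi (z - k) : R[i]) *: G z)) = (fun z => c *: f z).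
  by apply/funext => z; rewrite Hc /f /Psi !scalerA !mulrA.
have ccf : cc f.
  apply: (@suppbox_cc _ (fun i => k i 0) 2).
    apply: cont_mul; first exact: cont_eiq.
    by apply: cont_mul; [exact: cont_shift|exact: smooth_cont].
  move=> z; rewrite /f scalerA; have [/eqP ->|Hz _] := boolP (Psi (z - k) == 0); first by rewrite mulr0 scale0r eqxx.
  exact: (suppbox_shift suPsi Hz).
rewrite (rintZ Qdef hV complV c ccf) (snZ Hs) c1 mul1r.
set I_ := q _; have I0 : 0 <= I_ by exact: sn_ge0.
pose B1 := B * (D * wt k `^ e).
have D0 : 0 <= D by exact: powR_ge0.
have B10 : 0 <= B1 by rewrite mulr_ge0 // mulr_ge0 // wtp_ge0.
have e0 : 0 <= e by rewrite addr_ge0 // mulr_ge0.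
have HzB (z : 'cV[R]_N) e' : e' <= e -> (forall l, k l 0 <= z l 0 <= k l 0 + 2) -> B * wt z `^ e' <= B1.
  move=> ee Hz; apply: ler_wpM2l => //; apply: le_trans (wtp_mono z ee) _.
  rewrite /D -powRM ?wt_ge0 //; apply: ge0_ler_powR; rewrite ?nnegrE ?wt_ge0 ?mulr_ge0 ?wt_ge0 //.
  exact: wt_box.
have J0 : I_ <= C0 * B1.
  apply: (H0 q (S *m k) k G B1) => // z Hz; apply: le_trans (HB0 z) _; apply: HzB => //.
  by rewrite lerDl mulr_ge0.
have Ji i : `|(S *m k) i 0| ^+ (n + n) * I_ <= C i * B1.
  have [_ HCi] := HC i; apply: (HCi q (S *m k) k G B1) => // j z jn Hz.
  apply: le_trans (HB i j z jn) _; apply: HzB => //.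
  by rewrite lerD2l ler_wpM2l // ler_nat.
have J : wt k ^+ n * I_ <= Cw * (C0 + \sum_i C i) * B1.
  apply: le_trans (ler_wpM2r I0 (Hw k)) _; rewrite -!mulrA; apply: ler_wpM2l => //.
  by rewrite !mulrDl mul1r; apply: lerD => //; rewrite !mulr_suml; apply: ler_sum.
rewrite ler_pdivlMr ?exprn_gt0 ?wt_gt0 // mulrC.
have W : wt k ^+ n >= wt k `^ e * wt k ^+ N.
  by rewrite -!powR_mulrn ?wt_ge0 // -wtpD; exact: wtp_mono.
have X0 : 0 < wt k `^ e by exact: wtp_gt0.
rewrite -(ler_pM2l X0) mulrA; apply: le_trans (ler_wpM2r I0 W) _; apply: le_trans J _.
by rewrite le_eqVlt; apply/orP; left; apply/eqP; rewrite /B1; ring.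
Qed.

(** Sums [piece_bound] over the partition of unity. The range b of the centres grows with the
    support of G, but [sum_ctr] bounds the sum independently of it. *)
Lemma osc_estimate (P : 'M[R]_N) (m r : R) : P + P^T \in unitmx -> 0 <= m -> 0 <= r -> r < 2^-1 ->
  exists K, exists2 C : R, 0 <= C & forall q (G : 'cV[R]_N -> V) (B : R), Q q -> smooth G -> (exists L, supp_le L G) -> 0 <= B ->
    (forall z, q (G z) <= B * wt z `^ m) ->
    (forall i j z, (j <= K)%N -> q (iter j (partial i) G z) <= B * wt z `^ (m + r * j%:R)) ->
    q (riemann_integral (fun z => (eiq P 0 z : R[i]) *: G z)) <= C * B.
Proof.
move=> uP m0 r0 r1; have [K [C C0 H]] := piece_bound uP m0 r0 r1.
exists K; exists (C * 8 ^+ N); first by rewrite mulr_ge0 // exprn_ge0.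
move=> q G B Hq sG [L sL] B0 HB0 HB; have Hs := Qsn Qdef Hq.
pose b := (Num.truncn (L + 1)).+1.
have Lb : L <= b%:R - 1 by have := truncnS_gt (L + 1); rewrite -/b; lra.
pose f c z := (eiq P 0 z : R[i]) *: ((phi (z - ctr (b := b) c) : R[i]) *: G z).
have -> : (fun z => (eiq P 0 z : R[i]) *: G z) = (fun z => \sum_c f c z).
  apply/funext => z; rewrite /f -scaler_sumr -scaler_suml; congr (_ *: _).
  have [/eqP ->|/sL Hz] := boolP (G z == 0); first by rewrite scaler0.
  by rewrite phi_sum ?scale1r // => l; apply: le_trans (Hz l) Lb.
rewrite (rint_sum Qdef hV complV); last first.
  move=> c; apply: cc_mul; first exact: cont_eiq.
  apply: cc_mul; first by apply: cont_shift; exact: smooth_phi.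
  by split; [exact: smooth_cont|exists L].
apply: le_trans (sn_sum Hs _ _ _) _.
apply: (@le_trans _ _ (\sum_c C * B * (wt (ctr (b := b) c) ^+ N)^-1)).
  by apply: ler_sum => c _; exact: (H q (ctr c) G B).
rewrite -mulr_sumr [leRHS]mulrAC; apply: ler_wpM2l; first exact: mulr_ge0.
exact: sum_ctr.
Qed.

Lemma iter_partials (W : tvsType R[i]) j i (F : 'cV[R]_N -> W) : iter j (partial i) F = partials (nseq j i) F.
Proof. by elim: j => [//|j IH] /=; rewrite IH. Qed.

Lemma leibniz_bound q s : forall (g : 'cV[R]_N -> R[i]^o) (F : 'cV[R]_N -> V) z (b c : R), Q q -> smooth g -> smooth F ->
  0 <= b -> 0 <= c ->
  (forall t, (size t <= size s)%N -> normc (partials t g z) <= b) ->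
  (forall t, (size t <= size s)%N -> q (partials t F z) <= c) ->
  q (partials s (fun y => (g y : R[i]) *: F y) z) <= 2 ^+ size s * (b * c).
Proof.
(* The last index of the list is the derivative applied first, hence to the product itself. *)
elim/last_ind: s => [|s i IH] g F z b c Hq sg sF b0 c0 Hg HF; have Hs := Qsn Qdef Hq.
  rewrite expr0 mul1r /= (snZ Hs); apply: ler_pM; rewrite ?normc_ge0 ?(sn_ge0 Hs) //.
    exact: (Hg [::]).
  exact: (HF [::]).
rewrite size_rcons in Hg HF *.
rewrite partials_rcons (partial_mul hV i sg sF).
rewrite (partials_D hV); last 2 first.
- by apply: (smooth_mul hV); [exact: smooth_partial|].
- by apply: (smooth_mul hV); [|exact: smooth_partial].
apply: le_trans (snD Hs _ _) _; rewrite exprS -mulrA mulrDl mul1r; apply: lerD.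
  apply: (IH _ _ _ _ _ Hq (smooth_partial i sg) sF b0 c0) => t Ht; last by apply: HF; exact: leqW.
  by rewrite -partials_rcons; apply: Hg; rewrite size_rcons.
apply: (IH _ _ _ _ _ Hq sg (smooth_partial i sF) b0 c0) => t Ht; first by apply: Hg; exact: leqW.
by rewrite -partials_rcons; apply: HF; rewrite size_rcons.
Qed.

(** The form suited to cutoffs: a scalar factor of size B' w^(1/2), with its derivatives, raises the
    exponent m by 1/2 and leaves B' in the bound, where it will be the rate of convergence. *)
Lemma osc_estimate2 (P : 'M[R]_N) (m r : R) : P + P^T \in unitmx -> 0 <= m -> 0 <= r -> r < 2^-1 ->
  exists K, exists2 C : R, 0 <= C & forall q (g : 'cV[R]_N -> R[i]^o) (F : 'cV[R]_N -> V) (B B' : R),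
    Q q -> smooth g -> smooth F -> (exists L, supp_le L (fun z => (g z : R[i]) *: F z)) -> 0 <= B -> 0 <= B' ->
    (forall s z, (size s <= K)%N -> normc (partials s g z) <= B' * wt z `^ 2^-1) ->
    (forall s z, (size s <= K)%N -> q (partials s F z) <= B * wt z `^ (m + r * (size s)%:R)) ->
    q (riemann_integral (fun z => (eiq P 0 z : R[i]) *: ((g z : R[i]) *: F z))) <= C * (B * B').
Proof.
move=> uP m0 r0 r1; have m0' : 0 <= m + 2^-1 by rewrite addr_ge0 // invr_ge0.
have [K [C C0 H]] := osc_estimate uP m0' r0 r1; exists K; exists (C * 2 ^+ K); first by rewrite mulr_ge0 // exprn_ge0.
move=> q g F B B' Hq sg sF HL B0 B'0 Hg HF; rewrite -mulrA.
have Hd s z : (size s <= K)%N -> q (partials s (fun y => (g y : R[i]) *: F y) z) <=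
    2 ^+ K * (B * B') * wt z `^ (m + 2^-1 + r * (size s)%:R).
  move=> sK; have := @leibniz_bound q s g F z (B' * wt z `^ 2^-1) (B * wt z `^ (m + r * (size s)%:R)) Hq sg sF.
  rewrite !mulr_ge0 ?wtp_ge0 // => /(_ isT isT) H1.
  have {}H1 := H1 (fun t ts => Hg t z (leq_trans ts sK)).
  apply: le_trans (H1 _) _ => [t ts|].
    apply: le_trans (HF t z (leq_trans ts sK)) _; apply: ler_wpM2l => //; apply: wtp_mono.
    by rewrite lerD2l ler_wpM2l // ler_nat.
  have -> : m + 2^-1 + r * (size s)%:R = 2^-1 + (m + r * (size s)%:R) by ring.
  rewrite (wtpD z 2^-1) mulrACA [B' * B]mulrC -[leRHS]mulrA; apply: ler_wpM2r.
    by rewrite !mulr_ge0 // wtp_ge0.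
  by apply: ler_weXn2l => //; rewrite ler1n.
apply: (H q _ (2 ^+ K * (B * B')) Hq _ HL); first exact: (smooth_mul hV).
- by rewrite !mulr_ge0 ?exprn_ge0.
- by move=> z; have := Hd [::] z (leq0n _); rewrite mulr0 addr0.
- by move=> i j z jK; have := Hd (nseq j i) z; rewrite size_nseq iter_partials; apply.
Qed.

End Estimate.

(** Lists of bounded length over a finite type are finitely many; the constants are summed over the
    first letter. *)
Lemma unif_lists (R : realType) (T : finType) K : forall (Pr : seq T -> R -> Prop),
  (forall s C C', C <= C' -> Pr s C -> Pr s C') ->
  (forall s, exists2 C, 0 <= C & Pr s C) ->
  exists2 C, 0 <= C & forall s, (size s <= K)%N -> Pr s C.
Proof.
elim: K => [|K IH] Pr Pmono PC; have [C0 C00 HC0] := PC [::].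
  by exists C0 => // -[|].
have Hi i : exists C, 0 <= C /\ forall s, (size s <= K)%N -> Pr (i :: s) C.
  by have [s C C' CC|s|C C0' HC] := IH (fun s C => Pr (i :: s) C); [exact: Pmono|exact: PC|exists C].
have [C HC] := choice Hi; have S0 : 0 <= \sum_i C i by apply: sumr_ge0 => i _; have [] := HC i.
exists (C0 + \sum_i C i); first exact: addr_ge0.
case=> [_|i s sK]; first by apply: Pmono HC0; rewrite lerDl.
have [_ H] := HC i; apply: Pmono (H s sK); rewrite (bigD1 i) //= addrCA lerDl addr_ge0 //.
by apply: sumr_ge0 => l _; have [] := HC l.
Qed.

Section Growth.
Context {R : realType} (V : tvsType R[i]) (Q : set (V -> R)).
Hypothesis Qdef : defining_system Q.
Hypothesis hV : hausdorff_space V.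
Hypothesis complV : sequentially_complete V.
Variable N : nat.
Local Notation normc := (@ComplexField.Normc.normc R).

(* With r < 1/2, a symbol of order 2 m and of type - 2 r, in all the mixed derivatives. *)
Definition growth (r : R) (F : 'cV[R]_N -> V) := smooth F /\ forall q, Q q ->
  exists2 m : R, 0 <= m & forall s, exists2 C : R, 0 <= C &
    forall z, q (partials s F z) <= C * wt z `^ (m + r * (size s)%:R).

Lemma growth_lin r a F G : growth r F -> growth r G -> growth r (fun z => a *: F z + G z).
Proof.
move=> [sF HF] [sG HG]; have saF := smooth_Z hV a sF; split; first exact: smooth_D.
move=> q Hq; have Hs := Qsn Qdef Hq.
have [m1 m10 H1] := HF q Hq; have [m2 m20 H2] := HG q Hq.
exists (m1 + m2); first exact: addr_ge0.
move=> s; have [C1 C10 HC1] := H1 s; have [C2 C20 HC2] := H2 s.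
exists (normc a * C1 + C2); first by rewrite addr_ge0 // mulr_ge0 // normc_ge0.
move=> z; rewrite (partials_D hV _ saF sG) (partials_Z hV _ _ sF).
apply: le_trans (snD Hs _ _) _; rewrite (snZ Hs) mulrDl; apply: lerD.
  rewrite -mulrA; apply: ler_wpM2l; first exact: normc_ge0.
  apply: le_trans (HC1 z) _; apply: ler_wpM2l => //; apply: wtp_mono.
  by rewrite lerD2r lerDl.
apply: le_trans (HC2 z) _; apply: ler_wpM2l => //; apply: wtp_mono.
by rewrite lerD2r lerDr.
Qed.

Lemma growth_unif r F q : growth r F -> Q q -> exists2 m : R, 0 <= m & forall K, exists2 C : R, 0 <= C &
  forall s z, (size s <= K)%N -> q (partials s F z) <= C * wt z `^ (m + r * (size s)%:R).
Proof.
move=> [sF HF] Hq; have [m m0 H] := HF q Hq; exists m => // K.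
have [s C C' CC' HC z|s|C C0 HC] := @unif_lists R 'I_N K (fun s C => forall z, q (partials s F z) <= C * wt z `^ (m + r * (size s)%:R)).
- by apply: le_trans (HC z) _; apply: ler_wpM2r => //; exact: wtp_ge0.
- exact: H.
- by exists C => // s z sK; exact: HC.
Qed.

Definition cut (j : nat) : 'cV[R]_N -> R[i]^o := cutoff (fun=> j.+1%:R).

Lemma smooth_cut j : smooth (cut j).
Proof. exact: cutoff_smooth. Qed.

Lemma supp_cut j : supp_le (2 * j.+1%:R) (cut j).
Proof. by move=> z H l; apply: (@cutoff_supp _ _ (fun=> j.+1%:R)) => // i; rewrite ltr0n. Qed.

Lemma cc_cut j (F : 'cV[R]_N -> V) : continuous F -> cc (fun z => (cut j z : R[i]) *: F z).
Proof.
move=> cF; split; first by apply: cont_mul => //; apply: smooth_cont; exact: smooth_cut.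
by exists (2 * j.+1%:R); apply: supp_le_mull; exact: supp_cut.
Qed.

Lemma smooth_one : smooth (@one_ R N).
Proof. exact: (smooth_cst hausC (1 : R[i]^o)). Qed.

Lemma cut_bound K : exists2 C : R, 0 <= C & forall s j z, (size s <= K)%N ->
  normc (partials s (fun z => one_ z - cut j z) z) <= C / j.+1%:R * wt z `^ 2^-1.
Proof.
have [s C C' CC' HC j z|s|C C0 HC] := @unif_lists R 'I_N K (fun s C => forall j z,
    normc (partials s (fun z => one_ z - cut j z) z) <= C / j.+1%:R * wt z `^ 2^-1).
- apply: le_trans (HC j z) _; apply: ler_wpM2r; first exact: wtp_ge0.
  by apply: ler_wpM2r.
- have [C C0 HC] := @cutoff_bound R N s; exists C => // j z; rewrite mulrAC.
  by apply: HC; rewrite ?ler1n.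
- by exists C => // s j z sK; exact: HC.
Qed.

Lemma cutB_bound K : exists2 C : R, 0 <= C & forall s j k z, (size s <= K)%N ->
  normc (partials s (fun z => cut k z - cut j z) z) <= C * (j.+1%:R^-1 + k.+1%:R^-1) * wt z `^ 2^-1.
Proof.
have [C C0 HC] := cut_bound K; exists C => // s j k z sK.
have -> : (fun z => cut k z - cut j z) = (fun z => (one_ z - cut j z) - (one_ z - cut k z)).
  by apply/funext => y; rewrite opprB [cut k y - _]addrC [RHS]addrC subrKA addrC.
rewrite (partials_B hausC); last 2 first.
- by apply: (smooth_B hausC); [exact: smooth_one|exact: smooth_cut].
- by apply: (smooth_B hausC); [exact: smooth_one|exact: smooth_cut].
apply: le_trans (snB sn_normc _ _) _; rewrite mulrDr mulrDl; apply: lerD; exact: HC.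
Qed.

Variable P : 'M[R]_N.
Hypothesis uP : P + P^T \in unitmx.

Definition Iosc (F : 'cV[R]_N -> V) : V := riemann_integral (fun z => (eiq P 0 z : R[i]) *: F z).

Lemma Iosc_cutB j k (F : 'cV[R]_N -> V) : continuous F ->
  Iosc (fun z => (cut k z : R[i]) *: F z) - Iosc (fun z => (cut j z : R[i]) *: F z) =
  Iosc (fun z => (cut k z - cut j z : R[i]) *: F z).
Proof.
move=> cF; rewrite /Iosc -(rintB Qdef hV complV); last 2 first.
- by apply: cc_mul; [exact: cont_eiq|exact: cc_cut].
- by apply: cc_mul; [exact: cont_eiq|exact: cc_cut].
by congr riemann_integral; apply/funext => z; rewrite -scalerBr -scalerBl.
Qed.

(** The difference of two cutoffs is O(1/j + 1/k) w^(1/2) with all its derivatives by [cutB_bound],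
    so [osc_estimate2] applies with this rate as B'. *)
Lemma osc_rate m r : 0 <= m -> 0 <= r -> r < 2^-1 ->
  exists K, exists2 C : R, 0 <= C & forall q (F : 'cV[R]_N -> V) (B : R), Q q -> smooth F -> 0 <= B ->
    (forall s z, (size s <= K)%N -> q (partials s F z) <= B * wt z `^ (m + r * (size s)%:R)) ->
    forall j k, q (Iosc (fun z => (cut k z : R[i]) *: F z) - Iosc (fun z => (cut j z : R[i]) *: F z)) <=
      C * B * (j.+1%:R^-1 + k.+1%:R^-1).
Proof.
move=> m0 r0 r1; have [K [C C0 H]] := osc_estimate2 Qdef hV complV uP m0 r0 r1.
have [C' C'0 H'] := cutB_bound K.
exists K; exists (C * C'); first exact: mulr_ge0.
move=> q F B Hq sF B0 HF j k; rewrite Iosc_cutB; last exact: smooth_cont.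
have sg : smooth (fun z => cut k z - cut j z : R[i]^o).
  by apply: (smooth_B hausC); exact: smooth_cut.
have D0 : 0 <= C' * (j.+1%:R^-1 + k.+1%:R^-1) by rewrite mulr_ge0 // addr_ge0.
have sL : exists L, supp_le L (fun z => (cut k z - cut j z : R[i]) *: F z).
  exists (2 * j.+1%:R + 2 * k.+1%:R); apply: supp_le_mull => z.
  have [/eqP ->|Hz _] := boolP (cut j z == 0).
    by rewrite subr0 => Hz l; apply: le_trans (supp_cut Hz l) _; rewrite lerDr.
  by move=> l; apply: le_trans (supp_cut Hz l) _; rewrite lerDl.
apply: le_trans (H q _ F B _ Hq sg sF sL B0 D0 _ HF) _; last first.
  by rewrite le_eqVlt; apply/orP; left; apply/eqP; ring.
by move=> s z sK; exact: H'.
Qed.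

Lemma osc_lim r F : 0 <= r -> r < 2^-1 -> growth r F ->
  exists v : V, Iosc (fun z => (cut j z : R[i]) *: F z) @[j --> \oo] --> v.
Proof.
move=> r0 r1 gF; apply: complV; apply: (cauchy_seqQ Qdef) => q e Hq e0.
have [m m0 Hm] := growth_unif gF Hq; have [K [C C0 H]] := osc_rate m0 r0 r1.
have [B B0 HB] := Hm K; have CB0 : 0 <= C * B by exact: mulr_ge0.
have e1 : 0 < e / (2 * (C * B + 1)) by rewrite divr_gt0 // mulr_gt0 // ltr_pwDr.
have [k0 _ Hk0] := mesh_near e1.
exists k0 => j k jk kk; have [sF _] := gF.
apply: le_lt_trans (H q F B Hq sF B0 HB k j) _.
have := Hk0 j jk; have := Hk0 k kk; rewrite /= /mesh.
rewrite !ltr_pdivlMr ?mulr_gt0 ?ltr_pwDr // => h1 h2.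
have a0 : 0 < (j.+1%:R^-1 : R) by rewrite invr_gt0 ltr0n.
have b0 : 0 < (k.+1%:R^-1 : R) by rewrite invr_gt0 ltr0n.
by move: h1 h2 a0 b0; move: (C * B) (j.+1%:R^-1) (k.+1%:R^-1) => X a b; lra.
Qed.

(** The limit k to infinity in [osc_rate]. F enters only through B, which makes the rate uniform
    over families such as the inner integrands of an iterated integral. *)
Lemma osc_lim_rate m r : 0 <= m -> 0 <= r -> r < 2^-1 ->
  exists K, exists2 C : R, 0 <= C & forall q (F : 'cV[R]_N -> V) (B : R) (v : V), Q q -> smooth F -> 0 <= B ->
    (forall s z, (size s <= K)%N -> q (partials s F z) <= B * wt z `^ (m + r * (size s)%:R)) ->
    Iosc (fun z => (cut j z : R[i]) *: F z) @[j --> \oo] --> v ->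
    forall j, q (v - Iosc (fun z => (cut j z : R[i]) *: F z)) <= C * B / j.+1%:R.
Proof.
move=> m0 r0 r1; have [K [C C0 H]] := osc_rate m0 r0 r1.
exists K; exists (2 * C); first exact: mulr_ge0.
move=> q F B v Hq sF B0 HF Hv j.
apply: (lim_sn_le Qdef Hq (u := fun k => Iosc (fun z => (cut k z : R[i]) *: F z) - Iosc (fun z => (cut j z : R[i]) *: F z))).
  exact: (cvgV_sub Hv (cvg_cst _)).
exists j => // k /= jk; apply: le_trans (H q F B Hq sF B0 HF j k) _.
apply: (@le_trans _ _ (C * B * (j.+1%:R^-1 + j.+1%:R^-1))).
  apply: ler_wpM2l; first exact: mulr_ge0.
  by rewrite lerD2l lef_pV2 ?posrE ?ltr0n // ler_nat.
by rewrite le_eqVlt; apply/orP; left; apply/eqP; ring.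
Qed.

End Growth.

Section MultiIndex.
Context {R : realType} (V : tvsType R[i]) (N : nat).

Lemma midx_partials (mu : {ffun 'I_N -> nat}) : exists2 s : seq 'I_N, size s = midx_size mu &
  forall F : 'cV[R]_N -> V, midx_partial mu F = partials s F.
Proof.
have H (r : seq 'I_N) : exists2 s : seq 'I_N, size s = (\sum_(i <- r) mu i)%N &
    forall F : 'cV[R]_N -> V, foldr (fun i => iter (mu i) (partial i)) F r = partials s F.
  elim: r => [|i r [s ss Hs]]; first by exists [::]; rewrite ?big_nil.
  exists (nseq (mu i) i ++ s); first by rewrite size_cat size_nseq ss big_cons.
  by move=> F /=; rewrite Hs iter_partials partials_cat.
have [s ss Hs] := H (enum 'I_N); exists s => //.
by rewrite ss /midx_size big_enum.
Qed.

Lemma midx_pure (i : 'I_N) k : exists2 mu : {ffun 'I_N -> nat}, midx_size mu = k &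
  forall F : 'cV[R]_N -> V, midx_partial mu F = iter k (partial i) F.
Proof.
exists [ffun l => if l == i then k else 0%N].
  rewrite /midx_size (bigD1 i) //= ffunE eqxx big1 ?addn0 // => l li.
  by rewrite ffunE (negbTE li).
move=> F; rewrite /midx_partial.
have H (r : seq 'I_N) : uniq r -> foldr (fun l => iter ([ffun l => if l == i then k else 0%N] l) (partial l)) F r =
    if i \in r then iter k (partial i) F else F.
  elim: r => [//|l r IH] /= /andP[lr ur]; rewrite IH // ffunE in_cons eq_sym.
  have [->|li] := eqVneq i l; last by [].
  by rewrite (negbTE lr).
by rewrite H ?enum_uniq // mem_enum.
Qed.

Lemma midx_zero : exists2 mu : {ffun 'I_N -> nat}, midx_size mu = 0%N &
  forall F : 'cV[R]_N -> V, midx_partial mu F = F.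
Proof.
exists [ffun=> 0%N]; first by rewrite /midx_size big1 // => l _; rewrite ffunE.
by move=> F; rewrite /midx_partial; elim: (enum _) => [//|l r IH] /=; rewrite ffunE IH.
Qed.

Variable q : V -> R.
Hypothesis Hs : seminorm q.

Lemma symbol_norm_le (m rho : (V -> R) -> R) mu (F : 'cV[R]_N -> V) (B : R) :
  (forall z, q (midx_partial mu F z) <= B * wt z `^ ((m q - rho q * (midx_size mu)%:R) / 2)) ->
  (symbol_norm m rho q mu F <= B%:E)%E.
Proof.
move=> H; apply: ge_ereal_sup => _ [z _ <-]; rewrite lee_fin mulrC powRN ler_pdivrMr; last exact: wtp_gt0.
exact: H.
Qed.

Lemma symbol_norm_ge (m rho : (V -> R) -> R) mu (F : 'cV[R]_N -> V) (B : R) :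
  (symbol_norm m rho q mu F <= B%:E)%E ->
  forall z, q (midx_partial mu F z) <= B * wt z `^ ((m q - rho q * (midx_size mu)%:R) / 2).
Proof.
move=> H z; rewrite -ler_pdivrMr; last exact: wtp_gt0.
rewrite -lee_fin; apply: le_trans H; apply: ereal_sup_ubound; exists z => //.
by rewrite -powRN mulrC.
Qed.

Lemma symbol_norm_ge0 (m rho : (V -> R) -> R) mu (F : 'cV[R]_N -> V) : (0 <= symbol_norm m rho q mu F)%E.
Proof.
apply: (@le_trans _ _ ((1 + sqnorm (0 : 'cV[R]_N)) `^ (- ((m q - rho q * (midx_size mu)%:R) / 2)) * q (midx_partial mu F 0))%:E).
  by rewrite lee_fin mulr_ge0 ?powR_ge0 // sn_ge0.
by apply: ereal_sup_ubound; exists 0.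
Qed.

End MultiIndex.

Section CompactSupport.
Context {R : realType} (V : tvsType R[i]) (N : nat).

Lemma supp_le_test (F : 'cV[R]_N -> V) L : smooth F -> supp_le L F -> test_function F.
Proof.
move=> sF sL; split => //; apply: (subclosed_compact _ (@box_compact R N L)); first exact: closed_closure.
have -> : [set z : 'cV[R]_N | forall i, `|z i 0| <= L] = closure [set z : 'cV[R]_N | forall i, `|z i 0| <= L].
  apply/closure_id.
  have -> : [set z : 'cV[R]_N | forall i, `|z i 0| <= L] =
      \bigcap_(i in [set: 'I_N]) ((fun z : 'cV[R]_N => `|z i 0|) @^-1` [set x | x <= L]).
    by apply/seteqP; split=> z Hz i; [move=> _; exact: Hz|exact: (Hz i)].
  apply: closed_bigI => i _; apply: closed_comp; last exact: closed_le.
  move=> z _; apply: (cvg_comp _ Num.norm (@coord_continuous R N 1 i 0 z)); exact: norm_continuous.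
by apply: closureS => z Fz; apply: sL; apply/eqP.
Qed.

Lemma test_supp_le (F : 'cV[R]_N -> V) : test_function F -> exists L, supp_le L F.
Proof.
move=> [_ cF].
have Hi (i : 'I_N) : exists L : R, forall z, F z != 0 -> `|z i 0| <= L.
  have ci : compact ((fun z : 'cV[R]_N => z i 0) @` closure [set x | F x <> 0]).
    apply: continuous_compact => //; apply: continuous_subspaceT => z; exact: (@coord_continuous R N 1 i 0 z).
  have [L [_ HL]] := compact_bounded ci; exists (L + 1) => z Fz.
  apply: HL; first by rewrite ltrDl.
  exists z => //; apply: subset_closure => /=; exact/eqP.
have [L HL] := choice Hi; exists (\sum_i `|L i|) => z Fz i.
apply: le_trans (HL i z Fz) _; apply: le_trans (ler_norm _) _.
by rewrite (bigD1 i) //= lerDl sumr_ge0.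
Qed.

End CompactSupport.

(** * The oscillatory integral as the limit along standard cutoffs *)

Section Oscint.
Context {R : realType} (n : nat) (V : tvsType R[i]) (Q : set (V -> R)).
Hypothesis Qdef : defining_system Q.
Hypothesis hV : hausdorff_space V.
Hypothesis complV : sequentially_complete V.
Variable M : 'M[R]_n.
Hypothesis hM : `|\det M| = 1.
Local Notation normc := (@ComplexField.Normc.normc R).

Definition PM : 'M[R]_(n + n) := block_mx 0 M 0 0.

Lemma unitM : M \in unitmx.
Proof. by rewrite unitmxE unitfE -normr_gt0 hM. Qed.

Lemma unitPM : PM + PM^T \in unitmx.
Proof.
have uM := unitM; have uMT : M^T \in unitmx by rewrite unitmx_tr.
rewrite /PM tr_block_mx !trmx0 add_block_mx !addr0 add0r.
have H : block_mx 0 M M^T 0 *m block_mx 0 (invmx M^T) (invmx M) 0 = 1%:M :> 'M[R]_(n + n).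
  by rewrite mulmx_block !mul0mx !mulmx0 !addr0 !add0r !mulmxV // -scalar_mx_block.
by have [] := mulmx1_unit H.
Qed.

Lemma qphase_pairing z : qphase PM 0 z = pairing M (usubmx z) (dsubmx z).
Proof.
rewrite /qphase.
have -> : dotp (0 : 'cV[R]_(n + n)) z = 0 by rewrite /dotp big1 // => i _; rewrite mxE mul0r.
rewrite addr0 /bform /pairing /PM -{2}[z]vsubmxK mul_block_col !mul0mx !addr0 add0r.
rewrite big_split_ord /=.
rewrite [X in _ + X]big1 ?addr0; last by move=> i _; rewrite col_mxEd mxE mulr0.
by apply: eq_bigr => i _; rewrite col_mxEu [usubmx z i 0]mxE.
Qed.

Definition oscc : R[i] := ((2 * pi) ^- n)%:C.

Lemma osc0E (F : 'cV[R]_(n + n) -> V) : osc0 M F = oscc *: Iosc PM F.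
Proof. by rewrite /osc0 /Iosc; congr (_ *: riemann_integral _); apply/funext => z; rewrite /eiq qphase_pairing. Qed.

(* As [osc_estimate] involves only pure derivatives, which are multi-index derivatives
   for any order of the variables, partial derivatives need not be commuted. *)
Lemma regularization_cut m rho r (F : 'cV[R]_(n + n) -> V) G : 0 <= r -> r < 2^-1 -> growth Q r F -> regularization Q m rho F G ->
  osc0 M (G j) - osc0 M (fun z => (cut j z : R[i]) *: F z) @[j --> \oo] --> (0 : V).
Proof.
move=> r0 r1 gF [tG [m' [rho' [Hmr HG]]]]; have [sF _] := gF.
apply/(cvgQ_lt Qdef) => q e Hq e0; have Hs := Qsn Qdef Hq.
have [_ rho1 _] := Hmr q Hq; have [m1 m10 Hm] := growth_unif gF Hq.
(* On w = 1 + |z|^2, an order m' and a type rho' mean the exponent m'/2 with a loss - rho'/2 per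
   derivative, below 1/2 as rho' > -1. The 1/2 added to [m1] pays for the factor 1 - [cut]. Both
   maxima allow one estimate for F1 and F2 together. *)
pose rE := Num.max r (- rho' q / 2); pose mE := Num.max (m1 + 2^-1) (m' q / 2).
have rE0 : 0 <= rE by rewrite le_max r0.
have rE1 : rE < 2^-1 by rewrite gt_max r1 /=; lra.
have mE0 : 0 <= mE by rewrite le_max addr_ge0 // invr_ge0.
have [K [C C0 H]] := osc_estimate Qdef hV complV unitPM mE0 rE0 rE1.
have [B B0 HB] := Hm K; have [B' B'0 HB'] := @cut_bound R (n + n) K.
pose c := normc oscc; have c0 : 0 <= c by exact: normc_ge0.
pose d := e / (2 * (c * C + 1)).
have cC0 : 0 <= c * C by exact: mulr_ge0.
have d0 : 0 < d by rewrite divr_gt0 // mulr_gt0 // ltr_pwDr.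
have d2 : 0 < d / (2 ^+ K * (B * B') + 1) by rewrite divr_gt0 // ltr_pwDr // !mulr_ge0 // exprn_ge0.
have near1 : \forall j \near \oo, 2 ^+ K * (B * B') / j.+1%:R <= d.
  have := mesh_near d2; apply: filterS => j; rewrite ltr_pdivlMr ?ltr_pwDr ?mulr_ge0 ?exprn_ge0 // /mesh => Hj.
  have a0 : 0 < (j.+1%:R^-1 : R) by rewrite invr_gt0 ltr0n.
  by move: Hj a0; move: (2 ^+ K * _) (j.+1%:R^-1) => X a; lra.
have nearmu mu : \forall j \near \oo, (symbol_norm m' rho' q mu (fun x => (G j x - F x)%R) <= d%:E)%E.
  have := HG q mu Hq => /(_ [set x | (x <= d%:E)%E]); apply.
  have : (0%:E < d%:E)%E by rewrite lte_fin.
  by move=> /open_ereal_lt'; apply: filterS => x /= /ltW.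
have near0 : \forall j \near \oo, forall z, q (G j z - F z) <= d * wt z `^ mE.
  have [mu mu0 Hmu] := @midx_zero R V (n + n); have := nearmu mu; apply: filterS => j /(symbol_norm_ge) Hj z.
  have := Hj z; rewrite Hmu mu0 mulr0 subr0 => Hz; apply: le_trans Hz _.
  apply: ler_wpM2l; first exact: ltW. by apply: wtp_mono; rewrite le_max lexx orbT.
have neark i k : \forall j \near \oo, forall z, q (iter k (partial i) (fun x => G j x - F x) z) <= d * wt z `^ (mE + rE * k%:R).
  have [mu mu0 Hmu] := @midx_pure R V (n + n) i k; have := nearmu mu; apply: filterS => j /(symbol_norm_ge) Hj z.
  have := Hj z; rewrite Hmu mu0 => Hz; apply: le_trans Hz _.
  apply: ler_wpM2l; first exact: ltW. apply: wtp_mono.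
  rewrite mulrBl; apply: lerD; first by rewrite le_max lexx orbT.
  rewrite mulrAC -mulNr; apply: ler_wpM2r => //.
  by rewrite -mulNr le_max lexx orbT.
have neari : \forall j \near \oo, forall (i : 'I_(n + n)) (k : 'I_K.+1) z, q (iter k (partial i) (fun x => G j x - F x) z) <= d * wt z `^ (mE + rE * k%:R).
  by apply: filter_forall => i; apply: filter_forall => k; exact: neark.
apply: filterS3 near1 near0 neari => j H1 H0 Hi.
have sG : smooth (G j) by have [] := tG j.
(* The difference of G_j and the cut-off F is F1 + F2, with F1 = G_j - F small by the symbol
   convergence and F2 = (1 - [cut j]) F small by [cut_bound]. Neither part need have bounded
   support, so the estimate is applied to the sum. *)
have sX : smooth (fun z => (cut j z : R[i]) *: F z) by apply: (smooth_mul hV) => //; exact: smooth_cut.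
pose F1 z := G j z - F z; pose F2 z := ((one_ z - cut j z : R[i]^o) : R[i]) *: F z.
have sF1 : smooth F1 by exact: smooth_B.
have s1X : smooth (fun z : 'cV[R]_(n + n) => one_ z - cut j z : R[i]^o).
  by apply: (smooth_B hausC); [exact: smooth_one|exact: smooth_cut].
have sF2 : smooth F2 by exact: (smooth_mul hV s1X sF).
have EW : (fun z => G j z - (cut j z : R[i]) *: F z) = (fun z => F1 z + F2 z).
  apply/funext => z; rewrite /F1 /F2 scalerBl scale1r [RHS]addrA; congr (_ - _).
  by rewrite subrK.
have sW : smooth (fun z => F1 z + F2 z) by exact: smooth_D.
have [L1 L1G] := test_supp_le (tG j).
have sLX : supp_le (2 * j.+1%:R) (fun z => (cut j z : R[i]) *: F z).
  by apply: supp_le_mull; exact: supp_cut.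
have sLW : exists L, supp_le L (fun z => F1 z + F2 z).
  rewrite -EW; exists (`|L1| + 2 * j.+1%:R) => z.
  have [/eqP ->|Hz _] := boolP (G j z == 0).
    by rewrite sub0r oppr_eq0 => Hz l; apply: le_trans (sLX z Hz l) _; rewrite lerDr.
  move=> l; apply: le_trans (L1G z Hz l) _; apply: le_trans (ler_norm _) _.
  by rewrite lerDl.
have HF2 s z : (size s <= K)%N -> q (partials s F2 z) <= d * wt z `^ (mE + rE * (size s)%:R).
  move=> sK; have := @leibniz_bound _ V Q Qdef hV _ q s _ F z (B' / j.+1%:R * wt z `^ 2^-1) (B * wt z `^ (m1 + r * (size s)%:R)) Hq s1X sF.
  rewrite !mulr_ge0 ?invr_ge0 ?wtp_ge0 // => /(_ isT isT) Hl.
  have {}Hl := Hl (fun t ts => HB' t j z (leq_trans ts sK)).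
  apply: le_trans (Hl _) _ => [t ts|].
    apply: le_trans (HB t z (leq_trans ts sK)) _; apply: ler_wpM2l => //; apply: wtp_mono.
    by rewrite lerD2l ler_wpM2l // ler_nat.
  apply: (@le_trans _ _ (2 ^+ K * (B * B') / j.+1%:R * wt z `^ (2^-1 + (m1 + r * (size s)%:R)))).
    rewrite (wtpD z 2^-1); have -> : B' / j.+1%:R * wt z `^ 2^-1 * (B * wt z `^ (m1 + r * (size s)%:R)) =
      B * B' / j.+1%:R * (wt z `^ 2^-1 * wt z `^ (m1 + r * (size s)%:R)) by ring.
    rewrite [leLHS]mulrA; apply: ler_wpM2r; first by rewrite mulr_ge0 // wtp_ge0.
    rewrite mulrA; apply: ler_wpM2r; first by rewrite invr_ge0.
    by apply: ler_wpM2r; [exact: mulr_ge0|apply: ler_weXn2l => //; rewrite ler1n].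
  apply: ler_pM; rewrite ?wtp_ge0 ?mulr_ge0 ?exprn_ge0 ?invr_ge0 //.
  apply: wtp_mono; rewrite addrA; apply: lerD; first by rewrite addrC le_max lexx.
  by apply: ler_wpM2r => //; rewrite le_max lexx.
have HW : q (Iosc PM (fun z => F1 z + F2 z)) <= C * (2 * d).
  apply: (H q _ (2 * d) Hq sW sLW) => [|z|i k z kK].
  - by rewrite mulr_ge0 // ltW.
  - apply: le_trans (snD Hs _ _) _; rewrite -[leRHS]mulrA mulr_natl mulr2n; apply: lerD; first exact: H0.
    by have := HF2 [::] z (leq0n _); rewrite mulr0 addr0.
  rewrite iter_partials (partials_D hV _ sF1 sF2); apply: le_trans (snD Hs _ _) _.
  rewrite -[leRHS]mulrA mulr_natl mulr2n; apply: lerD.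
    by have := Hi i (Ordinal (kK : (k < K.+1)%N)) z; rewrite iter_partials.
  by have := HF2 (nseq k i) z; rewrite size_nseq; apply.
rewrite subr0 !osc0E -scalerBr (snZ Hs) -/c.
have -> : Iosc PM (G j) - Iosc PM (fun z => (cut j z : R[i]) *: F z) = Iosc PM (fun z => F1 z + F2 z).
  rewrite /Iosc -(rintB Qdef hV complV); last 2 first.
  - by apply: cc_mul; [exact: cont_eiq|split; [exact: smooth_cont|exists L1]].
  - by apply: cc_mul; [exact: cont_eiq|split; [exact: smooth_cont|exists (2 * j.+1%:R)]].
  congr riemann_integral; apply/funext => z; rewrite -scalerBr; congr (_ *: _).
  by have := congr1 (fun f => f z) EW.
apply: le_lt_trans (ler_wpM2l c0 HW) _.
have : d * (2 * (c * C + 1)) = e by rewrite /d divfK // mulf_neq0 // lt0r_neq0 // ltr_pwDr.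
move=> Ee; have -> : c * (C * (2 * d)) = d * (2 * (c * C + 1)) - 2 * d by ring.
by rewrite Ee gtrBl mulr_gt0.
Qed.

(** The exponent m + r |s| on w is an order 2 m and a type - 2 r, which exceeds -1. This provides
    both the symbol class and the regularizing sequence that [is_oscint] asks for. *)
Lemma growth_symbol r (F : 'cV[R]_(n + n) -> V) : 0 <= r -> r < 2^-1 -> growth Q r F ->
  exists m rho, [/\ admissible_type Q rho, symbol Q m rho F &
    regularization Q m rho F (fun j (z : 'cV[R]_(n + n)) => (cut j z : R[i]) *: F z)].
Proof.
move=> r0 r1 gF; have [sF _] := gF.
have Hm q : exists m : R, Q q -> 0 <= m /\ forall K, exists2 C : R, 0 <= C &
    forall s z, (size s <= K)%N -> q (partials s F z) <= C * wt z `^ (m + r * (size s)%:R).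
  have [Hq|nq] := pselect (Q q); last by exists 0.
  by have [m m0 H] := growth_unif gF Hq; exists m.
have [m1 Hm1] := choice Hm; pose m q := 2 * m1 q; pose rho (q : V -> R) := - (2 * r).
have adm : admissible_type Q rho by move=> q _; rewrite /rho; split; lra.
exists m, rho; split => //.
  split=> // q mu Hq; have [m10 H] := Hm1 q Hq; have [s ss Hs] := @midx_partials R V (n + n) mu.
  have [C C0 HC] := H (size s).
  apply: (@le_lt_trans _ _ C%:E); last exact: ltry.
  apply: symbol_norm_le => z; rewrite Hs; apply: le_trans (HC s z (leqnn _)) _.
  apply: ler_wpM2l => //; apply: wtp_mono; rewrite -ss /m /rho.
  by rewrite le_eqVlt; apply/orP; left; apply/eqP; field.
have tX j : test_function (fun z => (cut j z : R[i]) *: F z).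
  apply: (@supp_le_test _ _ _ _ (2 * j.+1%:R)); first by apply: (smooth_mul hV) => //; exact: smooth_cut.
  by apply: supp_le_mull; exact: supp_cut.
(* One more unit of order is a factor w^(1/2), which [cut_bound] turns into convergence at the rate
   1/j; the type need not be lowered. *)
split => //; exists (fun q => m q + 1), rho; split.
  by move=> q Hq; rewrite /rho; split; rewrite ?lexx //; [rewrite ltrDl|lra].
move=> q mu Hq; have [m10 H] := Hm1 q Hq; have [s ss Hs] := @midx_partials R V (n + n) mu.
have qs := Qsn Qdef Hq.
have [B B0 HB] := H (size s); have [B' B'0 HB'] := @cut_bound R (n + n) (size s).
pose D := 2 ^+ size s * (B' * B).
have D0 : 0 <= D by rewrite mulr_ge0 ?exprn_ge0 // mulr_ge0.
apply: (@squeeze_cvge _ _ _ _ (fun=> 0%E) _ (fun j : nat => (D / j.+1%:R)%:E)); last 2 first.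
- exact: cvg_cst.
- have -> : (0 : \bar R) = (D * 0)%:E by rewrite mulr0.
  apply: cvg_EFin; first by apply: filterE.
  by apply: cvgM; [exact: cvg_cst|exact: cvg_harmonic].
apply: filterE => j; rewrite symbol_norm_ge0 //=; apply: symbol_norm_le => z; rewrite Hs.
have s1X : smooth (fun z : 'cV[R]_(n + n) => one_ z - cut j z : R[i]^o).
  by apply: (smooth_B hausC); [exact: smooth_one|exact: smooth_cut].
have sF2 := smooth_mul hV s1X sF.
have -> : (fun x => (cut j x : R[i]) *: F x - F x) = (fun x => (-1) *: (((one_ x - cut j x : R[i]^o) : R[i]) *: F x)).
  by apply/funext => x; rewrite scaleN1r scalerBl scale1r opprB.
rewrite (partials_Z hV _ _ sF2) scaleN1r (snN qs).
have := @leibniz_bound _ V Q Qdef hV _ q s _ F z (B' / j.+1%:R * wt z `^ 2^-1) (B * wt z `^ (m1 q + r * (size s)%:R)) Hq s1X sF.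
rewrite !mulr_ge0 ?invr_ge0 ?wtp_ge0 // => /(_ isT isT) Hl.
have {}Hl := Hl (fun t ts => HB' t j z ts).
apply: le_trans (Hl _) _ => [t ts|].
  apply: le_trans (HB t z ts) _; apply: ler_wpM2l => //; apply: wtp_mono.
  by rewrite lerD2l ler_wpM2l // ler_nat.
rewrite /D -ss le_eqVlt; apply/orP; left; apply/eqP.
have -> : (m q + 1 - rho q * (size s)%:R) / 2 = 2^-1 + (m1 q + r * (size s)%:R) by rewrite /m /rho; field.
by rewrite (wtpD z 2^-1); ring.
Qed.

(** Every regularizing sequence, for any order and type, has the same limit as the standard cutoffs,
    so the value chosen by [oscint] is that limit. From here on only the cutoffs are used. *)
Lemma oscint_cvg r (F : 'cV[R]_(n + n) -> V) : 0 <= r -> r < 2^-1 -> growth Q r F ->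
  osc0 M (fun z => (cut j z : R[i]) *: F z) @[j --> \oo] --> oscint Q M F.
Proof.
move=> r0 r1 gF; have [v Hv] := osc_lim Qdef hV complV unitPM r0 r1 gF.
have {}Hv : osc0 M (fun z => (cut j z : R[i]) *: F z) @[j --> \oo] --> oscc *: v.
  by under eq_fun do rewrite osc0E; exact: cvgV_scalec.
have HG m rho G : regularization Q m rho F G -> osc0 M (G j) @[j --> \oo] --> oscc *: v.
  move=> HG; rewrite -[oscc *: v]add0r; apply: (cvg_eqn _ (cvgV_add (regularization_cut r0 r1 gF HG) Hv)); by apply: filterE => j; rewrite subrK.
have [m [rho [adm sym reg]]] := growth_symbol r0 r1 gF.
have is_v : is_oscint Q M F (oscc *: v).
  exists m, rho; split => //; first by exists (fun j z => (cut j z : R[i]) *: F z).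
  by move=> G; exact: HG.
have -> // : oscint Q M F = oscc *: v.
apply: xget_unique => // w [m' [rho' [_ _ [G regG] HGw]]].
exact: (cvg_unV hV (HGw G regG) (HG _ _ _ regG)).
Qed.

End Oscint.

(** * Growth of the orbits of the actions *)

(** Unlike a given defining system, the set of all continuous seminorms is stable under composition
    with continuous linear maps such as nu(a, .), as the successive bounds below require. *)
Definition csn (R : realType) (V : tvsType R[i]) : set (V -> R) := [set p | seminorm p /\ continuous p].
Arguments csn {R} V.

Section ContinuousSeminorms.
Context {R : realType}.

Lemma csn_comp (V W : tvsType R[i]) (T : V -> W) p : linear T -> continuous T -> csn W p -> csn V (p \o T).
Proof.
move=> HT cT [[p1 p2] cp]; split; last by move=> v; apply: (cvg_comp _ p (cT v)); exact: cp.
by split=> [v w|a v] /=; [rewrite (linTD HT)|rewrite (linTZ HT)].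
Qed.

Variables (V : tvsType R[i]) (Q : set (V -> R)).
Hypothesis Qdef : defining_system Q.

Lemma csn_Q q : Q q -> csn V q.
Proof. by case: Qdef => H _ /H. Qed.

Lemma csn_def : defining_system (csn V).
Proof.
split=> // U /(proj2 Qdef) [k [s [e [e0 Hs HU]]]]; exists k, s, e; split=> // i.
exact: csn_Q.
Qed.

Lemma csn_sum k (s : 'I_k -> V -> R) c : 0 <= c -> (forall i, csn V (s i)) -> csn V (fun v => c * \sum_i s i v).
Proof.
move=> c0 Hs; split; first split=> [v w|a v].
- rewrite -mulrDr -big_split; apply: ler_wpM2l => //; apply: ler_sum => i _ /=.
  by have [Hi _] := Hs i; exact: snD.
- have -> : c * \sum_i s i (a *: v) = ComplexField.Normc.normc a * (c * \sum_i s i v).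
    rewrite mulrCA; congr (_ * _); rewrite mulr_sumr; apply: eq_bigr => i _.
    by have [Hi _] := Hs i; exact: snZ.
  by rewrite rmorphM normcE_norm.
- move=> v; apply: (@cvgM _ _ _ (nbhs_filter v)); first exact: cst_continuous.
  by apply: (@cvgR_sum R _ _ (nbhs_filter v)) => i; have [_ ci] := Hs i; exact: ci.
Qed.

(** Homogeneity turns a bound on a ball into a domination of seminorms. *)
Lemma sn_dom (p p' : V -> R) e B : seminorm p -> seminorm p' -> 0 < e -> 0 <= B ->
  (forall v, p' v < e -> p v <= B) -> forall v, p v <= B / e * p' v.
Proof.
move=> Hp Hp' e0 B0 H v; apply/ler_addgt0Pr => d d0.
(* As p' v may vanish, v is scaled by e / y with y slightly larger than p' v; the divisor c keeps
   the resulting excess below d. *)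
have p0 := sn_ge0 Hp' v; pose c := B / e + 1; have c0 : 0 < c by rewrite ltr_pwDr // divr_ge0 // ltW.
pose y := p' v + d / c; have y0 : 0 < y by rewrite ltr_wpDl // divr_gt0.
have := H ((e / y)%:C *: v); rewrite (snZr Hp) (snZr Hp') gtr0_norm ?divr_gt0 //.
have -> : e / y * p' v < e.
  by rewrite mulrAC ltr_pdivrMr // ltr_pM2l // ltrDl divr_gt0.
move=> /(_ isT); rewrite mulrAC ler_pdivrMr // mulrC -ler_pdivlMr // mulrAC => H1.
apply: le_trans H1 _; rewrite /y mulrDr lerD2l mulrA ler_pdivrMr // mulrC.
by rewrite ler_pM2l // /c lerDl.
Qed.

Lemma csn_bound p : csn V p -> exists k (s : 'I_k -> V -> R) (C : R), [/\ 0 <= C, forall i, Q (s i) & forall v, p v <= C * \sum_i s i v].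
Proof.
move=> [Hp cp].
have nU : nbhs (0 : V) [set v | p v < 1].
  have cp0 : p x @[x --> (0 : V)] --> p 0 := cp 0; rewrite (sn0 Hp) in cp0.
  move: cp0 => /cvgrPdist_lt/(_ 1 ltr01); apply: filterS => v /=.
  by rewrite sub0r normrN; apply: le_lt_trans; exact: ler_norm.
have [k [s [e [e0 Hs HU]]]] := (proj2 Qdef) _ nU.
have ss : seminorm (fun v => \sum_i s i v).
  have [H _] := @csn_sum k s 1 ler01 (fun i => csn_Q (Hs i)).
  by move: H; congr seminorm; apply/funext => v; rewrite mul1r.
exists k, s, (1 / e); split=> //; first by rewrite divr_ge0 // ltW.
apply: (sn_dom Hp ss e0 ler01) => v Hv; apply/ltW/HU => i; apply: le_lt_trans Hv.
by rewrite (bigD1 i) //= lerDl sumr_ge0 // => j _; exact: (sn_ge0 (Qsn Qdef (Hs j))).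
Qed.

End ContinuousSeminorms.

(** * Interpolation of growth exponents between derivatives *)

Section Interpolation.
Context {R : realType} (V : tvsType R[i]) (Q : set (V -> R)).
Hypothesis Qdef : defining_system Q.
Variable N : nat.
Variables (q : V -> R) (Hq : Q q).
Let Hs := Qsn Qdef Hq.
Local Notation e_ i := (delta_mx i 0 : 'cV[R]_N).

Definition ord_le (F : 'cV[R]_N -> V) (e : R) := exists2 C : R, 0 <= C & forall z, q (F z) <= C * wt z `^ e.

Lemma ord_leW F e e' : e <= e' -> ord_le F e -> ord_le F e'.
Proof.
move=> ee [C C0 H]; exists C => // z; apply: le_trans (H z) _.
by apply: ler_wpM2l => //; exact: wtp_mono.
Qed.

Lemma wt_line (x : 'cV[R]_N) i t : `|t| <= 1 -> wt (x + t *: e_ i) <= 4 * wt x.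
Proof.
move=> t1; apply: le_trans (wtD _ _) _.
have : wt (t *: e_ i) <= 2.
  rewrite /wt /sqnorm (bigD1 i) //= big1 => [|j ji]; rewrite mxE e_E.
    by rewrite eqxx mulr1 addr0 -real_normK ?num_real //; have := normr_ge0 t; nra.
  by rewrite eq_sym (negbTE ji) mulr0 expr0n.
by have := wt_ge1 x; nra.
Qed.

(* Taylor's formula at order two with the step h = w^(-(e' - e) / 2), which balances
   the two terms of the bound. *)
Lemma landau i f0 f1 f2 e e' : 0 <= e -> e <= e' ->
  (forall x, pd i f0 x (f1 x)) -> (forall x, pd i f1 x (f2 x)) ->
  ord_le f0 e -> ord_le f2 e' -> ord_le f1 ((e + e') / 2).
Proof.
move=> e0 ee' d01 d12 [C0 C00 H0] [C2 C20 H2]; have e'0 := le_trans e0 ee'.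
pose D := 4 `^ e'; have D0 : 0 <= D by exact: powR_ge0.
have wl x t a : `|t| <= 1 -> 0 <= a -> a <= e' -> wt (x + t *: e_ i) `^ a <= D * wt x `^ a.
  move=> t1 a0 ae; apply: (@le_trans _ _ ((4 * wt x) `^ a)).
    by apply: ge0_ler_powR; rewrite ?nnegrE ?wt_ge0 ?mulr_ge0 ?wt_ge0 // wt_line.
  rewrite powRM ?wt_ge0 //; apply: ler_wpM2r; first exact: wtp_ge0.
  by apply: ler_powR => //; rewrite ler1n.
exists (C0 * D + C0 + C2 * D); first by rewrite !addr_ge0 // mulr_ge0.
move=> x; pose a := (e' - e) / 2; pose h := wt x `^ (- a).
have a0 : 0 <= a by rewrite divr_ge0 // subr_ge0.
have h0 : 0 < h by exact: wtp_gt0.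
have h1 : h <= 1 by rewrite -(powRr0 (wt x)); apply: wtp_mono; rewrite oppr_le0.
have nh : `|h| = h by exact: gtr0_norm.
have L1 t : `|t| <= `|h| -> q (f1 (x + t *: e_ i) - f1 x) <= C2 * (D * wt x `^ e') * h.
  rewrite nh => th; apply: (@le_trans _ _ (C2 * (D * wt x `^ e') * `|t|)); last first.
    by apply: ler_wpM2l => //; rewrite !mulr_ge0 // wtp_ge0.
  apply: (line_mvi Qdef Hq d12) => u ut; apply: le_trans (H2 _) _; apply: ler_wpM2l => //.
  by apply: wl => //; exact: le_trans ut (le_trans th h1).
have := line_taylor Qdef Hq d01 L1; rewrite nh => T.
have A1 : q (f0 (x + h *: e_ i)) <= C0 * (D * wt x `^ e).
  by apply: le_trans (H0 _) _; apply: ler_wpM2l => //; apply: wl => //; rewrite nh.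
have A2 := H0 x.
have A3 : h * q (f1 x) <= C0 * (D * wt x `^ e) + C0 * wt x `^ e + C2 * (D * wt x `^ e') * h * h.
  have -> : h * q (f1 x) = q (h%:C *: f1 x) by rewrite (snZr Hs) nh.
  have -> : h%:C *: f1 x = (f0 (x + h *: e_ i) - f0 x) - (f0 (x + h *: e_ i) - f0 x - h%:C *: f1 x).
    by rewrite opprB addrC subrK.
  apply: le_trans (snB Hs _ _) _; apply: lerD => //.
  by apply: le_trans (snB Hs _ _) _; exact: lerD.
have E1 : wt x `^ e = h * wt x `^ ((e + e') / 2).
  by rewrite /h -wtpD; congr (_ `^ _); rewrite /a; field.
have E2 : wt x `^ e' * h = wt x `^ ((e + e') / 2).
  by rewrite /h -wtpD; congr (_ `^ _); rewrite /a; field.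
rewrite -(ler_pM2l h0); apply: le_trans A3 _.
have -> : C2 * (D * wt x `^ e') * h * h = C2 * D * (wt x `^ e' * h) * h by ring.
rewrite E2 E1 le_eqVlt; apply/orP; left; apply/eqP; ring.
Qed.

(* If lam is admissible for all the chains, then so is lam - lam^2 / 2, by applying lam
   twice and then [landau]; hence the values 2 / (m + 2). *)
Lemma interp_chain m : forall i (f : nat -> 'cV[R]_N -> V) k g, 0 <= k -> k <= g ->
  (forall j x, pd i (f j) x (f j.+1 x)) -> ord_le (f 0%N) k -> (forall j, ord_le (f j) g) ->
  ord_le (f 1%N) (k + 2 / m.+2%:R * (g - k)).
Proof.
elim: m => [|m IH] i f k g k0 kg df f0 fg.
  by have -> : k + 2 / 2%:R * (g - k) = g by field.
have m2 : 0 < (m.+2%:R : R) by rewrite ltr0n.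
have m3 : 0 < (m.+3%:R : R) by rewrite ltr0n.
have f1 := IH i f k g k0 kg df f0 fg.
set lam := 2 / m.+2%:R in f1.
have lam0 : 0 <= lam by rewrite divr_ge0.
have lam1 : lam <= 1 by rewrite ler_pdivrMr // mul1r ler_nat.
pose k1 := k + lam * (g - k).
have gk : 0 <= g - k by rewrite subr_ge0.
have k1g : k1 <= g by rewrite /k1 -lerBrDl ler_piMl.
have kk1 : k <= k1 by rewrite lerDl mulr_ge0.
have f2 := IH i (fun j => f j.+1) k1 g (le_trans k0 kk1) k1g (fun j => df j.+1) f1 (fun j => fg j.+1).
have le2 : k <= k1 + lam * (g - k1) by rewrite (le_trans kk1) // lerDl mulr_ge0 // subr_ge0.
apply: ord_leW (landau k0 le2 (df 0%N) (df 1%N) f0 f2).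
rewrite -/lam /k1.
have -> : (k + (k + lam * (g - k) + lam * (g - (k + lam * (g - k))))) / 2 = k + (lam - lam ^+ 2 / 2) * (g - k) by field.
rewrite lerD2l; apply: ler_wpM2r => //; rewrite /lam ler_pdivlMr //.
have -> : m.+3%:R = m.+2%:R + 1 :> R by rewrite -natr1.
rewrite -subr_ge0; have -> : 2 - (2 / m.+2%:R - (2 / m.+2%:R) ^+ 2 / 2) * (m.+2%:R + 1) = 2 / m.+2%:R ^+ 2 :> R.
  by field; rewrite lt0r_neq0.
by rewrite divr_ge0 // exprn_ge0.
Qed.

(** One letter at a time: the pure derivatives in direction i of f s form a chain that starts with
    the exponent already reached and is bounded by g throughout, so [interp_chain] gains a
    derivative at a cost below r. The bound g does not appear in the resulting exponent. *)
Lemma interp n (dir : 'I_n -> 'I_N) (f : seq 'I_n -> 'cV[R]_N -> V) k g r : 0 <= k -> 0 < r ->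
  (forall i s x, pd (dir i) (f s) x (f (i :: s) x)) ->
  ord_le (f [::]) k -> (forall s, ord_le (f s) g) -> forall s, ord_le (f s) (k + r * (size s)%:R).
Proof.
move=> k0 r0 df f0 fg; elim=> [|i s IH]; first by rewrite mulr0 addr0.
set k1 := k + _ in IH; have k10 : 0 <= k1 by rewrite addr_ge0 // mulr_ge0 // ltW.
pose g1 := Num.max g k1.
have kg : k1 <= g1 by rewrite le_max lexx orbT.
pose fj j := f (nseq j i ++ s).
have H m := @interp_chain m (dir i) fj k1 g1 k10 kg (fun j => df i (nseq j i ++ s)) IH
  (fun j => ord_leW (ltac:(by rewrite le_max lexx) : g <= g1) (fg _)).
(* Makes the excess 2 (g1 - k1) / (m + 2) of [interp_chain] at most r. *)
pose m := Num.truncn (2 * (g1 - k1) / r).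
have -> : k + r * (size (i :: s))%:R = k1 + r by rewrite /k1 -[size (i :: s)]/((size s).+1) -natr1 mulrDr mulr1 addrA.
apply: ord_leW (H m); rewrite lerD2l.
have := truncnS_gt (2 * (g1 - k1) / r); rewrite -/m ltr_pdivrMr // => Hm.
rewrite mulrAC ler_pdivrMr ?ltr0n //; apply: le_trans (ltW Hm) _; rewrite mulrC.
by apply: ler_wpM2l; [exact: ltW|rewrite ler_nat].
Qed.

End Interpolation.

(** * Mixed derivatives of functions of three slots *)

Section Slots.
Context {R : realType} (V : tvsType R[i]) (Q : set (V -> R)).
Hypothesis Qdef : defining_system Q.
Hypothesis hV : hausdorff_space V.
Variable n : nat.
Local Notation N := (n + (n + n))%N.
Variable Psi : seq 'I_n -> seq 'I_n -> seq 'I_n -> 'cV[R]_N -> V.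
Hypothesis Pcont : forall s t l, continuous (Psi s t l).
Hypothesis pd1 : forall i s t l x, pd (lshift (n + n) i) (Psi s t l) x (Psi (i :: s) t l x).
Hypothesis pd2 : forall i s t l x, pd (rshift n (lshift n i)) (Psi s t l) x (Psi s (i :: t) l x).
Hypothesis pd3 : forall i s t l x, pd (rshift n (rshift n i)) (Psi s t l) x (Psi s t (i :: l) x).
Hypothesis b1 : forall q, Q q -> forall t l, exists2 g : R, 0 <= g & forall s, ord_le q (Psi s t l) g.
Hypothesis b2 : forall q, Q q -> forall s l, exists2 g : R, 0 <= g & forall t, ord_le q (Psi s t l) g.
Hypothesis b3 : forall q, Q q -> forall s t, exists2 g : R, 0 <= g & forall l, ord_le q (Psi s t l) g.

Lemma slot_pd (i : 'I_N) s t l : exists s' t' l',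
  (forall x, pd i (Psi s t l) x (Psi s' t' l' x)) /\ (size s' + size t' + size l' = (size s + size t + size l).+1)%N.
Proof.
have [j ->|j ->] := split_ordP i; last have [k ->|k ->] := split_ordP j.
- by exists (j :: s), t, l; split=> [x|]; [exact: pd1|rewrite /= !addSn].
- by exists s, (k :: t), l; split=> [x|]; [exact: pd2|rewrite /= addnS addSn].
- by exists s, t, (k :: l); split=> [x|]; [exact: pd3|rewrite /= addnS].
Qed.

(** In each slot the exponent bounding all derivatives depends in an unknown way on the derivatives
    taken in the other two. The first slot gives a starting exponent k valid for all s;
    interpolation in the second slot, then in the third, keeps k and forgets the unknown exponents,
    which affect only the constants. *)
Lemma slot_growth r : 0 < r -> growth Q r (Psi [::] [::] [::]).
Proof.
move=> r0; split.
  apply: (lspan_smooth hV (B := [set G | exists s t l, G = Psi s t l])); last by apply: lspan_base; exists [::], [::], [::].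
    by move=> _ [s [t [l ->]]]; exact: Pcont.
  move=> _ i [s [t [l ->]]]; have [s' [t' [l' [H _]]]] := slot_pd i s t l.
  by exists (Psi s' t' l') => //; apply: lspan_base; exists s', t', l'.
move=> q Hq; have [k k0 Hk] := b1 Hq [::] [::]; exists k => //.
have H1 s t : ord_le q (Psi s t [::]) (k + r * (size t)%:R).
  have [g g0 Hg] := b2 Hq s [::].
  exact: (interp Qdef Hq k0 r0 (fun i t x => @pd2 i s t [::] x) (Hk s) Hg).
have H2 s t l : ord_le q (Psi s t l) (k + r * (size s + size t + size l)%:R).
  have [g g0 Hg] := b3 Hq s t.
  have k1 : 0 <= k + r * (size t)%:R by rewrite addr_ge0 // mulr_ge0 // ltW.
  apply: ord_leW (interp Qdef Hq k1 r0 (fun i l x => @pd3 i s t l x) (H1 s t) Hg l).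
  by rewrite -addrA lerD2l -mulrDr; apply: ler_wpM2l; [exact: ltW|rewrite -natrD ler_nat -addnA leq_addl].
move=> S; have [s [t [l [-> <-]]]] : exists s t l, partials S (Psi [::] [::] [::]) = Psi s t l /\ (size s + size t + size l = size S)%N.
  elim: S => [|i S [s [t [l [E ss]]]]]; first by exists [::], [::], [::].
  have [s' [t' [l' [H ss']]]] := slot_pd i s t l; exists s', t', l'; split; last by rewrite ss' ss.
  by rewrite /= E; apply: (pd_fun hV).
exact: H2.
Qed.

End Slots.

Section GrowthAffine.
Context {R : realType} (V : tvsType R[i]) (Q : set (V -> R)).
Hypothesis Qdef : defining_system Q.
Hypothesis hV : hausdorff_space V.

Lemma partials_sum N (I : Type) (rr : seq I) (c : I -> R[i]) (G : I -> 'cV[R]_N -> V) s : (forall j, smooth (G j)) ->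
  smooth (fun y => \sum_(j <- rr) c j *: G j y) /\
  partials s (fun y => \sum_(j <- rr) c j *: G j y) = (fun y => \sum_(j <- rr) c j *: partials s (G j) y).
Proof.
move=> sG; elim: rr => [|j rr [IH1 IH2]].
  under eq_fun do rewrite big_nil; split; first exact: (smooth_cst hV).
  have -> : (fun y => \sum_(j <- [::]) c j *: partials s (G j) y) = fun=> 0 by apply/funext => y; rewrite big_nil.
  elim: s => [//|i s /= ->]; apply: (pd_fun hV) => x; exact: pd_cst.
have -> : (fun y => \sum_(l <- j :: rr) c l *: G l y) = (fun y => c j *: G j y + \sum_(l <- rr) c l *: G l y).
  by apply/funext => y; rewrite big_cons.
have sZ := smooth_Z hV (c j) (sG j); split; first exact: smooth_D.
rewrite (partials_D hV _ sZ IH1) (partials_Z hV _ _ (sG j)) IH2.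
by apply/funext => y; rewrite big_cons.
Qed.

(** By the chain rule each derivative is a combination of first derivatives of F, whose growth has m
    + r in place of m; hence the induction generalises both F and m. *)
Lemma growth_mul N N' (A : 'M[R]_(N, N')) r (F : 'cV[R]_N -> V) : 0 <= r ->
  growth Q r F -> growth Q r (fun y : 'cV[R]_N' => F (A *m y)).
Proof.
move=> r0 [sF HF].
have E (G : 'cV[R]_N -> V) : (fun y : 'cV[R]_N' => G (A *m y)) = (fun y => G (0 + A *m y)).
  by apply/funext => y; rewrite add0r.
split; first by rewrite E; exact: (smooth_aff Qdef hV).
move=> q Hq; have Hs := Qsn Qdef Hq; have [m m0 Hm] := HF q Hq; exists m => // s.
elim/last_ind: s F sF {HF} m m0 Hm => [|s i IH] F sF m m0 Hm.
  have [C C0 HC] := Hm [::]; rewrite mulr0 addr0 in HC *.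
  have [D D0 HD] := wtp_lin A m0; exists (C * D) => [|z]; first exact: mulr_ge0.
  by apply: le_trans (HC _) _; rewrite -mulrA; apply: ler_wpM2l.
rewrite size_rcons partials_rcons E (partial_aff Qdef hV _ _ _ sF).
have sG j : smooth (fun y : 'cV[R]_N' => partial j F (A *m y)).
  by rewrite E; apply: (smooth_aff Qdef hV); exact: smooth_partial.
have -> : (fun y => \sum_j (A j i)%:C *: partial j F (0 + A *m y)) = (fun y => \sum_j (A j i)%:C *: partial j F (A *m y)).
  by apply/funext => y; apply: eq_bigr => j _; rewrite add0r.
have [_ ->] := partials_sum (index_enum 'I_N) (fun j => (A j i)%:C) s sG.
have Hj j : exists C : R, 0 <= C /\ forall z, q (partials s (fun y => partial j F (A *m y)) z) <= C * wt z `^ (m + r + r * (size s)%:R).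
  have [t|C C0 HC] := IH (partial j F) (smooth_partial j sF) (m + r) (addr_ge0 m0 r0); last by exists C.
  have [C C0 HC] := Hm (rcons t j); exists C => // z.
  by have := HC z; rewrite size_rcons partials_rcons -natr1 mulrDr mulr1 [_ + r]addrC addrA.
have [C HC] := choice Hj; exists (\sum_j `|A j i| * C j).
  by apply: sumr_ge0 => j _; rewrite mulr_ge0 //; have [] := HC j.
move=> z; apply: le_trans (sn_sum Hs _ _ _) _; rewrite mulr_suml; apply: ler_sum => j _.
rewrite (snZr Hs) -mulrA; apply: ler_wpM2l => //; have [_ H] := HC j.
by rewrite -natr1 mulrDr mulr1 [_ + r]addrC addrA; exact: H.
Qed.

Lemma delta_rshift N1 N2 (i : 'I_N2) : delta_mx (rshift N1 i) 0 = col_mx 0 (delta_mx i 0) :> 'cV[R]_(N1 + N2).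
Proof.
apply/colP => k; have [j ->|j ->] := split_ordP k; rewrite ?col_mxEu ?col_mxEd !mxE ?eq_lrshift ?eq_rshift //.
Qed.

Lemma delta_lshift N1 N2 (i : 'I_N1) : delta_mx (lshift N2 i) 0 = col_mx (delta_mx i 0) 0 :> 'cV[R]_(N1 + N2).
Proof.
apply/colP => k; have [j ->|j ->] := split_ordP k; rewrite ?col_mxEu ?col_mxEd !mxE ?eq_rlshift ?eq_lshift //.
Qed.

Lemma partials_col N1 N2 s (F : 'cV[R]_(N1 + N2) -> V) (y : 'cV[R]_N1) :
  partials s (fun z : 'cV[R]_N2 => F (col_mx y z)) = (fun z => partials (map (@rshift N1 N2) s) F (col_mx y z)).
Proof.
elim: s => [//|i s IH] /=; rewrite IH; apply/funext => z; rewrite /partial.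
have -> // : diff_quotient i (fun z => partials (map (@rshift N1 N2) s) F (col_mx y z)) z =
  diff_quotient (rshift N1 i) (partials (map (@rshift N1 N2) s) F) (col_mx y z).
apply/funext => h; rewrite /diff_quotient delta_rshift scale_col_mx scaler0 add_col_mx addr0 //.
Qed.

End GrowthAffine.

Section LinearContinuity.
Context {R : realType} (V W : tvsType R[i]) (Q : set (W -> R)).
Hypothesis Qdef : defining_system Q.

Lemma csn_cont (p : V -> R) v e : csn V p -> 0 < e -> \forall w \near v, p (w - v) < e.
Proof.
move=> [Hp cp] e0; have cv : (w - v) @[w --> v] --> v - v.
  exact: (cvgV_sub (@cvg_id _ (nbhs v)) (cvg_cst v)).
have cpv : p (w - v) @[w --> v] --> p (v - v) by apply: (cvg_comp _ p cv); exact: cp.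
rewrite subrr (sn0 Hp) in cpv.
move: cpv => /cvgrPdist_lt/(_ e e0); apply: filterS => w /=.
by rewrite sub0r normrN; apply: le_lt_trans; exact: ler_norm.
Qed.

Lemma lin_cont (T : V -> W) : linear T ->
  (forall q, Q q -> exists2 p, csn V p & forall v, q (T v) <= p v) -> continuous T.
Proof.
move=> HT H v; apply/(@cvgQ_lt _ _ _ Qdef _ _ (nbhs_filter v)) => q e Hq e0.
have [p Hp Hqp] := H q Hq; have := csn_cont v Hp e0; apply: filterS => w Hw.
by rewrite -(linTB HT); apply: le_lt_trans (Hqp _) Hw.
Qed.

End LinearContinuity.

Section Action.
Context {R : realType} (n : nat) (V : tvsType R[i]) (Q : set (V -> R)).
Hypothesis Qdef : defining_system Q.
Hypothesis hV : hausdorff_space V.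
Variables (m : (V -> R) -> R) (beta : 'cV[R]_n -> V -> V).
Hypothesis act : smooth_poly_bounded_action Q m beta.
Local Notation e_ i := (delta_mx i 0 : 'cV[R]_n).

Lemma act_lin x : linear (beta x).
Proof. by case: act => [[]]. Qed.

Lemma actD x y v : beta (x + y) v = beta x (beta y v).
Proof. by case: act => [[]]. Qed.

Lemma actN x y v : beta y v = beta x (beta (y - x) v).
Proof. by rewrite -actD addrC subrK. Qed.

Lemma act_smooth v : smooth (beta ^~ v).
Proof. by case: act => [_ [/(_ v) []]]. Qed.

(** Continuity of the orbit map at 0, read on the undifferentiated symbol seminorm, controls all x
    at once on a neighbourhood of 0; [sn_dom] makes it homogeneous in v. *)
Lemma act_boundQ q : Q q -> exists2 k : R, 0 <= k & exists2 p, csn V p & forall x v, q (beta x v) <= wt x `^ k * p v.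
Proof.
move=> Hq; have Hs := Qsn Qdef Hq; have [mu mu0 Hmu] := @midx_zero R V n.
have nU : nbhs (0 : V) [set w | forall x, q (beta x w) <= wt x `^ (m q / 2)].
  case: act => _ [_ /(_ 0 q mu 1 Hq ltr01)]; apply: filterS => w /ltW /symbol_norm_ge H x.
  by have := H x; rewrite Hmu mu0 mulr0 subr0 mul1r (linT0 (act_lin x)) subr0.
have [k [s [e [e0 Hsi HU]]]] := (proj2 Qdef) _ nU.
have Hp := csn_sum ler01 (fun i => csn_Q Qdef (Hsi i)).
exists (`|m q| / 2); first by rewrite divr_ge0.
have e1 : 0 <= 1 / e by rewrite divr_ge0 // ltW.
exists (fun v => 1 / e * \sum_i s i v); first exact: (csn_sum e1 (fun i => csn_Q Qdef (Hsi i))).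
move=> x v; pose p v := 1 * \sum_i s i v.
have W0 := wtp_ge0 x (m q / 2).
have sb : seminorm (fun v => q (beta x v)).
  by split=> [v1 v2|a v1]; [rewrite (linTD (act_lin x)) snD|rewrite (linTZ (act_lin x)); case: Hs => _ ->].
have := sn_dom sb (proj1 Hp) e0 W0; rewrite /= => H.
apply: le_trans (H _ v) _ => [w Hw|].
  apply: HU => i; apply: le_lt_trans Hw; rewrite mul1r (bigD1 i) //= lerDl sumr_ge0 // => j _.
  exact: (sn_ge0 (Qsn Qdef (Hsi j))).
rewrite !mul1r -mulrA; apply: ler_wpM2r.
  by rewrite mulr_ge0 ?invr_ge0 ?(ltW e0) // sumr_ge0 // => j _; exact: (sn_ge0 (Qsn Qdef (Hsi j))).
apply: wtp_mono; apply: ler_wpM2r; last exact: ler_norm.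
by rewrite invr_ge0.
Qed.

Lemma act_bound q : csn V q -> exists2 k : R, 0 <= k & exists2 p, csn V p & forall x v, q (beta x v) <= wt x `^ k * p v.
Proof.
move=> Hq; have [l [s [C [C0 Hs HC]]]] := csn_bound Qdef Hq.
have Hi i : exists kp : R * (V -> R), [/\ 0 <= kp.1, csn V kp.2 & forall x v, s i (beta x v) <= wt x `^ kp.1 * kp.2 v].
  by have [k k0 [p Hp H]] := act_boundQ (Hs i); exists (k, p).
have [f Hf] := choice Hi.
exists (\sum_i (f i).1); first by apply: sumr_ge0 => i _; have [] := Hf i.
exists (fun v => C * \sum_i (f i).2 v); first by apply: csn_sum => // i; have [] := Hf i.
move=> x v; apply: le_trans (HC _) _; rewrite mulrCA; apply: ler_wpM2l => //.
rewrite mulr_sumr; apply: ler_sum => i _; have [f0 Hp H] := Hf i.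
apply: le_trans (H x v) _; apply: ler_wpM2r; first exact: (sn_ge0 (proj1 Hp)).
apply: wtp_mono; rewrite (bigD1 i) //= lerDl; apply: sumr_ge0 => j _; by have [] := Hf j.
Qed.

Lemma act_cont x : continuous (beta x).
Proof.
apply: (lin_cont (csn_def Qdef) (act_lin x)) => q Hq.
have [k k0 [p Hp H]] := act_bound Hq.
exists (fun v => wt x `^ k * \sum_(i < 1) p v); first exact: (csn_sum (wtp_ge0 x k) (fun=> Hp)).
by move=> v; rewrite big_ord1.
Qed.

(** The infinitesimal generators of the action. Differentiating an orbit replaces v by [gen i v], so
    the derivatives of the integrands are integrands of the same form with other elements. *)
Definition gen (i : 'I_n) (v : V) : V := partial i (beta ^~ v) 0.
Definition gens (s : seq 'I_n) (v : V) : V := foldr gen v s.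

Lemma pd_act i v x : pd i (beta ^~ v) x (beta x (gen i v)).
Proof.
have H0 : pd i (beta ^~ v) 0 (gen i v) := smooth_pd hV (i := i) (x := 0) (act_smooth v).
apply: (cvg_eqn _ (cvg_lin (act_cont (x := x)) H0)); apply: filterE => h.
by rewrite /diff_quotient (linTZ (act_lin x)) (linTB (act_lin x)) -!actD add0r addr0.
Qed.

(** T gathers the factors that do not depend on the coordinate d; being linear and continuous, it
    commutes with the derivative of the orbit. *)
Lemma pd_slot (W : tvsType R[i]) N (d : 'I_N) i (x : 'cV[R]_N -> 'cV[R]_n) (T : 'cV[R]_N -> V -> W) v z :
  (forall z (h : R), x (z + h *: delta_mx d 0) = x z + h *: e_ i) ->
  (forall z (h : R) v, T (z + h *: delta_mx d 0) v = T z v) ->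
  linear (T z) -> continuous (T z) ->
  pd d (fun z => T z (beta (x z) v)) z (T z (beta (x z) (gen i v))).
Proof.
move=> Hx HT lT cT; apply: (cvg_eqn _ (cvg_lin cT (@pd_act i v (x z)))); apply: filterE => h.
by rewrite /diff_quotient HT Hx (linTZ lT) (linTB lT).
Qed.

(** Continuity of each orbit together with the bound of [act_bound], uniform for x in bounded sets,
    gives joint continuity. *)
Lemma act_joint N (e : 'cV[R]_N -> V) (L : 'cV[R]_N -> 'cV[R]_n) : continuous e -> continuous L ->
  continuous (fun z => beta (L z) (e z)).
Proof.
move=> ce cL z0; apply/(@cvgQ_lt _ _ _ (csn_def Qdef) _ _ (nbhs_filter z0)) => q d Hq d0.
have [k k0 [p Hp H]] := act_bound Hq.
have d2 : 0 < d / 2 by rewrite divr_gt0.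
(* Bounds w(L z)^k as soon as each coordinate of L z is within 1 of that of L z0. *)
pose B := (2 * (wt (L z0) * (1 + n%:R))) `^ k.
have B0 : 0 <= B by exact: powR_ge0.
have dB : 0 < d / 2 / (B + 1) by rewrite divr_gt0 // ltr_pwDr.
have n1 : \forall z \near z0, q (beta (L z) (e z0) - beta (L z0) (e z0)) < d / 2.
  have c : beta (L z) (e z0) @[z --> z0] --> beta (L z0) (e z0).
    by apply: (cvg_comp _ (beta ^~ (e z0)) (cL z0)); exact: (smooth_cont (act_smooth _)).
  by have /(cvgQ_lt (csn_def Qdef))/(_ q _ Hq d2) := c.
have n2 : \forall z \near z0, p (e z - e z0) < d / 2 / (B + 1).
  have c : e z @[z --> z0] --> e z0 := ce z0.
  by have /(cvgQ_lt (csn_def Qdef))/(_ p _ Hp dB) := c.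
have n3 : \forall z \near z0, forall i, `|L z i 0 - L z0 i 0| < 1.
  have cz : L z @[z --> z0] --> L z0 := cL z0.
  by apply: (cz [set y : 'cV[R]_n | forall i, `|y i 0 - L z0 i 0| < 1]); apply/near_cV; exists 1.
apply: filterS3 n1 n2 n3 => z H1 H2 H3.
apply: le_lt_trans (snD_tri (proj1 Hq) _ (beta (L z) (e z0)) _) _.
rewrite [d]splitr -(linTB (act_lin _)); apply: ler_ltD => //.
apply: le_trans (H _ _) _; apply: (@le_trans _ _ (B * (d / 2 / (B + 1)))).
  apply: ler_pM => //; [exact: wtp_ge0|exact: (sn_ge0 (proj1 Hp))| |exact: ltW].
  apply: ge0_ler_powR; rewrite ?nnegrE ?wt_ge0 ?mulr_ge0 ?wt_ge0 ?addr_ge0 //.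
  have -> : L z = L z0 + (L z - L z0) by rewrite addrC subrK.
  apply: le_trans (wtD _ _) _; rewrite ler_pM2l // ler_pM2l ?wt_gt0 // lerD2l.
  apply: (@le_trans _ _ (\sum_(i < n) 1)); last by rewrite sumr_const card_ord.
  apply: ler_sum => i _; rewrite !mxE -real_normK ?num_real //.
  by apply: exprn_ile1 => //; apply: ltW.
rewrite mulrCA ger_pMr // ler_pdivrMr ?ltr_pwDr // mul1r.
by rewrite lerDl.
Qed.

Definition pb N (f : 'cV[R]_N -> R) (g : R) := exists2 C : R, 0 <= C & forall z, f z <= C * wt z `^ g.

(** The bound satisfied by the differences of two slots, by [wtD]. *)
Definition adm N (x : 'cV[R]_N -> 'cV[R]_n) := forall z, wt (x z) <= 2 * (wt z * wt z).

(** The increment k and the seminorm p depend on q alone, not on e or g. Iterated, this gives an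
    exponent that is independent of the innermost element. The weight of x z is at most quadratic in
    that of z, whence twice the exponent of [act_bound]. *)
Lemma act_step q : csn V q -> exists2 k : R, 0 <= k & exists2 p, csn V p &
  forall N (x : 'cV[R]_N -> 'cV[R]_n) (e : 'cV[R]_N -> V) g, adm x -> pb (fun z => p (e z)) g ->
    pb (fun z => q (beta (x z) (e z))) (g + k).
Proof.
move=> Hq; have [k k0 [p Hp H]] := act_bound Hq.
exists (k + k); first exact: addr_ge0.
exists p => // N x e g Hx [C C0 HC]; exists (2 `^ k * C); first by rewrite mulr_ge0 // powR_ge0.
move=> z; apply: le_trans (H _ _) _; rewrite !wtpD.
have -> : 2 `^ k * C * (wt z `^ g * (wt z `^ k * wt z `^ k)) = (2 `^ k * (wt z `^ k * wt z `^ k)) * (C * wt z `^ g) by ring.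
apply: ler_pM => //; [exact: wtp_ge0|exact: (sn_ge0 (proj1 Hp))|].
rewrite -!powRM ?mulr_ge0 ?wt_ge0 //.
by apply: ge0_ler_powR; rewrite ?nnegrE ?mulr_ge0 ?wt_ge0.
Qed.

End Action.

Section ThreeSlots.
Context {R : realType} {n : nat}.
Local Notation N := (n + (n + n))%N.
Local Notation e_ i := (delta_mx i 0 : 'cV[R]_n).
Implicit Types z : 'cV[R]_N.

Definition su z : 'cV[R]_n := usubmx z.
Definition sv z : 'cV[R]_n := usubmx (dsubmx z).
Definition sw z : 'cV[R]_n := dsubmx (dsubmx z).

Lemma usubDZ N1 N2 (z w : 'cV[R]_(N1 + N2)) h : usubmx (z + h *: w) = usubmx z + h *: usubmx w.
Proof. by apply/colP => i; rewrite !mxE. Qed.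
Lemma dsubDZ N1 N2 (z w : 'cV[R]_(N1 + N2)) h : dsubmx (z + h *: w) = dsubmx z + h *: dsubmx w.
Proof. by apply/colP => i; rewrite !mxE. Qed.

Lemma su1 z i (h : R) : su (z + h *: delta_mx (lshift (n + n) i) 0) = su z + h *: e_ i.
Proof. by rewrite /su usubDZ delta_lshift col_mxKu. Qed.
Lemma sv1 z i (h : R) : sv (z + h *: delta_mx (lshift (n + n) i) 0) = sv z.
Proof. by rewrite /sv dsubDZ delta_lshift col_mxKd scaler0 addr0. Qed.
Lemma sw1 z i (h : R) : sw (z + h *: delta_mx (lshift (n + n) i) 0) = sw z.
Proof. by rewrite /sw dsubDZ delta_lshift col_mxKd scaler0 addr0. Qed.
Lemma su2 z i (h : R) : su (z + h *: delta_mx (rshift n i) 0) = su z.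
Proof. by rewrite /su usubDZ delta_rshift col_mxKu scaler0 addr0. Qed.
Lemma sv2 z i (h : R) : sv (z + h *: delta_mx (rshift n (lshift n i)) 0) = sv z + h *: e_ i.
Proof. by rewrite /sv dsubDZ delta_rshift col_mxKd usubDZ delta_lshift col_mxKu. Qed.
Lemma sw2 z i (h : R) : sw (z + h *: delta_mx (rshift n (lshift n i)) 0) = sw z.
Proof. by rewrite /sw dsubDZ delta_rshift col_mxKd dsubDZ delta_lshift col_mxKd scaler0 addr0. Qed.
Lemma sv3 z i (h : R) : sv (z + h *: delta_mx (rshift n (rshift n i)) 0) = sv z.
Proof. by rewrite /sv dsubDZ delta_rshift col_mxKd usubDZ delta_rshift col_mxKu scaler0 addr0. Qed.
Lemma sw3 z i (h : R) : sw (z + h *: delta_mx (rshift n (rshift n i)) 0) = sw z + h *: e_ i.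
Proof. by rewrite /sw dsubDZ delta_rshift col_mxKd dsubDZ delta_rshift col_mxKd. Qed.

Lemma cont_coords (f : 'cV[R]_N -> 'cV[R]_n) (d : 'I_n -> 'I_N) : (forall z i, f z i 0 = z (d i) 0) -> continuous f.
Proof.
move=> H z; apply: (@cvg_cV _ _ _ _ (nbhs_filter z)) => i; rewrite H; under eq_fun do rewrite H.
exact: (@coord_continuous R N 1 (d i) 0 z).
Qed.

Lemma cont_su : continuous su.
Proof. by apply: (@cont_coords _ (@lshift n (n + n))) => z i; rewrite mxE. Qed.
Lemma cont_sv : continuous sv.
Proof. by apply: (@cont_coords _ (fun i => rshift n (lshift n i))) => z i; rewrite !mxE. Qed.
Lemma cont_sw : continuous sw.
Proof. by apply: (@cont_coords _ (fun i => rshift n (rshift n i))) => z i; rewrite !mxE. Qed.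

Lemma cont_diff (f g : 'cV[R]_N -> 'cV[R]_n) : continuous f -> continuous g -> continuous (fun z => f z - g z).
Proof.
move=> cf cg z; apply: (@cvg_cV _ _ _ _ (nbhs_filter z)) => i.
have -> : (fun t : 'cV[R]_N => (f t - g t) i 0) = (fun t => f t i 0 - g t i 0) by apply/funext => t; rewrite !mxE.
have -> : (f z - g z) i 0 = f z i 0 - g z i 0 by rewrite !mxE.
apply: (@cvgB _ _ _ _ (nbhs_filter z)).
  exact: (@cvg_coord R n _ _ (nbhs_filter z) f (f z) i (cf z)).
exact: (@cvg_coord R n _ _ (nbhs_filter z) g (g z) i (cg z)).
Qed.

Lemma wt_split N1 N2 (z : 'cV[R]_(N1 + N2)) : wt (usubmx z) <= wt z /\ wt (dsubmx z) <= wt z.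
Proof.
have -> : wt z = 1 + sqnorm (usubmx z) + sqnorm (dsubmx z).
  rewrite /wt -addrA; congr (_ + _); rewrite /sqnorm big_split_ord /=; congr (_ + _); apply: eq_bigr => i _; by rewrite !mxE.
by rewrite /wt; have := sqnorm_ge0 (usubmx z); have := sqnorm_ge0 (dsubmx z); move=> h1 h2; split; rewrite ?lerDl // lerD2r lerDl.
Qed.

Lemma wt_su z : wt (su z) <= wt z. Proof. by have [] := wt_split z. Qed.
Lemma wt_sv z : wt (sv z) <= wt z.
Proof. by have [_ H] := wt_split z; have [H' _] := wt_split (dsubmx z); exact: le_trans H' H. Qed.
Lemma wt_sw z : wt (sw z) <= wt z.
Proof. by have [_ H] := wt_split z; have [_ H'] := wt_split (dsubmx z); exact: le_trans H' H. Qed.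

Lemma wtN (N' : nat) (x : 'cV[R]_N') : wt (- x) = wt x.
Proof. by rewrite /wt /sqnorm; congr (_ + _); apply: eq_bigr => i _; rewrite mxE sqrrN. Qed.

Lemma adm_sub (f g : 'cV[R]_N -> 'cV[R]_n) : (forall z, wt (f z) <= wt z) -> (forall z, wt (g z) <= wt z) ->
  adm (fun z => f z - g z).
Proof.
move=> Hf Hg z; apply: le_trans (wtD _ _) _; rewrite ler_pM2l // wtN.
by apply: ler_pM => //; exact: wt_ge0.
Qed.

Lemma adm1 (f : 'cV[R]_N -> 'cV[R]_n) : (forall z, wt (f z) <= wt z) -> adm f.
Proof. by move=> Hf z; apply: le_trans (Hf z) _; have := wt_ge1 z; nra. Qed.

Lemma pb_cst N' (c : R) : pb (fun _ : 'cV[R]_N' => c) 0.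
Proof. by exists `|c| => // z; rewrite powRr0 mulr1 ler_norm. Qed.

End ThreeSlots.

(** * Growth of the integrands, one slot at a time *)

Section ModuleSlots.
Context {R : realType} (n : nat) (A E : tvsType R[i]).
Hypotheses (hausA : hausdorff_space A) (hausE : hausdorff_space E).
Variables (mu : A -> A -> A) (nu : A -> E -> E).
Hypotheses (mu_bilin : bilinear_map mu) (mu_cont : separately_continuous mu).
Hypotheses (nu_bilin : bilinear_map nu) (nu_cont : separately_continuous nu).
Hypothesis nuA : forall a b psi, nu (mu a b) psi = nu a (nu b psi).
Variables (QA : set (A -> R)) (QE : set (E -> R)).
Hypotheses (QA_def : defining_system QA) (QE_def : defining_system QE).
Variables (mA : (A -> R) -> R) (alpha : 'cV[R]_n -> A -> A).
Hypothesis alpha_act : smooth_poly_bounded_action QA mA alpha.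
Hypothesis alpha_aut : acts_multiplicatively mu alpha.
Variables (mE : (E -> R) -> R) (beta : 'cV[R]_n -> E -> E).
Hypothesis beta_act : smooth_poly_bounded_action QE mE beta.
Hypothesis beta_cov : forall x a psi, beta x (nu a psi) = nu (alpha x a) (beta x psi).
Local Notation N := (n + (n + n))%N.
Implicit Types z : 'cV[R]_N.

Let nul a : linear (nu a). Proof. by case: nu_bilin. Qed.
Let nur psi : linear (nu ^~ psi). Proof. by case: nu_bilin. Qed.
Let mul a : linear (mu a). Proof. by case: mu_bilin. Qed.
Let mur a : linear (mu ^~ a). Proof. by case: mu_bilin. Qed.
Let nulc a : continuous (nu a). Proof. by case: nu_cont. Qed.
Let nurc psi : continuous (nu ^~ psi). Proof. by case: nu_cont. Qed.
Let mulc a : continuous (mu a). Proof. by case: mu_cont. Qed.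
Let murc a : continuous (mu ^~ a). Proof. by case: mu_cont. Qed.
Local Notation DA := (gens alpha).
Local Notation DE := (gens beta).

Let cont_actA (x : 'cV[R]_N -> 'cV[R]_n) a : continuous x -> continuous (fun z => alpha (x z) a).
Proof. by move=> cx z; apply: (cvg_comp _ (alpha ^~ a) (cx z)); exact: (smooth_cont (act_smooth alpha_act a)). Qed.

Let contT (V W : tvsType R[i]) (T : V -> W) (f : 'cV[R]_N -> V) : continuous T -> continuous f -> continuous (T \o f).
Proof. by move=> cT cf z; apply: (cvg_comp _ T (cf z)); exact: cT. Qed.

Definition two (a : A) (psi : E) z : E := nu (alpha (su z) a) (beta (sw z) psi).
Definition three (a b : A) (psi : E) z : E := nu (alpha (su z) a) (nu (alpha (sv z) b) (beta (sw z) psi)).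

(* Covariance moves one of the actions in front: the element it acts on is left fixed
   inside, and the remaining slots are moved by differences. *)
Lemma twoE1 a psi z : two a psi z = beta (sw z) (nu (alpha (su z - sw z) a) psi).
Proof. by rewrite beta_cov /two -(actN alpha_act). Qed.

Lemma twoE2 a psi z : two a psi z = beta (su z) (nu a (beta (sw z - su z) psi)).
Proof. by rewrite beta_cov /two -(actN beta_act). Qed.

(** The three forms leave a, b and psi innermost respectively. The other two elements then enter
    only through fixed maps such as mu(., b) and nu(., psi), for which separate continuity is
    enough. *)
Lemma threeE1 a b psi z : three a b psi z = beta (sw z) (nu (alpha (sv z - sw z) (mu (alpha (su z - sv z) a) b)) psi).
Proof. by rewrite beta_cov -(actN alpha_act) alpha_aut -(actN alpha_act) nuA. Qed.

Lemma threeE2 a b psi z : three a b psi z = beta (sw z) (nu (alpha (su z - sw z) (mu a (alpha (sv z - su z) b))) psi).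
Proof. by rewrite beta_cov -(actN alpha_act) alpha_aut -(actN alpha_act) nuA. Qed.

Lemma threeE3 a b psi z : three a b psi z = beta (su z) (nu a (beta (sv z - su z) (nu b (beta (sw z - sv z) psi)))).
Proof. by rewrite beta_cov -(actN beta_act) beta_cov -(actN beta_act). Qed.

Lemma cont_two a psi : continuous (two a psi).
Proof.
rewrite (funext (twoE1 a psi)); apply: (act_joint QE_def beta_act); last exact: cont_sw.
apply: (@contT A E (nu ^~ psi) (fun z => alpha (su z - sw z) a)) => //.
by apply: cont_actA; apply: cont_diff; [exact: cont_su|exact: cont_sw].
Qed.

Lemma cont_three a b psi : continuous (three a b psi).
Proof.
rewrite (funext (threeE1 a b psi)); apply: (act_joint QE_def beta_act); last exact: cont_sw.
apply: (@contT A E (nu ^~ psi) (fun z => alpha (sv z - sw z) (mu (alpha (su z - sv z) a) b))) => //.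
apply: (act_joint QA_def alpha_act); last by apply: cont_diff; [exact: cont_sv|exact: cont_sw].
apply: (@contT A A (mu ^~ b) (fun z => alpha (su z - sv z) a)) => //.
by apply: cont_actA; apply: cont_diff; [exact: cont_su|exact: cont_sv].
Qed.

Let eq_pb (q : E -> R) (f f' : 'cV[R]_N -> E) g : f =1 f' -> pb (fun z => q (f' z)) g -> ord_le q f g.
Proof. by move=> /funext ->. Qed.

(** The seminorm is pulled back from the outside in, alternating [act_step] with composition by a
    fixed map. The innermost element is constant, of exponent 0, so only the constant depends on
    it. *)
Lemma two_b1 q : csn E q -> forall psi, exists2 g : R, 0 <= g & forall a, ord_le q (two a psi) g.
Proof.
move=> Hq psi; have [k1 k10 [p1 Hp1 H1]] := act_step QE_def beta_act Hq.
have [k2 k20 [p2 Hp2 H2]] := act_step QA_def alpha_act (csn_comp (nur psi) (nurc (psi := psi)) Hp1).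
exists (0 + k2 + k1); first by rewrite add0r addr_ge0.
move=> a; apply: (eq_pb (twoE1 a psi)); apply: H1; first by apply: adm1; exact: wt_sw.
apply: (H2 _ (fun z => su z - sw z) (fun=> a)); first by apply: adm_sub; [exact: wt_su|exact: wt_sw].
exact: pb_cst.
Qed.

Lemma two_b3 q : csn E q -> forall a, exists2 g : R, 0 <= g & forall psi, ord_le q (two a psi) g.
Proof.
move=> Hq a; have [k1 k10 [p1 Hp1 H1]] := act_step QE_def beta_act Hq.
have [k2 k20 [p2 Hp2 H2]] := act_step QE_def beta_act (csn_comp (nul a) (nulc (a := a)) Hp1).
exists (0 + k2 + k1); first by rewrite add0r addr_ge0.
move=> psi; apply: (eq_pb (twoE2 a psi)); apply: H1; first by apply: adm1; exact: wt_su.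
apply: (H2 _ (fun z => sw z - su z) (fun=> psi)); first by apply: adm_sub; [exact: wt_sw|exact: wt_su].
exact: pb_cst.
Qed.

Lemma three_b1 q : csn E q -> forall b psi, exists2 g : R, 0 <= g & forall a, ord_le q (three a b psi) g.
Proof.
move=> Hq b psi; have [k1 k10 [p1 Hp1 H1]] := act_step QE_def beta_act Hq.
have [k2 k20 [p2 Hp2 H2]] := act_step QA_def alpha_act (csn_comp (nur psi) (nurc (psi := psi)) Hp1).
have [k3 k30 [p3 Hp3 H3]] := act_step QA_def alpha_act (csn_comp (mur b) (murc (a := b)) Hp2).
exists (0 + k3 + k2 + k1); first by rewrite add0r !addr_ge0.
move=> a; apply: (eq_pb (threeE1 a b psi)); apply: H1; first by apply: adm1; exact: wt_sw.
apply: (H2 _ (fun z => sv z - sw z) (fun z => mu (alpha (su z - sv z) a) b)); first by apply: adm_sub; [exact: wt_sv|exact: wt_sw].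
apply: (H3 _ (fun z => su z - sv z) (fun=> a)); first by apply: adm_sub; [exact: wt_su|exact: wt_sv].
exact: pb_cst.
Qed.

Lemma three_b2 q : csn E q -> forall a psi, exists2 g : R, 0 <= g & forall b, ord_le q (three a b psi) g.
Proof.
move=> Hq a psi; have [k1 k10 [p1 Hp1 H1]] := act_step QE_def beta_act Hq.
have [k2 k20 [p2 Hp2 H2]] := act_step QA_def alpha_act (csn_comp (nur psi) (nurc (psi := psi)) Hp1).
have [k3 k30 [p3 Hp3 H3]] := act_step QA_def alpha_act (csn_comp (mul a) (mulc (a := a)) Hp2).
exists (0 + k3 + k2 + k1); first by rewrite add0r !addr_ge0.
move=> b; apply: (eq_pb (threeE2 a b psi)); apply: H1; first by apply: adm1; exact: wt_sw.
apply: (H2 _ (fun z => su z - sw z) (fun z => mu a (alpha (sv z - su z) b))); first by apply: adm_sub; [exact: wt_su|exact: wt_sw].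
apply: (H3 _ (fun z => sv z - su z) (fun=> b)); first by apply: adm_sub; [exact: wt_sv|exact: wt_su].
exact: pb_cst.
Qed.

Lemma three_b3 q : csn E q -> forall a b, exists2 g : R, 0 <= g & forall psi, ord_le q (three a b psi) g.
Proof.
move=> Hq a b; have [k1 k10 [p1 Hp1 H1]] := act_step QE_def beta_act Hq.
have [k2 k20 [p2 Hp2 H2]] := act_step QE_def beta_act (csn_comp (nul a) (nulc (a := a)) Hp1).
have [k3 k30 [p3 Hp3 H3]] := act_step QE_def beta_act (csn_comp (nul b) (nulc (a := b)) Hp2).
exists (0 + k3 + k2 + k1); first by rewrite add0r !addr_ge0.
move=> psi; apply: (eq_pb (threeE3 a b psi)); apply: H1; first by apply: adm1; exact: wt_su.
apply: (H2 _ (fun z => sv z - su z) (fun z => nu b (beta (sw z - sv z) psi))); first by apply: adm_sub; [exact: wt_sv|exact: wt_su].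
apply: (H3 _ (fun z => sw z - sv z) (fun=> psi)); first by apply: adm_sub; [exact: wt_sw|exact: wt_sv].
exact: pb_cst.
Qed.

Lemma comp_lin (V W X : tvsType R[i]) (T : V -> W) (S : W -> X) : linear T -> linear S -> linear (S \o T).
Proof. by move=> lT lS a x y /=; rewrite lT lS. Qed.

Lemma comp_cont (V W X : tvsType R[i]) (T : V -> W) (S : W -> X) : continuous T -> continuous S -> continuous (S \o T).
Proof. by move=> cT cS v; apply: (cvg_comp _ S (cT v)); exact: cS. Qed.

(** The family required by [slot_growth] is obtained by applying generators to a, b and psi. *)
Lemma growth_three r a b psi : 0 < r -> growth (csn E) r (three a b psi).
Proof.
move=> r0; apply: (@slot_growth _ _ _ (csn_def QE_def) hausE n (fun s t l => three (DA s a) (DA t b) (DE l psi)) _ _ _ _ _ _ _ _ r0).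
- by move=> s t l; exact: cont_three.
- move=> i s t l x.
  apply: (pd_slot QA_def hausA alpha_act (x := su) (T := fun z a' => nu a' (nu (alpha (sv z) (DA t b)) (beta (sw z) (DE l psi))))).
  + by move=> z h; exact: su1.
  + by move=> z h v; rewrite sv1 sw1.
  + exact: nur.
  + exact: nurc.
- move=> i s t l x.
  apply: (pd_slot QA_def hausA alpha_act (x := sv) (T := fun z b' => nu (alpha (su z) (DA s a)) (nu b' (beta (sw z) (DE l psi))))).
  + by move=> z h; exact: sv2.
  + by move=> z h v; rewrite su2 sw2.
  + by apply: (@comp_lin A E E (nu ^~ _) (nu _)); [exact: nur|exact: nul].
  + by apply: (@comp_cont A E E (nu ^~ _) (nu _)); [exact: nurc|exact: nulc].
- move=> i s t l x.
  apply: (pd_slot QE_def hausE beta_act (x := sw) (T := fun z psi' => nu (alpha (su z) (DA s a)) (nu (alpha (sv z) (DA t b)) psi'))).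
  + by move=> z h; exact: sw3.
  + by move=> z h v; rewrite su2 sv3.
  + by apply: (@comp_lin E E E (nu _) (nu _)); exact: nul.
  + by apply: (@comp_cont E E E (nu _) (nu _)); exact: nulc.
- by move=> q Hq t l; have [g g0 H] := three_b1 Hq (DA t b) (DE l psi); exists g => // s; exact: H.
- by move=> q Hq s l; have [g g0 H] := three_b2 Hq (DA s a) (DE l psi); exists g => // t; exact: H.
- by move=> q Hq s t; have [g g0 H] := three_b3 Hq (DA s a) (DA t b); exists g => // l; exact: H.
Qed.

Let zero_ord q (F : 'cV[R]_N -> E) g : csn E q -> F = (fun=> 0) -> ord_le q F g.
Proof. by move=> [Hq _] ->; exists 0 => // z; rewrite (sn0 Hq) mul0r. Qed.

Lemma growth_two r a psi : 0 < r -> growth (csn E) r (two a psi).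
Proof.
(* A dummy middle slot. *)
move=> r0; pose Psi (s t l : seq 'I_n) : 'cV[R]_N -> E := if t is [::] then two (DA s a) (DE l psi) else fun=> 0.
apply: (@slot_growth _ _ _ (csn_def QE_def) hausE n Psi _ _ _ _ _ _ _ _ r0).
- by move=> s [|j t] l; [exact: cont_two|exact: contV_cst].
- move=> i s [|j t] l x; last exact: pd_cst.
  apply: (pd_slot QA_def hausA alpha_act (x := su) (T := fun z a' => nu a' (beta (sw z) (DE l psi)))).
  + by move=> z h; exact: su1.
  + by move=> z h v; rewrite sw1.
  + exact: nur.
  + exact: nurc.
- move=> i s [|j t] l x; last exact: pd_cst.
  apply: (cvg_eqn _ (cvg_cst _)); apply: filterE => h.
  by rewrite /diff_quotient /= /two su2 sw2 subrr scaler0.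
- move=> i s [|j t] l x; last exact: pd_cst.
  apply: (pd_slot QE_def hausE beta_act (x := sw) (T := fun z psi' => nu (alpha (su z) (DA s a)) psi')).
  + by move=> z h; exact: sw3.
  + by move=> z h v; rewrite su2.
  + exact: nul.
  + exact: nulc.
- move=> q Hq [|j t] l; last by exists 0 => // s; exact: zero_ord.
  by have [g g0 H] := two_b1 Hq (DE l psi); exists g => // s; exact: H.
- move=> q Hq s l; have [g g0 H] := two_b1 Hq (DE l psi); exists g => // -[|j t]; first exact: H.
  exact: zero_ord.
- move=> q Hq s [|j t]; last by exists 0 => // l; exact: zero_ord.
  by have [g g0 H] := two_b3 Hq (DA s a); exists g => // l; exact: H.
Qed.

End ModuleSlots.

(** * The deformed products *)

Section MulBound.
Context {R : realType} (V : tvsType R[i]) (Q : set (V -> R)).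
Hypothesis Qdef : defining_system Q.
Hypothesis hV : hausdorff_space V.

(** A quantitative companion of [growth_mul]: the constant depends on A, e and K only, so that it
    can be applied to the sheared cutoffs uniformly in their radii. *)
Lemma mul_bound N N' (A : 'M[R]_(N, N')) e K : 0 <= e -> exists2 C : R, 0 <= C &
  forall q (F : 'cV[R]_N -> V) (B : R), Q q -> smooth F -> 0 <= B ->
    (forall s z, (size s <= K)%N -> q (partials s F z) <= B * wt z `^ e) ->
    forall s z, (size s <= K)%N -> q (partials s (fun y : 'cV[R]_N' => F (A *m y)) z) <= C * B * wt z `^ e.
Proof.
move=> e0; have [D D0 HD] := wtp_lin A e0.
pose a := 1 + \sum_i \sum_j `|A i j|.
have S0 : 0 <= \sum_i \sum_j `|A i j| by apply: sumr_ge0 => i _; apply: sumr_ge0.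
have a1 : 1 <= a by rewrite lerDl.
have a0 : 0 <= a by exact: le_trans a1.
exists (D * a ^+ K); first by rewrite mulr_ge0 // exprn_ge0.
have E (G : 'cV[R]_N -> V) : (fun y : 'cV[R]_N' => G (A *m y)) = (fun y => G (0 + A *m y)).
  by apply/funext => y; rewrite add0r.
have H q s : forall (F : 'cV[R]_N -> V) (B : R), Q q -> smooth F -> 0 <= B ->
    (forall t z, (size t <= size s)%N -> q (partials t F z) <= B * wt z `^ e) ->
    forall z, q (partials s (fun y : 'cV[R]_N' => F (A *m y)) z) <= D * a ^+ size s * B * wt z `^ e.
  elim/last_ind: s => [|s i IH] F B Hq sF B0 HF z; have Hs := Qsn Qdef Hq.
    rewrite expr0 mulr1 /=; apply: le_trans (HF [::] (A *m z) (leqnn _)) _.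
    by rewrite [D * B]mulrC -mulrA; apply: ler_wpM2l.
  rewrite partials_rcons E (partial_aff Qdef hV _ _ _ sF).
  have sG j : smooth (fun y : 'cV[R]_N' => partial j F (A *m y)).
    by rewrite E; apply: (smooth_aff Qdef hV); exact: smooth_partial.
  have -> : (fun y => \sum_j (A j i)%:C *: partial j F (0 + A *m y)) = (fun y => \sum_j (A j i)%:C *: partial j F (A *m y)).
    by apply/funext => y; apply: eq_bigr => j _; rewrite add0r.
  have [_ ->] := partials_sum hV (index_enum 'I_N) (fun j => (A j i)%:C) s sG.
  have W0 : 0 <= D * a ^+ size s * B * wt z `^ e by rewrite !mulr_ge0 ?wtp_ge0 ?exprn_ge0.
  apply: le_trans (sn_sum Hs _ _ _) _.
  apply: (@le_trans _ _ (\sum_j `|A j i| * (D * a ^+ size s * B * wt z `^ e))).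
    apply: ler_sum => j _; rewrite (snZr Hs); apply: ler_wpM2l => //.
    apply: IH => //; first exact: smooth_partial.
    by move=> t y ts; rewrite -partials_rcons; apply: HF; rewrite !size_rcons.
  rewrite -mulr_suml size_rcons exprS.
  have -> : D * (a * a ^+ size s) * B * wt z `^ e = a * (D * a ^+ size s * B * wt z `^ e) by ring.
  apply: ler_wpM2r => //; rewrite /a; apply: (@le_trans _ _ (\sum_j \sum_l `|A j l|)); last by rewrite lerDr.
  by apply: ler_sum => j _; rewrite (bigD1 i) //= lerDl sumr_ge0.
move=> q F B Hq sF B0 HF s z sK.
apply: le_trans (H q s F B Hq sF B0 (fun t y ts => HF t y (leq_trans ts sK)) z) _.
apply: ler_wpM2r; first exact: wtp_ge0.
by apply: ler_wpM2r => //; apply: ler_wpM2l => //; apply: ler_weXn2l.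
Qed.

End MulBound.

(** * Iterated oscillatory integrals as limits of integrals over R^(4n) *)

Section Iterated.
Context {R : realType} (n : nat) (V : tvsType R[i]) (Q : set (V -> R)).
Hypothesis Qdef : defining_system Q.
Hypothesis hV : hausdorff_space V.
Hypothesis complV : sequentially_complete V.
Variable M : 'M[R]_n.
Hypothesis hM : `|\det M| = 1.
Local Notation normc := (@ComplexField.Normc.normc R).
Local Notation n2 := (n + n)%N.
Local Notation oscc := (oscc (R := R) n).

Definition P4 : 'M[R]_(n2 + n2) := block_mx (PM M) 0 0 (PM M).

Lemma unitP4 : P4 + P4^T \in unitmx.
Proof.
have := unitPM hM; rewrite /P4 tr_block_mx !trmx0 add_block_mx !addr0; set S := PM M + _ => uS.
have H : block_mx S 0 0 S *m block_mx (invmx S) 0 0 (invmx S) = 1%:M :> 'M[R]_(n2 + n2).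
  by rewrite mulmx_block !mul0mx !mulmx0 !addr0 !add0r !mulmxV // -scalar_mx_block.
by have [] := mulmx1_unit H.
Qed.

Lemma eiq_col (z y : 'cV[R]_n2) : eiq P4 0 (col_mx z y) = eiq (PM M) 0 z * eiq (PM M) 0 y.
Proof.
rewrite /eiq -expiD; congr expi; rewrite /qphase.
have d0 N (x : 'cV[R]_N) : dotp 0 x = 0 by rewrite /dotp big1 // => i _; rewrite mxE mul0r.
rewrite !d0 !addr0 /bform /P4 mul_block_col !mul0mx addr0 add0r big_split_ord /=.
by congr (_ + _); apply: eq_bigr => i _; rewrite ?col_mxEu ?col_mxEd.
Qed.

Definition lam4 (l j : nat) (i : 'I_(n2 + n2)) : R :=
  (col_mx (const_mx l.+1%:R) (const_mx j.+1%:R) : 'cV[R]_(n2 + n2)) i 0.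

Lemma lam4l l j i : lam4 l j (lshift n2 i) = l.+1%:R.
Proof. by rewrite /lam4 col_mxEu mxE. Qed.

Lemma lam4r l j i : lam4 l j (rshift n2 i) = j.+1%:R.
Proof. by rewrite /lam4 col_mxEd mxE. Qed.

Definition cut2 l j : 'cV[R]_(n2 + n2) -> R[i]^o := cutoff (lam4 l j).

Lemma lam4_gt0 l j i : 0 < lam4 l j i.
Proof. by have [k ->|k ->] := split_ordP i; rewrite ?lam4l ?lam4r ltr0n. Qed.

Lemma cut2_col l j (z y : 'cV[R]_n2) : cut2 l j (col_mx z y) = cut l z * cut j y.
Proof.
have H : \prod_i eta (col_mx z y i 0 / lam4 l j i) = (\prod_i eta (z i 0 / l.+1%:R)) * \prod_i eta (y i 0 / j.+1%:R).
  rewrite big_split_ord; congr (_ * _); apply: eq_bigr => i _.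
    by rewrite col_mxEu lam4l.
  by rewrite col_mxEd lam4r.
by rewrite /cut2 /cutoff H (rmorphM (real_complex R)).
Qed.

Lemma smooth_cut2 l j : smooth (cut2 l j).
Proof. exact: cutoff_smooth. Qed.

Lemma supp_cut2 l j : supp_le (2 * (l.+1%:R + j.+1%:R)) (cut2 l j).
Proof.
move=> z H i; apply: le_trans (cutoff_supp (lam4_gt0 l j) H i) _; rewrite ler_pM2l //.
by have [k ->|k ->] := split_ordP i; rewrite ?lam4l ?lam4r ?lerDl ?lerDr.
Qed.

Lemma smooth_col (G : 'cV[R]_(n2 + n2) -> V) (z : 'cV[R]_n2) : smooth G -> smooth (fun y : 'cV[R]_n2 => G (col_mx z y)).
Proof.
move=> sG; have -> : (fun y : 'cV[R]_n2 => G (col_mx z y)) = (fun y => G (col_mx z 0 + col_mx 0 1%:M *m y)).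
  by apply/funext => y; rewrite mul_col_mx mul0mx mul1mx add_col_mx addr0 add0r.
exact: (smooth_aff Qdef hV).
Qed.

Variable r : R.
Hypotheses (r0 : 0 <= r) (r1 : r < 2^-1).
Variable G : 'cV[R]_(n2 + n2) -> V.
Hypothesis gG : growth Q r G.
Let sG : smooth G. Proof. by case: gG. Qed.

(** The outer variables are cut off at radius l + 1 and the inner ones at j + 1; iterating the
    oscillatory integrals means j to infinity first. *)
Definition W4 (F : 'cV[R]_(n2 + n2) -> V) l j : V := riemann_integral (fun z => (eiq P4 0 z : R[i]) *: ((cut2 l j z : R[i]) *: F z)).

Lemma growth_col (z : 'cV[R]_n2) : growth Q r (fun y : 'cV[R]_n2 => G (col_mx z y)).
Proof.
split; first exact: smooth_col.
move=> q Hq; have [m m0 Hm] := growth_unif gG Hq; exists m => // s.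
have [B B0 HB] := Hm (size s); exists (B * wt z `^ (m + r * (size s)%:R)); first by rewrite mulr_ge0 // wtp_ge0.
move=> y; rewrite partials_col; have := HB (map (@rshift n2 n2) s) (col_mx z y).
rewrite size_map => /(_ (leqnn _)) H; apply: le_trans H _; rewrite -mulrA; apply: ler_wpM2l => //.
by apply: wtp_col; rewrite addr_ge0 // mulr_ge0.
Qed.

(** On a bounded set of parameters z the growth bounds of the inner integrands have a common
    constant, and [osc_lim_rate] depends on them only through it. *)
Lemma inner_rate (f : 'cV[R]_n2 -> V) q L : Q q -> 0 <= L ->
  (forall z, osc0 M (fun y => (cut j y : R[i]) *: G (col_mx z y)) @[j --> \oo] --> f z) ->
  exists2 D : R, 0 <= D & forall (z : 'cV[R]_n2) j, (forall i, `|z i 0| <= L) ->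
    q (f z - osc0 M (fun y => (cut j y : R[i]) *: G (col_mx z y))) <= D / j.+1%:R.
Proof.
move=> Hq L0 Hf; have Hs := Qsn Qdef Hq; have [m m0 Hm] := growth_unif gG Hq.
have [K [C C0 HC]] := osc_lim_rate Qdef hV complV (unitPM hM) m0 r0 r1.
(* Here w bounds the e-th power of the weight of z on the cube of half-side L. *)
have [B B0 HB] := Hm K; pose e := m + r * K%:R; pose w := (1 + n2%:R * L ^+ 2) `^ e.
have e0 : 0 <= e by rewrite addr_ge0 // mulr_ge0.
have w0 : 0 <= w by exact: powR_ge0.
exists (normc oscc * (C * (B * w))); first by rewrite !mulr_ge0 // normc_ge0.
move=> z j zL; have [v Hv] := osc_lim Qdef hV complV (unitPM hM) r0 r1 (growth_col z).
have -> : f z = oscc *: v.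
  apply: (cvg_unV hV (Hf z)); under eq_fun do rewrite osc0E; exact: cvgV_scalec.
rewrite osc0E -scalerBr (snZ Hs) -mulrA; apply: ler_wpM2l; first exact: normc_ge0.
apply: (HC q _ (B * w) v Hq (smooth_col z sG) _ _ Hv j); first by rewrite mulr_ge0.
move=> s y sK; rewrite partials_col; have := HB (map (@rshift n2 n2) s) (col_mx z y).
rewrite size_map => /(_ sK) H; apply: le_trans H _; rewrite -mulrA; apply: ler_wpM2l => //.
apply: le_trans (wtp_col z y _) _; first by rewrite addr_ge0 // mulr_ge0.
apply: ler_wpM2r; first exact: wtp_ge0.
apply: (@le_trans _ _ (wt z `^ e)); first by apply: wtp_mono; rewrite lerD2l ler_wpM2l // ler_nat.
apply: ge0_ler_powR; rewrite ?nnegrE ?wt_ge0 ?addr_ge0 ?mulr_ge0 ?exprn_ge0 //.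
rewrite /wt lerD2l; apply: (@le_trans _ _ (\sum_(i < n2) L ^+ 2)); last by rewrite sumr_const card_ord mulr_natl.
apply: ler_sum => i _; rewrite -real_normK ?num_real //.
by apply: lerXn2r; rewrite ?nnegrE.
Qed.

(** The fixed outer cutoff confines z to a cube, where the inner integrals converge at a uniform
    rate; the limit in j may then be taken under the outer integral. *)
Lemma iter_lim (f : 'cV[R]_n2 -> V) l : continuous f ->
  (forall z, osc0 M (fun y => (cut j y : R[i]) *: G (col_mx z y)) @[j --> \oo] --> f z) ->
  oscc *: (oscc *: W4 G l j) @[j --> \oo] --> osc0 M (fun z => (cut l z : R[i]) *: f z).
Proof.
move=> cf Hf.
pose h j z := (eiq P4 0 z : R[i]) *: ((cut2 l j z : R[i]) *: G z).
pose fj j z := osc0 M (fun y => (cut j y : R[i]) *: G (col_mx z y)).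
have cch j : cc (h j).
  apply: cc_mul; first exact: cont_eiq; split.
    by apply: cont_mul; apply: smooth_cont => //; exact: smooth_cut2.
  by exists (2 * (l.+1%:R + j.+1%:R)); apply: supp_le_mull; exact: supp_cut2.
have ccf : cc (fun z => (eiq (PM M) 0 z : R[i]) *: ((cut l z : R[i]) *: f z)).
  by apply: cc_mul; [exact: cont_eiq|exact: cc_cut].
have hE j z : oscc *: riemann_integral (fun y => h j (col_mx z y)) =
    (eiq (PM M) 0 z : R[i]) *: ((cut l z : R[i]) *: fj j z).
  have ccy : cc (fun y : 'cV[R]_n2 => (eiq (PM M) 0 y : R[i]) *: ((cut j y : R[i]) *: G (col_mx z y))).
    by apply: cc_mul; [exact: cont_eiq|apply: cc_cut; exact: smooth_cont (smooth_col z sG)].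
  have -> : (fun y => h j (col_mx z y)) = (fun y => (eiq (PM M) 0 z * cut l z : R[i]) *:
      ((eiq (PM M) 0 y : R[i]) *: ((cut j y : R[i]) *: G (col_mx z y)))).
    apply/funext => y; rewrite /h eiq_col cut2_col !scalerA; congr (_ *: _).
    by rewrite -!mulrA; congr (_ * _); rewrite mulrCA.
  rewrite (rintZ Qdef hV complV _ ccy) /fj osc0E /Iosc !scalerA; congr (_ *: _).
  by rewrite mulrC.
rewrite osc0E; apply: cvgV_scalec; apply/(cvgQ_lt Qdef) => q e Hq e0; have Hs := Qsn Qdef Hq.
pose L := 2 * l.+1%:R : R; have L0 : 0 <= L by rewrite mulr_ge0.
have [D D0 HD] := inner_rate Hq L0 Hf.
have [B B0 HB] := cont_bounded defsys_normc (q := normc) erefl (smooth_cont (@smooth_cut R n2 l)) (@supp_cut R n2 l).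
pose X := (2 * L + 1) ^+ n2 * (B * D).
have X0 : 0 <= X by rewrite mulr_ge0 ?mulr_ge0 // exprn_ge0 // addr_ge0 // mulr_ge0.
have Hj j : q (oscc *: W4 G l j - Iosc (PM M) (fun z => (cut l z : R[i]) *: f z)) <= X / j.+1%:R.
  pose g1 z := (eiq (PM M) 0 z : R[i]) *: ((cut l z : R[i]) *: fj j z).
  pose g2 z := (eiq (PM M) 0 z : R[i]) *: ((cut l z : R[i]) *: f z).
  have sg (F : 'cV[R]_n2 -> V) : supp_le L (fun z => (eiq (PM M) 0 z : R[i]) *: ((cut l z : R[i]) *: F z)).
    by apply: supp_le_mul; apply: supp_le_mull; exact: supp_cut.
  have l1 : latsum K g1 @[K --> \oo] --> oscc *: W4 G l j.
    apply: (cvg_eqn _ (cvgV_scalec (a := oscc) (rint_fub Qdef hV complV (cch j)))); apply: filterE => K.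
    have sh : supp_le (2 * (l.+1%:R + j.+1%:R)) (fun z => riemann_integral (fun y => h j (col_mx z y))).
      move=> z Hz i; rewrite leNgt; apply/negP => Hi; move/eqP: Hz; apply.
      rewrite (_ : (fun y => h j (col_mx z y)) = fun=> 0) ?(rint0 Qdef hV complV) //.
      apply/funext => y; apply: (@col_zero _ _ _ _ _ (2 * (l.+1%:R + j.+1%:R)) _ _ i).
        by apply: supp_le_mul; apply: supp_le_mull; exact: supp_cut2.
      by rewrite -ltNge.
    rewrite -(latsumZ _ _ _ sh); last by rewrite mulr_ge0.
    by congr latsum; apply/funext => z; rewrite /g1 -hE.
  have l2 : latsum K g2 @[K --> \oo] --> Iosc (PM M) (fun z => (cut l z : R[i]) *: f z) := rint_lim Qdef hV complV ccf.
  apply: (lim_sn_le Qdef Hq (cvgV_sub l1 l2)); apply: filterE => K.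
  rewrite -(latsumB _ L0 (sg _) (sg _)) /X -!mulrA.
  apply: (latsum_bound K Hs _ (supp_le_box _)); first by rewrite mulr_ge0.
    have -> : (fun z => g1 z - g2 z) = (fun z => (eiq (PM M) 0 z : R[i]) *: ((cut l z : R[i]) *: (fj j z - f z))).
      by apply/funext => z; rewrite /g1 /g2 -!scalerBr.
    exact: sg.
  move=> z; rewrite -scalerBr -scalerBr !(snZ Hs) normc_expi mul1r.
  have [/eqP ->|Hz] := boolP (cut l z == 0).
    by rewrite ComplexField.Normc.normc0 mul0r mulr_ge0 // mulr_ge0 // invr_ge0.
  apply: ler_pM; rewrite ?normc_ge0 ?(sn_ge0 Hs) //.
  by rewrite (snBC Hs); apply: HD => i; exact: supp_cut.
have e1 : 0 < e / (X + 1) by rewrite divr_gt0 // ltr_pwDr.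
apply: filterS (mesh_near e1) => j; rewrite /mesh ltr_pdivlMr ?ltr_pwDr // => Hm.
apply: le_lt_trans (Hj j) _; apply: le_lt_trans Hm; rewrite mulrC; apply: ler_wpM2l; first by rewrite invr_ge0.
by rewrite lerDl.
Qed.

End Iterated.

Section ShearMatrix.
Variables (K : comNzRingType) (n : nat).
Local Notation n2 := (n + n)%N.

(* The matrix of (p', x', p, x) |-> (p' + p, x, p', x' - x). *)
Definition shear : 'M[K]_(n2 + n2) :=
  block_mx (block_mx 1%:M 0 0 0) (block_mx 1%:M 0 0 1%:M) (block_mx 1%:M 0 0 1%:M) (block_mx 0 0 0 (- 1%:M)).
Definition shear_inv : 'M[K]_(n2 + n2) :=
  block_mx (block_mx 0 0 0 1%:M) (block_mx 1%:M 0 0 1%:M) (block_mx 1%:M 0 0 1%:M) (block_mx (- 1%:M) 0 0 0).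

Lemma shear_col (p' x' p x : 'cV[K]_n) :
  shear *m col_mx (col_mx p' x') (col_mx p x) = col_mx (col_mx (p' + p) x) (col_mx p' (x' - x)).
Proof.
rewrite /shear !mul_block_col !mul0mx !mul1mx !mulNmx !mul1mx !addr0 !add0r.
by rewrite !add_col_mx !addr0 !add0r.
Qed.

Lemma shear_inv_col (a b c d : 'cV[K]_n) :
  shear_inv *m col_mx (col_mx a b) (col_mx c d) = col_mx (col_mx c (b + d)) (col_mx (a - c) b).
Proof.
rewrite /shear_inv !mul_block_col !mul0mx !mul1mx !mulNmx !mul1mx !addr0 !add0r.
by rewrite !add_col_mx !addr0 !add0r.
Qed.

Lemma col4K (z : 'cV[K]_(n2 + n2)) : z = col_mx (col_mx (usubmx (usubmx z)) (dsubmx (usubmx z))) (col_mx (usubmx (dsubmx z)) (dsubmx (dsubmx z))).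
Proof. by rewrite !vsubmxK. Qed.

Lemma shearK : cancel (mulmx shear) (mulmx shear_inv : 'cV[K]_(n2 + n2) -> 'cV[K]_(n2 + n2)).
Proof.
move=> z; rewrite [z]col4K shear_col shear_inv_col; congr (col_mx (col_mx _ _) (col_mx _ _)).
  by rewrite addrC subrK.
by rewrite addrC addKr.
Qed.

Lemma shear_invK : cancel (mulmx shear_inv) (mulmx shear : 'cV[K]_(n2 + n2) -> 'cV[K]_(n2 + n2)).
Proof.
move=> z; rewrite [z]col4K shear_inv_col shear_col; congr (col_mx (col_mx _ _) (col_mx _ _)).
  by rewrite addrC subrK.
by rewrite addrC addKr.
Qed.

End ShearMatrix.

(** The shear is integral with integral inverse, so it permutes every lattice, as [rint_bij]
    requires; no Jacobian appears. *)
Lemma map_shear (R : realType) n : map_mx intr (shear int n) = shear R n.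
Proof. by rewrite /shear !map_block_mx !map_mx0 map_mxN !map_mx1. Qed.

Section ShearPhase.
Context {R : realType} (n : nat) (M : 'M[R]_n).
Local Notation n2 := (n + n)%N.

Lemma pairingDl p p' x : pairing M (p + p') x = pairing M p x + pairing M p' x.
Proof. by rewrite /pairing -big_split; apply: eq_bigr => i _; rewrite mxE mulrDl. Qed.

Lemma pairingBr p x x' : pairing M p (x - x') = pairing M p x - pairing M p x'.
Proof. by rewrite /pairing -sumrB; apply: eq_bigr => i _; rewrite mulmxBr !mxE mulrBr. Qed.

Lemma eiq_pair (p x : 'cV[R]_n) : eiq (PM M) 0 (col_mx p x) = expi (pairing M p x).
Proof. by rewrite /eiq qphase_pairing col_mxKu col_mxKd. Qed.

(** The cross terms <p', x> and - <p', x> cancel. *)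
Lemma eiq_shear z : eiq (P4 M) 0 (shear R n *m z) = eiq (P4 M) 0 z.
Proof.
rewrite [z]col4K shear_col !eiq_col !eiq_pair -!expiD; congr expi.
by rewrite pairingDl pairingBr; ring.
Qed.

End ShearPhase.

Section IteratedEquality.
Context {R : realType} (n : nat) (V : tvsType R[i]) (Q : set (V -> R)).
Hypothesis Qdef : defining_system Q.
Hypothesis hV : hausdorff_space V.
Hypothesis complV : sequentially_complete V.
Variable M : 'M[R]_n.
Hypothesis hM : `|\det M| = 1.
Local Notation normc := (@ComplexField.Normc.normc R).
Local Notation n2 := (n + n)%N.
Local Notation U := (shear R n).
Local Notation oscc := (oscc (R := R) n).
Variable r : R.
Hypotheses (r0 : 0 <= r) (r1 : r < 2^-1).
Variables G Gt : 'cV[R]_(n2 + n2) -> V.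
Hypotheses (gG : growth Q r G) (gGt : growth Q r Gt).
Hypothesis GU : forall z, Gt (U *m z) = G z.
Let sG : smooth G. Proof. by case: gG. Qed.
Let sGt : smooth Gt. Proof. by case: gGt. Qed.

Lemma supp_le_shear (W : tvsType R[i]) (F : 'cV[R]_(n2 + n2) -> W) L : supp_le L F -> exists L', supp_le L' (fun z => F (U *m z)).
Proof.
move=> sF; exists (\sum_i \sum_k `|shear_inv R n i k| * `|L|) => z Hz i.
rewrite -(shearK z) mxE; apply: le_trans (ler_norm_sum _ _ _) _.
rewrite [leRHS](bigD1 i) //=; apply: (@le_trans _ _ (\sum_k `|shear_inv R n i k| * `|L|)); last first.
  by rewrite lerDl; apply: sumr_ge0 => j _; apply: sumr_ge0 => k _; exact: mulr_ge0.
apply: ler_sum => k _; rewrite normrM; apply: ler_wpM2l => //.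
exact: le_trans (sF _ Hz k) (ler_norm _).
Qed.

Lemma cont_shear (W : tvsType R[i]) (F : 'cV[R]_(n2 + n2) -> W) : continuous F -> continuous (fun z => F (U *m z)).
Proof.
move=> cF z; have -> : (fun z => F (U *m z)) = (fun z => F (0 + U *m z)) by apply/funext => y; rewrite add0r.
by apply: (cvg_comp _ F (@cont_aff R _ _ U 0 z)); exact: cF.
Qed.

Lemma cc_W4 (F : 'cV[R]_(n2 + n2) -> V) l j : continuous F -> cc (fun z => (eiq (P4 M) 0 z : R[i]) *: ((cut2 l j z : R[i]) *: F z)).
Proof.
move=> cF; apply: cc_mul; first exact: cont_eiq; split.
  by apply: cont_mul => //; apply: smooth_cont; exact: smooth_cut2.
by exists (2 * (l.+1%:R + j.+1%:R)); apply: supp_le_mull; exact: supp_cut2.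
Qed.

Lemma W4_shear l j : W4 M Gt l j = riemann_integral (fun z => (eiq (P4 M) 0 z : R[i]) *: ((cut2 l j (U *m z) : R[i]) *: G z)).
Proof.
pose F z := (eiq (P4 M) 0 z : R[i]) *: ((cut2 l j z : R[i]) *: Gt z).
have ccF : cc F by apply: cc_W4; exact: smooth_cont.
have ccFU : cc (F \o mulmx U).
  case: ccF => cF [L sF]; split; first exact: cont_shear.
  exact: (supp_le_shear sF).
have := rint_bij Qdef hV complV (u := mulmx (shear int n)) (U := mulmx U) _ _ ccF ccFU.
rewrite /W4 -/F => <-.
- by congr riemann_integral; apply/funext => z; rewrite /F /= eiq_shear GU.
- by exists (mulmx (shear_inv int n)); [exact: shearK|exact: shear_invK].
- by move=> K k; rewrite /latpt -scalemxAr -map_shear map_mxM.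
Qed.

Lemma cutoff_unif N K : exists2 C : R, 0 <= C & forall s, (size s <= K)%N -> forall lam (rho : R), 1 <= rho -> (forall l, rho <= lam l) ->
  forall z : 'cV[R]_N, normc (partials s (fun z => one_ z - cutoff lam z) z) <= C / rho * wt z `^ 2^-1.
Proof.
apply: (@unif_lists R 'I_N K) => [s C C' CC H lam rho r1' Hl z|s].
  apply: le_trans (H lam rho r1' Hl z) _; apply: ler_wpM2r; first exact: wtp_ge0.
  by apply: ler_wpM2r => //; rewrite invr_ge0; exact: le_trans r1'.
have [C C0 H] := @cutoff_bound R N s; exists C => // lam rho r1' Hl z.
by rewrite mulrAC; exact: H.
Qed.

(** After the shear both integrals have the same integrand up to the cutoffs. The difference of the
    cutoffs is O(1/l) w^(1/2) with its derivatives, since l <= j makes l + 1 the smallest radius. *)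
Lemma W4_diff q : Q q -> exists2 D : R, 0 <= D & forall l j, (l <= j)%N -> q (W4 M G l j - W4 M Gt l j) <= D / l.+1%:R.
Proof.
move=> Hq; have Hs := Qsn Qdef Hq; have [m m0 Hm] := growth_unif gG Hq.
have [K [C C0 HC]] := osc_estimate2 Qdef hV complV (unitP4 hM) m0 r0 r1.
have [B B0 HB] := Hm K.
have [C1 C10 HC1] := cutoff_unif (n2 + n2) K.
have h0 : 0 <= 2^-1 :> R by rewrite invr_ge0.
have [C2 C20 HC2] := mul_bound defsys_normc hausC U K h0.
exists (C * (B * (C1 + C2 * C1))).
  by rewrite !mulr_ge0 ?addr_ge0 // mulr_ge0.
move=> l j lj; rewrite W4_shear /W4 -(rintB Qdef hV complV); last 2 first.
- by apply: cc_W4; exact: smooth_cont.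
- apply: cc_mul; first exact: cont_eiq; split.
    apply: cont_mul; last exact: smooth_cont.
    by apply: (@cont_shear R[i]^o); apply: smooth_cont; exact: smooth_cut2.
  have [L HL] := supp_le_shear (@supp_cut2 R n l j).
  by exists L; exact: supp_le_mull.
(* The difference is written with 1 - [cut2], for which [cutoff_bound] provides the rate; the
   sheared term is controlled by [mul_bound]. *)
pose g0 (z : 'cV[R]_(n2 + n2)) : R[i]^o := one_ z - cut2 l j z.
pose g (z : 'cV[R]_(n2 + n2)) : R[i]^o := g0 (U *m z) - g0 z.
have sg0 : smooth g0 by apply: (smooth_B hausC); [exact: smooth_one|exact: smooth_cut2].
have sg0U : smooth (fun z => g0 (U *m z)).
  have -> : (fun z => g0 (U *m z)) = (fun z => g0 (0 + U *m z)) by apply/funext => y; rewrite add0r.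
  exact: (smooth_aff defsys_normc hausC).
have sg : smooth g by exact: (smooth_B hausC sg0U sg0).
have Eg z : g z = cut2 l j z - cut2 l j (U *m z).
  rewrite /g /g0 -[one_ (U *m z)]/(1 : R[i]^o) -[one_ z]/(1 : R[i]^o) opprB [LHS]addrC -addrA; congr (_ + _).
  exact: addKr.
have -> : (fun z => (eiq (P4 M) 0 z : R[i]) *: ((cut2 l j z : R[i]) *: G z) -
    (eiq (P4 M) 0 z : R[i]) *: ((cut2 l j (U *m z) : R[i]) *: G z)) =
    (fun z => (eiq (P4 M) 0 z : R[i]) *: ((g z : R[i]) *: G z)).
  by apply/funext => z; rewrite -scalerBr -scalerBl Eg.
pose rho : R := l.+1%:R.
have rho1 : 1 <= rho by rewrite ler1n.
have rlam i : rho <= lam4 l j i.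
  by rewrite /rho; have [k ->|k ->] := split_ordP i; rewrite ?lam4l ?lam4r // ler_nat.
have Bg0 s z : (size s <= K)%N -> normc (partials s g0 z) <= C1 / rho * wt z `^ 2^-1.
  by move=> sK; exact: HC1.
have D0 : 0 <= C1 / rho by rewrite divr_ge0.
have Bg s z : (size s <= K)%N -> normc (partials s g z) <= (C1 + C2 * C1) / rho * wt z `^ 2^-1.
  move=> sK; rewrite (partials_B hausC _ sg0U sg0); apply: le_trans (snB sn_normc _ _) _.
  rewrite [C1 + _]addrC !mulrDl; apply: lerD; last exact: Bg0.
  by have := HC2 normc g0 (C1 / rho) erefl sg0 D0 Bg0 s z sK; rewrite [C2 * (_ / _)]mulrA.
have supg : exists L, supp_le L (fun z => (g z : R[i]) *: G z).
  have [L HL] := supp_le_shear (@supp_cut2 R n l j).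
  exists (`|L| + 2 * (l.+1%:R + j.+1%:R)); apply: supp_le_mull => z; rewrite Eg.
  have [/eqP ->|Hz _] := boolP (cut2 l j z == 0).
    rewrite sub0r oppr_eq0 => Hz i; apply: le_trans (HL z Hz i) _.
    by apply: le_trans (ler_norm _) _; rewrite lerDl mulr_ge0.
  by move=> i; apply: le_trans (supp_cut2 Hz i) _; rewrite lerDr.
have E0 : 0 <= (C1 + C2 * C1) / rho by rewrite divr_ge0 // addr_ge0 // mulr_ge0.
apply: le_trans (HC q g G B ((C1 + C2 * C1) / rho) Hq sg sG supg B0 E0 Bg HB) _.
by rewrite /rho !mulrA.
Qed.

(** For fixed l, [iter_lim] lets j tend to infinity along j >= l in [W4_diff], whose bound does not
    involve j; then l tends to infinity. *)
Lemma iterated_eq (f ft : 'cV[R]_n2 -> V) (a b : V) : continuous f -> continuous ft ->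
  (forall z, osc0 M (fun y => (cut j y : R[i]) *: G (col_mx z y)) @[j --> \oo] --> f z) ->
  (forall z, osc0 M (fun y => (cut j y : R[i]) *: Gt (col_mx z y)) @[j --> \oo] --> ft z) ->
  osc0 M (fun z => (cut l z : R[i]) *: f z) @[l --> \oo] --> a ->
  osc0 M (fun z => (cut l z : R[i]) *: ft z) @[l --> \oo] --> b -> a = b.
Proof.
move=> cf cft Hf Hft Ha Hb; apply/eqP; rewrite -subr_eq0; apply/eqP.
apply: (cvg_unV hV (cvgV_sub Ha Hb)).
apply/(cvgQ_lt Qdef) => q e Hq e0; have Hs := Qsn Qdef Hq; have [D D0 HD] := W4_diff Hq.
pose c := normc oscc; have c0 : 0 <= c by exact: normc_ge0.
have X0 : 0 <= c * (c * D) by rewrite !mulr_ge0.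
have e1 : 0 < e / (c * (c * D) + 1) by rewrite divr_gt0 // ltr_pwDr.
apply: filterS (mesh_near e1) => l; rewrite /mesh ltr_pdivlMr ?ltr_pwDr // => Hm.
have L1 := iter_lim Qdef hV complV hM r0 r1 gG (l := l) cf Hf.
have L2 := iter_lim Qdef hV complV hM r0 r1 gGt (l := l) cft Hft.
rewrite subr0; apply: le_lt_trans Hm; apply: (@le_trans _ _ (l.+1%:R^-1 * (c * (c * D)))); last first.
  by apply: ler_wpM2l; [rewrite invr_ge0|rewrite lerDl].
apply: (lim_sn_le Qdef Hq (cvgV_sub L1 L2)); exists l => // j /= lj.
rewrite -!scalerBr !(snZ Hs) -/c [leRHS]mulrCA; apply: ler_wpM2l => //; rewrite [leRHS]mulrCA; apply: ler_wpM2l => //.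
by rewrite [leRHS]mulrC; exact: HD.
Qed.

End IteratedEquality.

Section OscintLinear.
Context {R : realType} (n : nat) (V W : tvsType R[i]) (Q : set (V -> R)) (QW : set (W -> R)).
Hypotheses (Qdef : defining_system Q) (QWdef : defining_system QW).
Hypotheses (hV : hausdorff_space V) (hW : hausdorff_space W).
Hypotheses (complV : sequentially_complete V) (complW : sequentially_complete W).
Variable M : 'M[R]_n.
Hypothesis hM : `|\det M| = 1.
Variable r : R.
Hypotheses (r0 : 0 <= r) (r1 : r < 2^-1).

Lemma oscint_lin (F F' H : 'cV[R]_(n + n) -> V) c : growth Q r F -> growth Q r F' ->
  (forall z, H z = c *: F z + F' z) -> oscint Q M H = c *: oscint Q M F + oscint Q M F'.
Proof.
move=> gF gF' /funext ->; have gH := growth_lin Qdef hV c gF gF'.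
have [sF _] := gF; have [sF' _] := gF'.
have c1 := oscint_cvg Qdef hV complV hM r0 r1 gF.
have c2 := oscint_cvg Qdef hV complV hM r0 r1 gF'.
apply: (cvg_unV hV (oscint_cvg Qdef hV complV hM r0 r1 gH)).
apply: (cvg_eqn _ (cvgV_add (cvgV_scalec (a := c) c1) c2)); apply: filterE => j.
have ccF : cc (fun z => (eiq (PM M) 0 z : R[i]) *: ((cut j z : R[i]) *: F z)).
  by apply: cc_mul; [exact: cont_eiq|apply: cc_cut; exact: smooth_cont].
have ccF' : cc (fun z => (eiq (PM M) 0 z : R[i]) *: ((cut j z : R[i]) *: F' z)).
  by apply: cc_mul; [exact: cont_eiq|apply: cc_cut; exact: smooth_cont].
rewrite !osc0E /Iosc scalerA mulrC -scalerA -scalerDr; congr (_ *: _).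
rewrite -(rintZ Qdef hV complV c ccF) -(rintD Qdef hV complV (ccZ c ccF) ccF').
congr riemann_integral; apply/funext => z; rewrite !scalerDr; congr (_ + _).
by rewrite !scalerA; congr (_ *: _); ring.
Qed.

(** Brings the outer action and product inside the inner integral, which is possible before the
    cutoff is removed. *)
Lemma osc0_lin (T : V -> W) (F : 'cV[R]_(n + n) -> V) j : linear T -> continuous T -> continuous F ->
  T (osc0 M (fun z => (cut j z : R[i]) *: F z)) = osc0 M (fun z => (cut j z : R[i]) *: T (F z)).
Proof.
move=> lT cT cF.
have ccF : cc (fun z => (eiq (PM M) 0 z : R[i]) *: ((cut j z : R[i]) *: F z)).
  by apply: cc_mul; [exact: cont_eiq|exact: cc_cut].
have [_ H] := rint_lin_comp Qdef hV complV QWdef hW complW lT cT ccF.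
rewrite !osc0E (linTZ lT) /Iosc -H; congr (_ *: riemann_integral _).
by apply/funext => z /=; rewrite !(linTZ lT).
Qed.

End OscintLinear.

Section SlotMatrices.
Context {R : realType} (n : nat) (theta : 'M[R]_n).
Local Notation n2 := (n + n)%N.

(** The middle slot is idle in [two] and receives 0. *)
Definition slot2 : 'M[R]_(n + n2, n2) := col_mx (row_mx theta 0) (col_mx 0 (row_mx 0 1%:M)).
(** With (p', x') outer and (p, x) inner, the left side of the module identity evaluates [three] at
    (theta p' + theta p, theta p' + x, x') and the right side, [slot_r], at (theta p', x' + theta p,
    x' + x). *)
Definition slot_l : 'M[R]_(n + n2, n2 + n2) :=
  col_mx (row_mx (row_mx theta 0) (row_mx theta 0))
    (col_mx (row_mx (row_mx theta 0) (row_mx 0 1%:M)) (row_mx (row_mx 0 1%:M) 0)).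
Definition slot_r : 'M[R]_(n + n2, n2 + n2) :=
  col_mx (row_mx (row_mx theta 0) 0)
    (col_mx (row_mx (row_mx 0 1%:M) (row_mx theta 0)) (row_mx (row_mx 0 1%:M) (row_mx 0 1%:M))).

Lemma slot2E (z : 'cV[R]_n2) : slot2 *m z = col_mx (theta *m usubmx z) (col_mx 0 (dsubmx z)).
Proof. by rewrite -{1}[z]vsubmxK /slot2 !mul_col_mx !mul_row_col !mul0mx !mul1mx !addr0 !add0r. Qed.

Lemma slot_lE (z y : 'cV[R]_n2) : slot_l *m col_mx z y =
  col_mx (theta *m usubmx z + theta *m usubmx y) (col_mx (theta *m usubmx z + dsubmx y) (dsubmx z)).
Proof.
rewrite -{1}[z]vsubmxK -{1}[y]vsubmxK /slot_l !mul_col_mx.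
by rewrite !mul_row_col !mul0mx !mul1mx !addr0 !add0r.
Qed.

Lemma slot_rE (z y : 'cV[R]_n2) : slot_r *m col_mx z y =
  col_mx (theta *m usubmx z) (col_mx (dsubmx z + theta *m usubmx y) (dsubmx z + dsubmx y)).
Proof.
rewrite -{1}[z]vsubmxK -{1}[y]vsubmxK /slot_r !mul_col_mx.
by rewrite !mul_row_col !mul0mx !mul1mx !addr0 !add0r.
Qed.

Lemma slot_shear (z : 'cV[R]_(n2 + n2)) : slot_r *m (shear R n *m z) = slot_l *m z.
Proof.
rewrite [z]col4K shear_col slot_rE slot_lE !col_mxKu !col_mxKd mulmxDr.
congr (col_mx _ (col_mx _ _)); first by rewrite addrC.
by rewrite addrC subrK.
Qed.

End SlotMatrices.

Section DeformedModule.
Context {R : realType} (n : nat) (M : 'M[R]_n).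
Hypothesis hM : `|\det M| = 1.
Variables (A E : tvsType R[i]).
Hypotheses (hausA : hausdorff_space A) (hausE : hausdorff_space E).
Hypotheses (complA : sequentially_complete A) (complE : sequentially_complete E).
Variables (nu : A -> E -> E).
Hypotheses (nu_bilin : bilinear_map nu) (nu_cont : separately_continuous nu).
Variables (QA : set (A -> R)) (QE : set (E -> R)).
Hypotheses (QA_def : defining_system QA) (QE_def : defining_system QE).
Variables (mA : (A -> R) -> R) (alpha : 'cV[R]_n -> A -> A).
Hypothesis alpha_act : smooth_poly_bounded_action QA mA alpha.
Variables (mE : (E -> R) -> R) (beta : 'cV[R]_n -> E -> E).
Hypothesis beta_act : smooth_poly_bounded_action QE mE beta.
Hypothesis beta_cov : forall x a psi, beta x (nu a psi) = nu (alpha x a) (beta x psi).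
Variable theta : 'M[R]_n.

Lemma growth_csn (V : tvsType R[i]) (Q : set (V -> R)) N r (F : 'cV[R]_N -> V) : defining_system Q ->
  growth (csn V) r F -> growth Q r F.
Proof. by move=> Qdef [sF HF]; split=> // q Hq; apply: HF; exact: (csn_Q Qdef). Qed.

Definition integrand (a : A) (psi : E) (z : 'cV[R]_(n + n)) : E :=
  nu (alpha (theta *m usubmx z) a) (beta (dsubmx z) psi).

(* Any r in ]0, 1/2[ would do. *)
Let r : R := 4^-1.
Let r_gt0 : 0 < r. Proof. by rewrite invr_gt0. Qed.
Let r0 : 0 <= r. Proof. exact: ltW. Qed.
Let r1 : r < 2^-1. Proof. by rewrite ltf_pV2 ?posrE // ltr_nat. Qed.

Lemma growth_integrand a psi : growth QE r (integrand a psi).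
Proof.
apply: (growth_csn QE_def).
have := growth_mul (csn_def QE_def) hausE (slot2 theta) r0
  (growth_two hausA hausE nu_bilin nu_cont QA_def QE_def alpha_act beta_act beta_cov a psi r_gt0).
rewrite (_ : (fun y => _) = integrand a psi) //; apply/funext => z.
by rewrite /two slot2E /su /sw !col_mxKd col_mxKu.
Qed.

Lemma deformed_cvg a psi :
  osc0 M (fun z => (cut j z : R[i]) *: integrand a psi z) @[j --> \oo] --> deformed QE M theta alpha beta nu a psi.
Proof. exact: (oscint_cvg QE_def hausE complE hM r0 r1 (growth_integrand a psi)). Qed.

Lemma deformed_bilin : bilinear_map (deformed QE M theta alpha beta nu).
Proof.
have [nul nur] := nu_bilin; split=> [a|psi] c x y.
  apply: (oscint_lin QE_def hausE complE hM r0 r1 (growth_integrand a x) (growth_integrand a y)) => z.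
  by rewrite /integrand (act_lin beta_act) nul.
apply: (oscint_lin QE_def hausE complE hM r0 r1 (growth_integrand x psi) (growth_integrand y psi)) => z.
by rewrite /integrand (act_lin alpha_act) nur.
Qed.

Lemma cont_integrand a psi : continuous (integrand a psi).
Proof. by apply: smooth_cont; have [] := growth_integrand a psi. Qed.

End DeformedModule.

Section DeformedAssociativity.
Context {R : realType} (n : nat) (M : 'M[R]_n).
Hypothesis hM : `|\det M| = 1.
Variables (A E : tvsType R[i]).
Hypotheses (hausA : hausdorff_space A) (hausE : hausdorff_space E).
Hypotheses (complA : sequentially_complete A) (complE : sequentially_complete E).
Variables (mu : A -> A -> A) (nu : A -> E -> E).
Hypotheses (mu_bilin : bilinear_map mu) (mu_cont : separately_continuous mu).
Hypotheses (nu_bilin : bilinear_map nu) (nu_cont : separately_continuous nu).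
Hypothesis nuA : forall a b psi, nu (mu a b) psi = nu a (nu b psi).
Variables (QA : set (A -> R)) (QE : set (E -> R)).
Hypotheses (QA_def : defining_system QA) (QE_def : defining_system QE).
Variables (mA : (A -> R) -> R) (alpha : 'cV[R]_n -> A -> A).
Hypothesis alpha_act : smooth_poly_bounded_action QA mA alpha.
Hypothesis alpha_aut : acts_multiplicatively mu alpha.
Variables (mE : (E -> R) -> R) (beta : 'cV[R]_n -> E -> E).
Hypothesis beta_act : smooth_poly_bounded_action QE mE beta.
Hypothesis beta_cov : forall x a psi, beta x (nu a psi) = nu (alpha x a) (beta x psi).
Variable theta : 'M[R]_n.

(** Both sides are iterated oscillatory integrals of the one function [three], composed with
    [slot_l] and [slot_r], which the shear exchanges; [iterated_eq] then applies. *)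
Lemma deformed_assoc a b psi :
  deformed QE M theta alpha beta nu (deformed QA M theta alpha alpha mu a b) psi =
  deformed QE M theta alpha beta nu a (deformed QE M theta alpha beta nu b psi).
Proof.
have r_gt0 : (0 : R) < 4^-1 by rewrite invr_gt0.
have r0 := ltW r_gt0; have r1 : (4^-1 : R) < 2^-1 by rewrite ltf_pV2 ?posrE // ltr_nat.
have g3 := growth_three hausA hausE mu_bilin mu_cont nu_bilin nu_cont nuA QA_def QE_def alpha_act alpha_aut beta_act beta_cov a b psi r_gt0.
have gG := growth_csn QE_def (growth_mul (csn_def QE_def) hausE (slot_l theta) r0 g3).
have gGt := growth_csn QE_def (growth_mul (csn_def QE_def) hausE (slot_r theta) r0 g3).
have [nul nur] := nu_bilin; have [nulc nurc] := nu_cont.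
have cA := act_cont QA_def alpha_act; have cE := act_cont QE_def beta_act.
have lA := act_lin alpha_act; have lE := act_lin beta_act.
apply: (iterated_eq QE_def hausE complE hM r0 r1 gG gGt _
  (f := integrand nu alpha beta theta (deformed QA M theta alpha alpha mu a b) psi)
  (ft := integrand nu alpha beta theta a (deformed QE M theta alpha beta nu b psi))).
- by move=> z; rewrite slot_shear.
- exact: (cont_integrand hausA hausE nu_bilin nu_cont QA_def QE_def alpha_act beta_act beta_cov).
- exact: (cont_integrand hausA hausE nu_bilin nu_cont QA_def QE_def alpha_act beta_act beta_cov).
(* For fixed outer variables T is linear and continuous, so it carries the limit defining the inner
   deformed product to a limit of integrals of [three]. *)
- move=> z; pose T v := nu (alpha (theta *m usubmx z) v) (beta (dsubmx z) psi).
  have lT : linear T := comp_lin (lA _) (nur _).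
  have cT : continuous T := comp_cont (@cA _) (@nurc _).
  have ci := cont_integrand hausA hausA mu_bilin mu_cont QA_def QA_def alpha_act alpha_act alpha_aut (theta := theta) (a := a) (psi := b).
  have H : osc0 M (fun z => (cut j z : R[i]) *: integrand mu alpha alpha theta a b z) @[j --> \oo] --> deformed QA M theta alpha alpha mu a b.
    exact: (deformed_cvg hM hausA hausA complA mu_bilin mu_cont QA_def QA_def alpha_act alpha_act alpha_aut).
  apply: (cvg_eqn _ (cvg_lin cT H)); apply: filterE => j.
  rewrite (osc0_lin QA_def QE_def hausA hausE complA complE M j lT cT ci); congr osc0; apply/funext => y.
  rewrite /T /integrand /three slot_lE /su /sv /sw !col_mxKd !col_mxKu; congr (_ *: _).
  by rewrite alpha_aut -!(actD alpha_act) nuA.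
- move=> z; pose T v := nu (alpha (theta *m usubmx z) a) (beta (dsubmx z) v).
  have lT : linear T := comp_lin (lE _) (nul _).
  have cT : continuous T := comp_cont (@cE _) (@nulc _).
  have ci := cont_integrand hausA hausE nu_bilin nu_cont QA_def QE_def alpha_act beta_act beta_cov (theta := theta) (a := b) (psi := psi).
  have H : osc0 M (fun z => (cut j z : R[i]) *: integrand nu alpha beta theta b psi z) @[j --> \oo] --> deformed QE M theta alpha beta nu b psi.
    exact: (deformed_cvg hM hausA hausE complE nu_bilin nu_cont QA_def QE_def alpha_act beta_act beta_cov).
  apply: (cvg_eqn _ (cvg_lin cT H)); apply: filterE => j.
  rewrite (osc0_lin QE_def QE_def hausE hausE complE complE M j lT cT ci); congr osc0; apply/funext => y.
  rewrite /T /integrand /three slot_rE /su /sv /sw !col_mxKd !col_mxKu; congr (_ *: _).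
  by rewrite beta_cov -(actD alpha_act) -(actD beta_act).
- exact: (deformed_cvg hM hausA hausE complE nu_bilin nu_cont QA_def QE_def alpha_act beta_act beta_cov).
- exact: (deformed_cvg hM hausA hausE complE nu_bilin nu_cont QA_def QE_def alpha_act beta_act beta_cov).
Qed.

End DeformedAssociativity.

Unset Implicit Arguments.

Theorem theorem4p9 (R : realType) (n : nat)
  (M : 'M[R]_n) (hM : `|\det M| = 1)
  (A E : tvsType R[i])
  (hausA : hausdorff_space A) (hausE : hausdorff_space E)
  (complA : sequentially_complete A) (complE : sequentially_complete E)
  (mu : A -> A -> A) (mu_bilin : bilinear_map mu)
  (mu_cont : separately_continuous mu)
  (nu : A -> E -> E) (nu_module : left_module mu nu)
  (nu_cont : separately_continuous nu)
  (QA : set (A -> R)) (QA_def : defining_system QA) (QA_filt : filtrating QA)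
  (QE : set (E -> R)) (QE_def : defining_system QE) (QE_filt : filtrating QE)
  (mA : (A -> R) -> R) (alpha : 'cV[R]_n -> A -> A)
  (alpha_act : smooth_poly_bounded_action QA mA alpha)
  (alpha_aut : acts_multiplicatively mu alpha)
  (mE : (E -> R) -> R) (beta : 'cV[R]_n -> E -> E)
  (beta_act : smooth_poly_bounded_action QE mE beta)
  (beta_cov : forall x a psi, beta x (nu a psi) = nu (alpha x a) (beta x psi))
  (theta : 'M[R]_n) :
  let mu_theta : A -> A -> A := deformed QA M theta alpha alpha mu in
  let nu_theta : A -> E -> E := deformed QE M theta alpha beta nu in
  left_module mu_theta nu_theta /\
  (associative mu -> associative mu_theta).
Proof.
have [nu_bilin nuA] := nu_module; split.
  split; first exact: (deformed_bilin hM hausA hausE complE nu_bilin nu_cont QA_def QE_def alpha_act beta_act beta_cov).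
  exact: (deformed_assoc hM hausA hausE complA complE mu_bilin mu_cont nu_bilin nu_cont nuA QA_def QE_def alpha_act alpha_aut beta_act beta_cov).
(* An associative algebra is a left module over itself, with alpha in the role of beta.
   [associative] has the sides of the module identity in the opposite order, hence the
   symmetries. *)
move=> muA a b c; apply/esym.
exact: (deformed_assoc hM hausA hausA complA complA mu_bilin mu_cont mu_bilin mu_cont (fun x y z => esym (muA x y z)) QA_def QA_def alpha_act alpha_aut alpha_act alpha_aut).
Qed.
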